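(* Let $n\in\{8,16,24\}$ and let $L\subseteq\mathbb{R}^n$ be an even unimodular lattice. Then for every $\alpha>0$ the lattice $L$ is a critical point of the $f_\alpha$-potential energy on the manifold of rank $n$ lattices of point density $1$.
   Context: A lattice $L\subseteq\mathbb{R}^n$ (discrete subgroup of full rank) is unimodular if it equals its dual $L^*=\{y\in\mathbb{R}^n: x\cdot y\in\mathbb{Z}\ \forall x\in L\}$, and even if $x\cdot x$ is an even integer for all $x\in L$. For $\alpha>0$ let $f_\alpha(r)=e^{-\alpha r}$ and $\mathcal{E}(f_\alpha,L)=\sum_{x\in L\setminus\{0\}}e^{-\alpha\|x\|^2}$. The manifold of rank $n$ lattices of point density $1$ (one lattice point per unit volume) is parametrized by positive definite symmetric $n\times n$ matrices $Y$ of determinant $1$: with $L$ fixed (of density $1$), the energy function is $F_{\alpha,L}(Y)=\sum_{x\in L\setminus\{0\}}e^{-\alpha x^{\mathsf T}Yx}$, with $L$ itself corresponding to $Y=I_n$. The tangent space at $I_n$ is the space of symmetric matrices $H$ of trace zero. $L$ is critical for the $f_\alpha$-potential energy if the gradient at $I_n$ vanishes, i.e. $-\alpha\sum_{x\in L\setminus\{0\}}(x^{\mathsf T}Hx)\,e^{-\alpha\|x\|^2}=0$ for every symmetric trace-zero matrix $H$. *)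

(* Defs.v *)
From HB Require Import structures.
From mathcomp Require Import all_boot all_order all_algebra.
From mathcomp Require Import all_classical all_reals all_analysis.

Set Implicit Arguments.
Unset Strict Implicit.
Unset Printing Implicit Defensive.

Import Order.TTheory GRing.Theory Num.Theory.
Import numFieldNormedType.Exports.

Local Open Scope classical_set_scope.
Local Open Scope ring_scope.

(* Vectors of R^n are column vectors. *)

Definition dot (R : realType) (n : nat) (x y : 'cV[R]_n) : R :=
  (x^T *m y) 0 0.

Definition qform (R : realType) (n : nat) (Y : 'M[R]_n) (x : 'cV[R]_n) : R :=
  (x^T *m Y *m x) 0 0.

(* The matrix B collects, as its columns, n linearly independent lattice
   vectors; they need not generate L. *)
Definition is_lattice (R : realType) (n : nat) (L : set 'cV[R]_n) : Prop :=
  [/\ L 0,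
      forall x y, L x -> L y -> L (x - y),
      L `<=` isolated L
    & exists2 B : 'M[R]_n, B \in unitmx & forall j, L (col j B)].

Definition dual_lattice (R : realType) (n : nat) (L : set 'cV[R]_n) :
    set 'cV[R]_n :=
  [set y | forall x, L x -> dot x y \is a Num.int].

Definition unimodular (R : realType) (n : nat) (L : set 'cV[R]_n) : Prop :=
  L = dual_lattice L.

Definition even_lattice (R : realType) (n : nat) (L : set 'cV[R]_n) : Prop :=
  forall x, L x -> exists k : int, dot x x = (2 * k)%:~R.

(* The unordered sum of a real family: for a summable family this is the
   difference of the sums of its positive and negative parts.  It is a junk
   value as soon as one of the two parts is infinite. *)
Definition lattice_sum (R : realType) (n : nat) (D : set 'cV[R]_n)
    (f : 'cV[R]_n -> R) : R :=
  fine (\esum_(x in D) (Num.max (f x) 0)%:E)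
  - fine (\esum_(x in D) (Num.max (- f x) 0)%:E).

Definition gauss (R : realType) (alpha r : R) : R := expR (- (alpha * r)).

(* F_{alpha,L}(Y) *)
Definition energy (R : realType) (n : nat) (alpha : R) (L : set 'cV[R]_n)
    (Y : 'M[R]_n) : R :=
  lattice_sum (L `\ 0) (fun x => gauss alpha (qform Y x)).

(* The manifold of rank n lattices of point density 1: a matrix Y
   stands for the lattice obtained from L by replacing the squared
   norm x |-> dot x x with x |-> qform Y x. *)
Definition density1 (R : realType) (n : nat) : set 'M[R]_n :=
  [set Y | [/\ Y^T = Y, forall x, x != 0 -> 0 < qform Y x & \det Y = 1]].

(* The tangent space of density1 at 1%:M. *)
Definition tangent (R : realType) (n : nat) : set 'M[R]_n :=
  [set H | H^T = H /\ \tr H = 0].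

Definition curve_along (R : realType) (n : nat) (H : 'M[R]_n)
    (g : R -> 'M[R]_n) : Prop :=
  [/\ forall t, density1 (g t), g 0 = 1%:M & is_derive (0 : R) 1 g H].

Definition gradient_term (R : realType) (n : nat) (alpha : R) (H : 'M[R]_n)
    (x : 'cV[R]_n) : R :=
  qform H x * gauss alpha (dot x x).

(* The inner product of the gradient of energy alpha L at 1%:M with H. *)
Definition gradient_along (R : realType) (n : nat) (alpha : R)
    (L : set 'cV[R]_n) (H : 'M[R]_n) : R :=
  - alpha * lattice_sum (L `\ 0) (gradient_term alpha H).

(* The first two clauses say that the differential at 1%:M of the energy,
   restricted to the manifold density1, exists and is given by an absolutely
   convergent series; the last one says that it vanishes. *)
Definition critical (R : realType) (n : nat) (alpha : R)
    (L : set 'cV[R]_n) : Prop :=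
  forall H : 'M[R]_n, tangent H ->
    [/\ summable (L `\ 0) (fun x => (gradient_term alpha H x)%:E),
        forall g : R -> 'M[R]_n, curve_along H g ->
          is_derive (0 : R) 1 (fun t => energy alpha L (g t))
                    (gradient_along alpha L H)
      & gradient_along alpha L H = 0].

(* Main.v *)
Require Import Defs.
From mathcomp Require Import all_boot all_order all_algebra.
From mathcomp Require Import all_classical all_reals all_analysis.
From mathcomp Require Import complex finmap zify ring lra.

Set Implicit Arguments.
Unset Strict Implicit.
Unset Printing Implicit Defensive.

Import Order.TTheory GRing.Theory Num.Theory.
Import numFieldNormedType.Exports.

Local Open Scope classical_set_scope.
Local Open Scope ring_scope.
Local Open Scope complex_scope.

(* For a symmetric H of trace zero the polynomial P(x) = x^T H x is harmonic, so
   theta(w) = sum_(x in L) P(x) exp(- pi w |x|^2), Re w > 0, is up to the variable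
   change tau = i w a cusp form of weight k = n/2 + 2 in {6, 10, 14} for the full
   modular group, and there is none.  Criticality is theta(alpha / pi) = 0 together
   with termwise differentiation of the energy.

   The inversion formula is Poisson summation.  An orthogonal frame of vectors of
   L presents L as a union of cosets of a rectangular lattice, described by a
   self-dual code, which reduces it to Gaussian sums in one variable; there it is
   a discrete Fourier transform on N points, with N tending to infinity, whose
   coefficients are Riemann sums evaluated by shifting the contour.

   Vanishing needs no valence formula.  As k is 2 mod 4, the inversion formula
   forces theta(1) = 0, and this eliminates the first Fourier coefficient.  The
   remaining ones are bounded by the supremum of |theta| on the line Re w = 1/2,
   so that on the fundamental domain |theta(w)| (Re w)^(k/2) is at most 97/100 of
   its own supremum. *)

(** * Complex modulus, exponential and derivatives *)

(** No integral occurs in the proof. Contour shifts act on finite Riemann sums, and the Gaussian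
    moments that they produce stay unevaluated until Poisson summation with lam = 1 and b = 0 forces
    the zeroth one to tend to 1; a Riemann sum of a derivative then gives the second. The covolume
    of L is likewise never computed: the constant of the inversion formula is only known to be
    positive, and two inversions rule out every value but 1 unless theta vanishes.

    The supremum argument cannot start on the whole half-plane, since nothing bounds |theta(w)| (Re
    w)^(k/2) near Re w = 0 beforehand. It runs on Re w >= e with an arbitrary e <= 1/2; the moves
    used there never decrease Re w, so they stay in this region. The threshold 43/50 is a rational
    just below sqrt 3 / 2, the least Re w on the fundamental domain. The numerical margin has to
    depend on n: n = 32 gives weight 18, where a nonzero cusp form exists. *)

Section ComplexBasics.
Variable R : realType.
Local Notation C := R[i].
Implicit Types (x y t : R) (z u v : C).

Definition cabs z : R := Normc.normc z.

Lemma cabs_ge0 z : 0 <= cabs z.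
Proof. by case: z => a b; exact: sqrtr_ge0. Qed.

Lemma cabs0 : cabs 0 = 0. Proof. exact: Normc.normc0. Qed.

Lemma cabs1 : cabs 1 = 1. Proof. exact: Normc.normc1. Qed.

Lemma cabs_eq0 z : (cabs z == 0) = (z == 0).
Proof.
by apply/eqP/eqP => [/Normc.eq0_normc//|->]; exact: cabs0.
Qed.

Lemma cabsD z u : cabs (z + u) <= cabs z + cabs u.
Proof. exact: le_normcD. Qed.

Lemma cabsN z : cabs (- z) = cabs z. Proof. exact: normcN. Qed.

Lemma cabsB z u : cabs (z - u) <= cabs z + cabs u.
Proof. by rewrite -(cabsN u); exact: cabsD. Qed.

Lemma cabsBC z u : cabs (z - u) = cabs (u - z).
Proof. by rewrite -cabsN opprB. Qed.

Lemma cabsM z u : cabs (z * u) = cabs z * cabs u.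
Proof. exact: Normc.normcM. Qed.

Lemma cabsV z : cabs z^-1 = (cabs z)^-1.
Proof. exact: Normc.normcV. Qed.

Lemma cabsX z n : cabs (z ^+ n) = cabs z ^+ n.
Proof. by elim: n => [|n ih]; rewrite ?expr0 ?cabs1// !exprS cabsM ih. Qed.

Lemma cabs_real x : cabs x%:C = `|x|.
Proof. by rewrite /cabs /= expr0n /= addr0 sqrtr_sqr. Qed.

Lemma cabs_sum I (r : seq I) (P : pred I) (F : I -> C) :
  cabs (\sum_(i <- r | P i) F i) <= \sum_(i <- r | P i) cabs (F i).
Proof.
elim/big_rec2: _ => [|i x z _ h]; first by rewrite cabs0.
by apply: le_trans (cabsD _ _) _; rewrite lerD2l.
Qed.

Lemma cabs_prod I (r : seq I) (P : pred I) (F : I -> C) :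
  cabs (\prod_(i <- r | P i) F i) = \prod_(i <- r | P i) cabs (F i).
Proof. by apply: (big_morph cabs) => [z u|]; [exact: cabsM|exact: cabs1]. Qed.

Lemma sqr_cabs z : cabs z ^+ 2 = complex.Re z ^+ 2 + complex.Im z ^+ 2.
Proof. by case: z => a b; rewrite /cabs /= sqr_sqrtr ?addr_ge0 ?sqr_ge0. Qed.

Lemma Re_le_cabs z : `|complex.Re z| <= cabs z.
Proof.
by case: z => a b; rewrite /cabs /= -sqrtr_sqr ler_wsqrtr// lerDl sqr_ge0.
Qed.

Lemma Im_le_cabs z : `|complex.Im z| <= cabs z.
Proof.
by case: z => a b; rewrite /cabs /= -sqrtr_sqr ler_wsqrtr// lerDr sqr_ge0.
Qed.

Lemma cabs_le_ReIm z : cabs z <= `|complex.Re z| + `|complex.Im z|.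
Proof.
case: z => a b; have -> : Complex a b = a%:C + Complex 0 b.
  by rewrite /GRing.add/= addr0 add0r.
apply: le_trans (cabsD _ _) _; rewrite cabs_real /=.
by rewrite /cabs /= expr0n/= add0r sqrtr_sqr add0r addr0.
Qed.

Lemma cRe_sum I (r : seq I) (P : pred I) (F : I -> C) :
  complex.Re (\sum_(i <- r | P i) F i) = \sum_(i <- r | P i) complex.Re (F i).
Proof. by apply: (big_morph (@complex.Re R)) => // -[a b] [c d]. Qed.

Lemma cIm_sum I (r : seq I) (P : pred I) (F : I -> C) :
  complex.Im (\sum_(i <- r | P i) F i) = \sum_(i <- r | P i) complex.Im (F i).
Proof. by apply: (big_morph (@complex.Im R)) => // -[a b] [c d]. Qed.

Definition cexp z : C :=
  Complex (expR (complex.Re z) * cos (complex.Im z))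
          (expR (complex.Re z) * sin (complex.Im z)).

Lemma cexpD z u : cexp (z + u) = cexp z * cexp u.
Proof.
case: z u => [a b] [c d]; rewrite /cexp /= expRD cosD sinD.
by apply/eqP; rewrite eq_complex /=; apply/andP; split; apply/eqP; ring.
Qed.

Lemma cexp0 : cexp 0 = 1.
Proof. by rewrite /cexp /= expR0 cos0 sin0 mulr1 mulr0. Qed.

Lemma cabs_cexp z : cabs (cexp z) = expR (complex.Re z).
Proof.
rewrite /cabs /cexp /= !exprMn -mulrDr cos2Dsin2 mulr1 sqrtr_sqr.
by rewrite ger0_norm// expR_ge0.
Qed.

Lemma cexp_neq0 z : cexp z != 0.
Proof. by rewrite -cabs_eq0 cabs_cexp gt_eqF// expR_gt0. Qed.

Lemma cexpN z : cexp (- z) = (cexp z)^-1.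
Proof.
by apply: (mulIf (cexp_neq0 z)); rewrite -cexpD addNr cexp0 mulVf// cexp_neq0.
Qed.

Lemma cexp_real x : cexp x%:C = (expR x)%:C.
Proof. by rewrite /cexp /= cos0 sin0 mulr1 mulr0. Qed.

Lemma cexpMn z n : cexp (z *+ n) = cexp z ^+ n.
Proof.
elim: n => [|n ih]; first by rewrite mulr0n expr0 cexp0.
by rewrite mulrS cexpD ih exprS.
Qed.

Lemma cexp_sum I (r : seq I) (P : pred I) (F : I -> C) :
  cexp (\sum_(i <- r | P i) F i) = \prod_(i <- r | P i) cexp (F i).
Proof. by apply: (big_morph cexp) => [z u|]; [exact: cexpD|exact: cexp0]. Qed.

Definition cexp2pi x : C := cexp (Complex 0 (2 * pi * x)).

Lemma cexp2piD x y : cexp2pi (x + y) = cexp2pi x * cexp2pi y.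
Proof.
rewrite /cexp2pi -cexpD; congr cexp; apply/eqP; rewrite eq_complex /=.
by apply/andP; split; apply/eqP; ring.
Qed.

Lemma cexp2pi0 : cexp2pi 0 = 1.
Proof. by rewrite /cexp2pi mulr0 cexp0. Qed.

Lemma cabs_cexp2pi x : cabs (cexp2pi x) = 1.
Proof. by rewrite cabs_cexp /= expR0. Qed.

Lemma cexp2piN x : cexp2pi (- x) = (cexp2pi x)^-1.
Proof.
rewrite /cexp2pi -cexpN; congr cexp; apply/eqP; rewrite eq_complex /=.
by apply/andP; split; apply/eqP; ring.
Qed.

Lemma cexp2pi_nat n : cexp2pi n%:R = 1.
Proof.
elim: n => [|n ih]; first exact: cexp2pi0.
rewrite -addn1 natrD cexp2piD ih mul1r /cexp2pi /cexp /= mulr1 expR0.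
by rewrite !mul1r mulr_natl cos2pi sin2pi.
Qed.

Lemma cexp2pi_int (k : int) : cexp2pi k%:~R = 1.
Proof.
case: k => n; first exact: cexp2pi_nat.
by rewrite NegzE mulrNz cexp2piN cexp2pi_nat invr1.
Qed.

Lemma cexp2pi_sum I (r : seq I) (P : pred I) (F : I -> R) :
  cexp2pi (\sum_(i <- r | P i) F i) = \prod_(i <- r | P i) cexp2pi (F i).
Proof.
by apply: (big_morph cexp2pi) => [x y|]; [exact: cexp2piD|exact: cexp2pi0].
Qed.

Lemma cexp2piMn x n : cexp2pi (x *+ n) = cexp2pi x ^+ n.
Proof.
elim: n => [|n ih]; first by rewrite mulr0n expr0 cexp2pi0.
by rewrite mulrS cexp2piD ih exprS.
Qed.

(** On the fractional part r one has cos (2 pi r) = 1 - 2 sin (pi r)^2, and sin (pi r) > 0 for 0 < r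
    < 1. *)
Lemma cexp2pi_eq1 x : cexp2pi x = 1 -> x \is a Num.int.
Proof.
pose k := Num.floor x; pose r := x - k%:~R.
have r0 : 0 <= r by rewrite subr_ge0; exact: floor_le.
have r1 : r < 1 by rewrite ltrBlDl; have := floorD1_gt x; rewrite intrD.
have -> : x = r + k%:~R by rewrite subrK.
rewrite cexp2piD cexp2pi_int mulr1 => e1.
suff -> : r = 0 by rewrite add0r intr_int.
apply/eqP/negPn/negP => rn0.
have {}r0 : 0 < r by rewrite lt0r rn0.
move/(congr1 (@complex.Re R)): e1; rewrite /cexp2pi /cexp /= expR0 mul1r => e1.
have : sin (pi * r) > 0 :> R.
  by apply: sin_gt0_pi; rewrite mulr_gt0 ?pi_gt0//= -[ltRHS]mulr1 ltr_pM2l ?pi_gt0.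
have := e1; rewrite (_ : 2 * pi * r = (pi * r) *+ 2); last by ring.
rewrite cos_mulr2n cos2sin2 => {}e1 s0.
have : sin (pi * r) ^+ 2 = 0 :> R by lra.
by move/eqP; rewrite sqrf_eq0 gt_eqF.
Qed.

Definition cderiv (f : R -> C) t (d : C) : Prop :=
  is_derive t 1 (fun x => complex.Re (f x)) (complex.Re d) /\
  is_derive t 1 (fun x => complex.Im (f x)) (complex.Im d).

Lemma cderiv_eq f t d d' : cderiv f t d -> d = d' -> cderiv f t d'.
Proof. by move=> h <-. Qed.

Lemma cderiv_ext f g t d : f =1 g -> cderiv f t d -> cderiv g t d.
Proof. by move=> /funext ->. Qed.

Lemma cderiv_cst z t : cderiv (fun=> z) t 0.
Proof. by split; apply: is_derive_cst. Qed.

Lemma cderiv_id t : cderiv (fun x => x%:C) t 1.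
Proof. by split; [exact: is_derive_id|exact: is_derive_cst]. Qed.

Lemma cderivD f g t a b :
  cderiv f t a -> cderiv g t b -> cderiv (fun x => f x + g x) t (a + b).
Proof.
move=> [f1 f2] [g1 g2]; split.
  have -> : (fun x => complex.Re (f x + g x)) =
    (fun x => complex.Re (f x)) + (fun x => complex.Re (g x)).
    by apply/funext => x; rewrite /GRing.add /=; case: (f x) (g x) => [? ?] [? ?].
  rewrite (_ : complex.Re (a + b) = complex.Re a + complex.Re b).
    exact: is_deriveD.
  by case: a b {f1 f2 g1 g2} => [? ?] [? ?].
have -> : (fun x => complex.Im (f x + g x)) =
  (fun x => complex.Im (f x)) + (fun x => complex.Im (g x)).
  by apply/funext => x; rewrite /GRing.add /=; case: (f x) (g x) => [? ?] [? ?].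
rewrite (_ : complex.Im (a + b) = complex.Im a + complex.Im b).
  exact: is_deriveD.
by case: a b {f1 f2 g1 g2} => [? ?] [? ?].
Qed.

Lemma cderivM f g t a b : cderiv f t a -> cderiv g t b ->
  cderiv (fun x => f x * g x) t (a * g t + f t * b).
Proof.
move=> [f1 f2] [g1 g2]; split.
  have -> : (fun x => complex.Re (f x * g x)) =
    (fun x => complex.Re (f x)) * (fun x => complex.Re (g x)) -
    (fun x => complex.Im (f x)) * (fun x => complex.Im (g x)).
    apply/funext => x; rewrite [RHS]/GRing.add /= /GRing.opp /= {2 3}/GRing.mul /=.
    by case: (f x) (g x) => [? ?] [? ?].
  apply: is_derive_eq.
  by rewrite /GRing.scale /=; case: a b (f t) (g t) {f1 f2 g1 g2} =>
    [? ?] [? ?] [? ?] [? ?] /=; ring.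
have -> : (fun x => complex.Im (f x * g x)) =
  (fun x => complex.Re (f x)) * (fun x => complex.Im (g x)) +
  (fun x => complex.Im (f x)) * (fun x => complex.Re (g x)).
  apply/funext => x; rewrite [RHS]/GRing.add /= {2 3}/GRing.mul /=.
  by case: (f x) (g x) => [? ?] [? ?] /=.
apply: is_derive_eq.
by rewrite /GRing.scale /=; case: a b (f t) (g t) {f1 f2 g1 g2} =>
  [? ?] [? ?] [? ?] [? ?] /=; ring.
Qed.

Lemma cderiv_sum I (r : seq I) (F : I -> R -> C) (D : I -> C) t :
  (forall i, cderiv (F i) t (D i)) ->
  cderiv (fun x => \sum_(i <- r) F i x) t (\sum_(i <- r) D i).
Proof.
move=> h; elim: r => [|i r ih].
  rewrite big_nil; apply: cderiv_ext (cderiv_cst 0 t) => x.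
  by rewrite big_nil.
rewrite big_cons; apply: cderiv_ext (cderivD (h i) ih) => x.
by rewrite big_cons.
Qed.

Lemma cderivX f t a n : cderiv f t a ->
  cderiv (fun x => f x ^+ n) t (n%:R * f t ^+ n.-1 * a).
Proof.
move=> h; elim: n => [|n ih].
  by rewrite !mul0r; exact: cderiv_cst.
apply: cderiv_ext (cderiv_eq (cderivM h ih) _) => [x|]; first by rewrite -exprS.
by case: n {ih} => [|n] /=; rewrite ?exprS; ring.
Qed.

Lemma cderiv_cexp f t a : cderiv f t a ->
  cderiv (fun x => cexp (f x)) t (a * cexp (f t)).
Proof.
move=> [f1 f2].
have e1 := is_derive1_comp (is_derive_expR (complex.Re (f t))) f1.
have e2 := is_derive1_comp (is_derive_cos (complex.Im (f t))) f2.
have e3 := is_derive1_comp (is_derive_sin (complex.Im (f t))) f2.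
split => /=.
  have -> : (fun x => expR (complex.Re (f x)) * cos (complex.Im (f x))) =
    (expR \o (fun x => complex.Re (f x))) * (cos \o (fun x => complex.Im (f x))).
    by [].
  apply: is_derive_eq; rewrite /GRing.scale /=.
  by case: (f t) a {f1 f2 e1 e2 e3} => [? ?] [? ?] /=; ring.
have -> : (fun x => expR (complex.Re (f x)) * sin (complex.Im (f x))) =
  (expR \o (fun x => complex.Re (f x))) * (sin \o (fun x => complex.Im (f x))).
  by [].
apply: is_derive_eq; rewrite /GRing.scale /=.
by case: (f t) a {f1 f2 e1 e2 e3} => [? ?] [? ?] /=; ring.
Qed.

Lemma cabs_unit_dir z : exists2 u, cabs u = 1 & complex.Re (u * z) = cabs z.
Proof.
have [->|z0] := eqVneq z 0; first by exists 1; rewrite ?cabs1// mulr0 cabs0.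
have cz0 : cabs z != 0 by rewrite cabs_eq0.
exists (z^*%C / (cabs z)%:C).
  rewrite cabsM cabsV cabs_real ger0_norm ?cabs_ge0//.
  suff -> : cabs z^*%C = cabs z by rewrite divff.
  by case: z {z0 cz0} => a b; rewrite /cabs /= sqrrN.
have h := sqr_cabs z.
rewrite mulrAC -fmorphV /=.
case: z z0 cz0 h => a b /= _ cz0 h.
rewrite (_ : _ - _ = cabs (Complex a b) ^+ 2 / cabs (Complex a b)); last first.
  by rewrite h; ring.
by rewrite expr2 mulfK.
Qed.

(* The mean value inequality follows from the real mean value theorem
   applied to Re (u f) for a unit u aligning the increment of f with R. *)
Lemma cabs_mvt f (df : R -> C) (a b M : R) : a <= b ->
  (forall x, a <= x <= b -> cderiv f x (df x)) ->
  (forall x, a <= x <= b -> cabs (df x) <= M) ->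
  cabs (f b - f a) <= M * (b - a).
Proof.
rewrite le_eqVlt => /predU1P[<- _ _|ab fdf dfM].
  by rewrite !subrr cabs0 mulr0.
have [u u1 uE] := cabs_unit_dir (f b - f a).
pose g x := complex.Re (u * f x).
have gdg x : a <= x <= b -> is_derive x 1 g (complex.Re (u * df x)).
  move=> /fdf h; have [+ _] := cderivM (cderiv_cst u x) h.
  by rewrite mul0r add0r.
have [||c /andP[ac cb] gE] := @MVT R g (fun x => complex.Re (u * df x)) a b ab.
- by move=> x; rewrite in_itv/= => /andP[ax xb]; apply: gdg; rewrite !ltW.
- apply: derivable_within_continuous => x; rewrite in_itv/= => /gdg h.
  exact: ex_derive.
have -> : cabs (f b - f a) = g b - g a.
  by rewrite -uE mulrBr /g; case: (u * f b) (u * f a) => [? ?] [? ?].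
have {}ac : a <= c <= b by move: ac cb; rewrite !bnd_simp => ac cb; rewrite !ltW.
have dM : complex.Re (u * df c) <= M.
  apply: le_trans (ler_norm _) _; apply: le_trans (Re_le_cabs _) _.
  by rewrite cabsM u1 mul1r; apply: dfM.
by rewrite gE; apply: ler_wpM2r dM; rewrite subr_ge0 ltW.
Qed.

End ComplexBasics.

(** * Riemann sums over the integers *)

Section VanishingSequences.
Variable R : realType.

(** One-sided on purpose: the sequences are mostly moduli, and [tends0_const_le] reads an inequality
    between constants off an estimate with vanishing error. *)
Definition tends0 (u : nat -> R) : Prop :=
  forall e, 0 < e -> exists B0, forall B, (B0 <= B)%N -> u B <= e.

Lemma tends0_le (u v : nat -> R) :
  (exists B0, forall B, (B0 <= B)%N -> u B <= v B) -> tends0 v -> tends0 u.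
Proof.
move=> [B1 uv] v0 e e0; have [B0 ve] := v0 _ e0.
exists (maxn B0 B1) => B; rewrite geq_max => /andP[h0 h1].
by apply: le_trans (uv _ h1) (ve _ h0).
Qed.

Lemma tends0D (u v : nat -> R) : tends0 u -> tends0 v -> tends0 (fun B => u B + v B).
Proof.
move=> u0 v0 e e0; have e2 : 0 < e / 2 by rewrite divr_gt0.
have [B0 ue] := u0 _ e2; have [B1 ve] := v0 _ e2.
exists (maxn B0 B1) => B; rewrite geq_max => /andP[/ue h0 /ve h1].
by rewrite [leRHS]splitr lerD.
Qed.

Lemma tends0_cst0 : tends0 (fun=> 0).
Proof. by move=> e e0; exists 0%N => B _; apply: ltW. Qed.

Lemma tends0Z c (u : nat -> R) : 0 <= c -> tends0 u -> tends0 (fun B => c * u B).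
Proof.
rewrite le_eqVlt => /predU1P[<- _|c0 u0 e e0].
  by move=> e e0; exists 0%N => B _; rewrite mul0r ltW.
have [B0 ue] := u0 (e / c) (divr_gt0 e0 c0).
by exists B0 => B /ue; rewrite ler_pdivlMr// mulrC.
Qed.

Lemma tends0_sum I (r : seq I) (P : pred I) (F : I -> nat -> R) :
  (forall i, P i -> tends0 (F i)) ->
  tends0 (fun B => \sum_(i <- r | P i) F i B).
Proof.
move=> h; elim: r => [|i r ih].
  by apply: tends0_le tends0_cst0; exists 0%N => B _; rewrite big_nil.
case Pi: (P i); last first.
  by apply: tends0_le ih; exists 0%N => B _; rewrite big_cons Pi.
by apply: tends0_le (tends0D (h _ Pi) ih); exists 0%N => B _; rewrite big_cons Pi.
Qed.

Lemma tends0_inv c : tends0 (fun B => c / (1 + B%:R)).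
Proof.
move=> e e0; exists (Num.truncn (`|c| / e)).+1 => B hB.
rewrite ler_pdivrMr ?ltr_wpDr// -ler_pdivrMl// mulrC.
apply: le_trans (_ : `|c| / e <= _).
  by rewrite ler_wpM2r ?invr_ge0 ?(ltW e0)// ler_norm.
apply: le_trans (_ : B%:R <= _); last by rewrite lerDr.
apply: le_trans (ltW (truncnS_gt _)) _; last by rewrite ler_nat.
Qed.

Lemma tends0_const_le c : tends0 (fun=> c) -> c <= 0.
Proof.
move=> h; rewrite leNgt; apply/negP => c0.
have [B0 /(_ B0 (leqnn _))] := h (c / 2) (divr_gt0 c0 (ltr0n _ 2)).
by rewrite leNgt; have -> : c / 2 < c by lra.
Qed.

Definition ctends (u : nat -> R[i]) (l : R[i]) : Prop :=
  tends0 (fun B => cabs (u B - l)).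

Lemma ctends_unique u l l' : ctends u l -> ctends u l' -> l = l'.
Proof.
move=> h h'; apply/eqP; rewrite -subr_eq0 -cabs_eq0 eq_le cabs_ge0 andbT.
apply: tends0_const_le; apply: tends0_le (tends0D h h').
exists 0%N => B _; rewrite (_ : l - l' = (u B - l') - (u B - l)); last by ring.
by rewrite [leRHS]addrC; exact: cabsB.
Qed.

Lemma ctendsZ c u l : ctends u l -> ctends (fun B => c * u B) (c * l).
Proof.
move=> h; apply: tends0_le (tends0Z (cabs_ge0 c) h); exists 0%N => B _.
by rewrite -mulrBr cabsM.
Qed.

Lemma ctends_diff u v l :
  ctends u l -> tends0 (fun B => cabs (u B - v B)) -> ctends v l.
Proof.
move=> h d; apply: tends0_le (tends0D h d); exists 0%N => B _.
rewrite (_ : v B - l = (u B - l) - (u B - v B)); last by ring.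
exact: cabsB.
Qed.

Lemma tends0_cabsM (u v : nat -> R[i]) K :
  (forall B, cabs (u B) <= K) -> tends0 (fun B => cabs (v B)) ->
  tends0 (fun B => cabs (u B * v B)).
Proof.
move=> uK v0; apply: tends0_le (tends0Z _ v0).
  by exists 0%N => B _; rewrite cabsM ler_wpM2r ?cabs_ge0.
exact: le_trans (cabs_ge0 _) (uK 0%N).
Qed.

(** Factors are exchanged one at a time while the others stay bounded. *)
Lemma tends0_prodB I (r : seq I) (u v : I -> nat -> R[i]) (K : I -> R) :
  (forall i B, cabs (u i B) <= K i) -> (forall i B, cabs (v i B) <= K i) ->
  (forall i, tends0 (fun B => cabs (u i B - v i B))) ->
  tends0 (fun B => cabs (\prod_(i <- r) u i B - \prod_(i <- r) v i B)).
Proof.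
move=> uK vK uv; elim: r => [|i r ih].
  by apply: tends0_le tends0_cst0; exists 0%N => B _; rewrite !big_nil subrr cabs0.
have h1 := tends0_cabsM (uK i) ih.
have h2 : tends0 (fun B => cabs (\prod_(j <- r) v j B * (u i B - v i B))).
  apply: (@tends0_cabsM _ _ (\prod_(j <- r) K j)) (uv i) => B.
  by rewrite cabs_prod; apply: ler_prod => j _; rewrite cabs_ge0 vK.
apply: tends0_le (tends0D h1 h2); exists 0%N => B _; rewrite !big_cons.
apply: le_trans (cabsD _ _); rewrite le_eqVlt; apply/orP; left; apply/eqP.
by congr cabs; ring.
Qed.

End VanishingSequences.

(** * Symmetric sums over the integers *)

Section IntegerSums.

(** The sum over |l| <= B, indexed by an ordinal so that [bigA_distr_bigA] turns a product of such
    sums into a sum over a box. *)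
Definition zsum (V : nmodType) (B : nat) (f : int -> V) : V :=
  \sum_(i < B.*2.+1) f (i%:Z - B%:Z).

Lemma eq_zsum (V : nmodType) B (f g : int -> V) : f =1 g -> zsum B f = zsum B g.
Proof. by move=> fg; apply: eq_bigr => i _. Qed.

Lemma zsum0 (V : nmodType) (f : int -> V) : zsum 0 f = f 0.
Proof. by rewrite /zsum big_ord_recl big_ord0 addr0. Qed.

Lemma zsumS (V : nmodType) B (f : int -> V) :
  zsum B.+1 f = zsum B f + (f B.+1%:Z + f (- B.+1%:Z)).
Proof.
rewrite /zsum big_ord_recl doubleS big_ord_recr /=.
rewrite (_ : _ - _ = - B.+1%:Z); last by rewrite sub0r.
rewrite [RHS]addrA [RHS]addrC; congr (_ + _); congr (_ + _).
  by apply: eq_bigr => i _; congr f; rewrite /bump /=; lia.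
by congr f; rewrite /bump /=; lia.
Qed.

Lemma zsumD (V : nmodType) B (f g : int -> V) :
  zsum B (fun l => f l + g l) = zsum B f + zsum B g.
Proof. exact: big_split. Qed.

Lemma zsumB (V : zmodType) B (f g : int -> V) :
  zsum B (fun l => f l - g l) = zsum B f - zsum B g.
Proof. exact: sumrB. Qed.

Lemma zsumZ (A : pzRingType) B (c : A) (f : int -> A) :
  zsum B (fun l => c * f l) = c * zsum B f.
Proof. by rewrite /zsum mulr_sumr. Qed.

Lemma zsum_telescope (V : zmodType) B (f : int -> V) :
  zsum B (fun l => f (l + 1) - f l) = f (B%:Z + 1) - f (- B%:Z).
Proof.
elim: B => [|B ih]; first by rewrite zsum0 !add0r oppr0.
rewrite zsumS ih (_ : - B.+1%:Z + 1 = - B%:Z); last by lia.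
rewrite (_ : B.+1%:Z = B%:Z + 1); last by lia.
by rewrite addrCA !subrKA.
Qed.

Lemma zsum_exchange (V : nmodType) B B' (f : int -> int -> V) :
  zsum B (fun l => zsum B' (f l)) = zsum B' (fun m => zsum B (fun l => f l m)).
Proof. exact: exchange_big. Qed.

Variable R : realType.

Lemma cabs_zsum B (f : int -> R[i]) : cabs (zsum B f) <= zsum B (fun l => cabs (f l)).
Proof. exact: cabs_sum. Qed.

Lemma le_zsum B (f g : int -> R) :
  (forall l, f l <= g l) -> zsum B f <= zsum B g.
Proof. by move=> fg; apply: ler_sum. Qed.

Lemma zsum_inv_sqr B (h : R) : 0 < h -> h <= 1 ->
  h * zsum B (fun l => ((1 + `|l%:~R * h|) ^+ 2)^-1) <= 3.
Proof.
move=> h0 h1.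
(* The induction needs the telescoped tail. With a = 1 + B h, a new pair of terms contributes at
   most 2 / a - 2 / (a + h); the central term gives h. *)
suff : h * zsum B (fun l => ((1 + `|l%:~R * h|) ^+ 2)^-1) <=
       h + 2 - 2 / (1 + B%:R * h).
  move=> H; apply: le_trans H _.
  have : 0 <= 2 / (1 + B%:R * h) by rewrite divr_ge0// addr_ge0// mulr_ge0// ltW.
  by lra.
elim: B => [|B ih].
  by rewrite zsum0 !mul0r normr0 addr0 expr1n !invr1; lra.
rewrite zsumS mulrDr; apply: le_trans (lerD ih (lexx _)) _.
rewrite rmorphN /= mulNr normrN -mulr2n -pmulrn.
rewrite ger0_norm; last by rewrite mulr_ge0// ltW.
set a := 1 + B%:R * h; have -> : 1 + B.+1%:R * h = a + h.
  by rewrite /a -natr1; ring.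
have a1 : 1 <= a by rewrite lerDl mulr_ge0// ltW.
suff : h * (((a + h) ^+ 2)^-1 *+ 2) <= 2 / a - 2 / (a + h) by lra.
have a0 : 0 < a by lra.
have ah0 : 0 < a + h by lra.
have -> : 2 / a - 2 / (a + h) = 2 * h / (a * (a + h)).
  by field; rewrite !gt_eqF.
rewrite (_ : h * (_ *+ 2) = 2 * h * ((a + h) ^+ 2)^-1); last by ring.
rewrite ler_wpM2l//; first by lra.
by rewrite lef_pV2 ?posrE ?exprn_gt0 ?mulr_gt0// expr2 ler_wpM2r; lra.
Qed.

End IntegerSums.

(** * Uniform rapid decay and Riemann sums of derivatives *)

Section RapidDecay.
Variable R : realType.
Local Notation C := R[i].

(** The bound is uniform in t, which serves as the contour parameter, as the discretization level B,
    or as [tt] for a single function. *)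
Definition rapid (T : Type) (D : set T) (f : T -> R -> C) : Prop :=
  forall m, exists K, forall t x, D t -> (1 + `|x|) ^+ m * cabs (f t x) <= K.

Lemma rapidD (T : Type) (D : set T) (f g : T -> R -> C) :
  rapid D f -> rapid D g -> rapid D (fun t x => f t x + g t x).
Proof.
move=> hf hg m; have [K fK] := hf m; have [L gL] := hg m.
exists (K + L) => t x Dt; apply: le_trans (lerD (fK _ x Dt) (gL _ x Dt)).
by rewrite -mulrDr ler_wpM2l ?cabsD// exprn_ge0// addr_ge0.
Qed.

Lemma rapidM (T : Type) (D : set T) (a f : T -> R -> C) K :
  (forall t x, D t -> cabs (a t x) <= K * (1 + `|x|)) ->
  rapid D f -> rapid D (fun t x => a t x * f t x).
Proof.
move=> aK hf m; have [L fL] := hf m.+1; exists (`|K| * L) => t x Dt.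
rewrite cabsM mulrCA; apply: le_trans (ler_wpM2r _ (aK _ x Dt)) _.
  by rewrite mulr_ge0 ?cabs_ge0// exprn_ge0// addr_ge0.
rewrite -mulrA; apply: le_trans (_ : `|K| * _ <= _).
  apply: ler_wpM2r (ler_norm K).
  by rewrite !mulr_ge0 ?cabs_ge0 ?exprn_ge0 ?addr_ge0.
by rewrite ler_wpM2l// mulrA -exprS fL.
Qed.

Lemma rapidZ (T : Type) (D : set T) (a : T -> C) (f : T -> R -> C) K :
  (forall t, D t -> cabs (a t) <= K) ->
  rapid D f -> rapid D (fun t x => a t * f t x).
Proof.
move=> aK; apply: (@rapidM _ _ (fun t _ => a t) _ K) => t x Dt.
apply: le_trans (aK _ Dt) _; rewrite ler_peMr ?lerDl//.
exact: le_trans (cabs_ge0 _) (aK _ Dt).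
Qed.

(** The polynomial factor is at most m! exp (1 + |x|), and completing the square absorbs |x| into d
    x^2 at the cost of 1 / (4 d). *)
Lemma rapid_cexp (T : Type) (D : set T) (E : T -> R -> C) (d K : R) : 0 < d ->
  (forall t x, D t -> complex.Re (E t x) <= K - d * x ^+ 2) ->
  rapid D (fun t x => cexp (E t x)).
Proof.
move=> d0 EK m; exists (m`!%:R * expR (1 + (4 * d)^-1 + K)) => t x Dt.
rewrite cabs_cexp; have x0 : 0 <= 1 + `|x| by rewrite addr_ge0.
have hm : (1 + `|x|) ^+ m <= m`!%:R * expR (1 + `|x|).
  case: m => [|m].
    rewrite expr0 mul1r; apply: le_trans (expR_ge1Dx _).
    by rewrite lerDl addr_ge0.
  rewrite -ler_pdivrMl ?ltr0n ?fact_gt0// mulrC.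
  by apply: le_trans (expR_ge1Dxn m x0); rewrite lerDr.
apply: le_trans (ler_wpM2r (expR_ge0 _) hm) _.
rewrite -mulrA -expRD ler_wpM2l// ler_expR.
have := EK t x Dt; set y := `|x|; have -> : x ^+ 2 = y ^+ 2 by rewrite /y real_normK ?num_real.
have : 0 <= d * (y - (2 * d)^-1) ^+ 2 by rewrite mulr_ge0 ?sqr_ge0// ltW.
have -> : d * (y - (2 * d)^-1) ^+ 2 = d * y ^+ 2 - y + (4 * d)^-1.
  by field; rewrite gt_eqF.
by lra.
Qed.

Lemma rapid_bound (T : Type) (D : set T) (f : T -> R -> C) : rapid D f ->
  exists2 K, 0 <= K & forall t x, D t -> cabs (f t x) <= K / (1 + `|x|) ^+ 2.
Proof.
move=> /(_ 2)[K fK]; exists `|K| => // t x Dt.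
have x0 : 0 < (1 + `|x|) ^+ 2 by rewrite exprn_gt0// ltr_wpDr.
rewrite ler_pdivlMr// mulrC; apply: le_trans (fK _ x Dt) (ler_norm _).
Qed.

Lemma cabs_mvt_near (f df : R -> C) (x y M : R) :
  (forall z, cderiv f z (df z)) ->
  (forall z, `|z - x| <= `|y - x| -> cabs (df z) <= M) ->
  cabs (f y - f x) <= M * `|y - x|.
Proof.
move=> fdf dfM; have [xy|yx] := leP x y.
  rewrite [in leRHS]ger0_norm ?subr_ge0//; apply: cabs_mvt xy _ _ => z //.
  move=> /andP[xz zy]; apply: dfM; rewrite !ger0_norm ?subr_ge0//; last exact: le_trans zy.
  by rewrite lerD2r.
rewrite cabsBC [in leRHS]distrC [in leRHS]ger0_norm ?subr_ge0 ?(ltW yx)//.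
apply: cabs_mvt (ltW yx) _ _ => z // /andP[yz zx]; apply: dfM.
rewrite distrC (distrC y) !ger0_norm ?subr_ge0//; last exact: le_trans zx.
by rewrite lerD2l lerN2.
Qed.

(** The factor 4 moves the decay weight from an intermediate point z to x: |z - x| <= 1 gives 1 +
    |x| <= 2 (1 + |z|). *)
Lemma cabs_taylor2 (f f1 f2 : R -> C) K (x y : R) :
  (forall z, cderiv f z (f1 z)) -> (forall z, cderiv f1 z (f2 z)) ->
  (forall z, cabs (f2 z) <= K / (1 + `|z|) ^+ 2) -> 0 <= K -> `|y - x| <= 1 ->
  cabs (f y - f x - (y - x)%:C * f1 x) <=
  4 * K / (1 + `|x|) ^+ 2 * `|y - x| ^+ 2.
Proof.
move=> ff1 f1f2 f2K K0 yx1; set M := 4 * K / _.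
have h2 z : `|z - x| <= `|y - x| -> cabs (f2 z) <= M.
  move=> zx; apply: le_trans (f2K z) _.
  have p0 (u : R) : 0 < 1 + `|u| by rewrite ltr_wpDr.
  have xz : (1 + `|x|) <= 2 * (1 + `|z|).
    have : `|x| <= `|z| + `|z - x|.
      by rewrite -{1}(subKr z x) ; apply: le_trans (ler_normB _ _) _.
    have := normr_ge0 z; lra.
  rewrite /M ler_pdivrMr ?exprn_gt0// mulrAC ler_pdivlMr ?exprn_gt0//.
  rewrite (_ : 4 * K * _ = K * (2 * (1 + `|z|)) ^+ 2); last by ring.
  by rewrite ler_wpM2l// lerXn2r// nnegrE ltW// mulr_gt0.
have M0 : 0 <= M by rewrite /M divr_ge0 ?mulr_ge0 ?exprn_ge0 ?addr_ge0.
pose g z := f z - z%:C * f1 x; pose g1 z := f1 z - f1 x.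
have gg1 z : cderiv g z (g1 z).
  have := cderivD (ff1 z) (cderivM (cderiv_id z) (cderiv_cst (- f1 x) z)).
  move/cderiv_eq => /(_ (g1 z)) h; apply: cderiv_ext (h _).
    by move=> w; rewrite mulrN.
  by rewrite mulr0 addr0 mul1r.
have -> : f y - f x - (y - x)%:C * f1 x = g y - g x.
  by rewrite /g rmorphB /=; ring.
rewrite expr2 mulrA; apply: cabs_mvt_near gg1 _ => z zx.
apply: le_trans (_ : M * `|z - x| <= _); last by rewrite ler_wpM2l.
by apply: cabs_mvt_near f1f2 _ => w wz; apply: h2; exact: le_trans zx.
Qed.

(** The discrete form of the fact that the integral of a derivative vanishes: h f1 is a difference
    of f up to a Taylor remainder, and the differences telescope to two boundary values. The 12 is
    the 4 of [cabs_taylor2] times the 3 of [zsum_inv_sqr]. *)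
Lemma riemann_sum_deriv (f f1 f2 : R -> C) K L (h : R) :
  (forall z, cderiv f z (f1 z)) -> (forall z, cderiv f1 z (f2 z)) ->
  0 <= K ->
  (forall z, cabs (f z) <= K / (1 + `|z|) ^+ 2) ->
  (forall z, cabs (f2 z) <= K / (1 + `|z|) ^+ 2) -> 0 < h -> h <= 1 ->
  cabs (zsum L (fun l => h%:C * f1 (l%:~R * h))) <=
  2 * K / (1 + L%:R * h) ^+ 2 + 12 * K * h.
Proof.
move=> ff1 f1f2 K0 fK f2K h0 h1.
pose F (l : int) := f (l%:~R * h).
have -> : zsum L (fun l => h%:C * f1 (l%:~R * h)) =
    (F (L%:Z + 1) - F (- L%:Z)) -
    zsum L (fun l => F (l + 1) - F l - h%:C * f1 (l%:~R * h)).
  by rewrite zsumB zsum_telescope; ring.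
apply: le_trans (cabsB _ _) _; apply: lerD.
  have Lh : 0 <= L%:R * h by rewrite mulr_ge0// ltW.
  have mono z : L%:R * h <= `|z| -> cabs (f z) <= K / (1 + L%:R * h) ^+ 2.
    move=> Lz; apply: le_trans (fK z) _; rewrite ler_wpM2l// lef_pV2 ?posrE.
    - by rewrite lerXn2r ?nnegrE ?addr_ge0// lerD2l.
    - by rewrite exprn_gt0// ltr_wpDr.
    - by rewrite exprn_gt0// ltr_wpDr.
  apply: le_trans (cabsB _ _) _.
  rewrite -mulrA mulrDl mul1r; apply: lerD; apply: mono.
    rewrite (_ : (L%:Z + 1)%:~R = L%:R + 1 :> R); last by rewrite intrD.
    rewrite normrM (gtr0_norm h0) ler_wpM2r ?(ltW h0)//.
    by rewrite ger0_norm ?addr_ge0// lerDl.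
  by rewrite normrM (gtr0_norm h0) rmorphN normrN ger0_norm.
apply: le_trans (cabs_zsum _ _) _.
apply: le_trans (_ : zsum L (fun l : int => (4 * K * h) * (h *
    ((1 + `|l%:~R * h|) ^+ 2)^-1)) <= _).
  apply: le_zsum => l; rewrite /F intrD mulrDl mul1r.
  have := @cabs_taylor2 f f1 f2 K (l%:~R * h) (l%:~R * h + h) ff1 f1f2 f2K K0.
  rewrite (addrC _ h) addrK (gtr0_norm h0) => /(_ h1) H.
  by apply: le_trans H _; rewrite le_eqVlt; apply/orP; left; apply/eqP; ring.
rewrite !zsumZ (_ : 12 * K * h = 4 * K * h * 3); last by ring.
by rewrite ler_wpM2l ?zsum_inv_sqr// !mulr_ge0// ltW.
Qed.

End RapidDecay.

(** * Poisson summation by discrete Fourier transforms *)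

Section DiscreteFourier.
Variable R : realType.
Local Notation C := R[i].

Lemma zsum_add (V : nmodType) B n (f : int -> V) :
  zsum (B + n) f = zsum B f +
    \sum_(r < n) (f (B + r).+1%:Z + f (- (B + r).+1%:Z)).
Proof.
elim: n => [|n ih]; first by rewrite addn0 big_ord0 addr0.
by rewrite addnS zsumS ih big_ord_recr /= -addrA.
Qed.

Lemma zsum_multiples (V : nmodType) (N B : nat) (f : int -> V) : (0 < N)%N ->
  zsum (N * B) (fun l => if (N%:Z %| l)%Z then f l else 0) =
  zsum B (fun m => f (m * N%:Z)).
Proof.
move=> N0; elim: B => [|B ih]; first by rewrite muln0 !zsum0 dvdz0 mul0r.
rewrite mulnS addnC zsum_add ih zsumS; congr (_ + _).
case: N N0 {ih} => // N _; rewrite big_ord_recr /= big1 ?add0r => [|i _].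
  have -> : (N.+1 * B + N).+1%:Z = B.+1%:Z * N.+1%:Z by lia.
  rewrite -mulNr !dvdz_mull//; congr (_ + _).
have nd : ~~ (N.+1%:Z %| (N.+1 * B + i).+1%:Z)%Z.
  rewrite -[(_ %| _)%Z]/(N.+1 %| (N.+1 * B + i).+1)%N -addnS dvdn_addr ?dvdn_mulr//.
  by rewrite gtnNdvd// ltnS ltn_ord.
by rewrite rpredN (negbTE nd) addr0.
Qed.

Lemma zsum_character (B : nat) (l : int) : let N := B.*2.+1 in
  zsum B (fun j => cexp2pi (- (j%:~R * (l%:~R / N%:R)))) =
  (if (N%:Z %| l)%Z then N%:R else 0) :> C.
Proof.
move=> N; set x := l%:~R / N%:R :> R.
have N0 : N%:R != 0 :> R by rewrite pnatr_eq0.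
have E (i : nat) : cexp2pi (- ((i%:Z - B%:Z)%:~R * x)) =
    cexp2pi (B%:R * x) * cexp2pi (- x) ^+ i :> C.
  rewrite -cexp2piMn -cexp2piD; congr cexp2pi.
  by rewrite intrB -mulr_natl /= ; ring.
rewrite /zsum (eq_bigr _ (fun (i : 'I__) _ => E i)) -mulr_sumr -/N.
case: ifPn => [/dvdzP[q lq]|nd].
  have xq : x = q%:~R by rewrite /x lq intrM /= mulfK.
  rewrite xq cexp2piN cexp2pi_int invr1 (eq_bigr (fun=> 1)) => [|i _].
    by rewrite sumr_const card_ord -[B%:R]/(B%:~R) -intrM cexp2pi_int mul1r.
  by rewrite expr1n.
have n1 : cexp2pi (- x) - 1 != 0 :> C.
  rewrite subr_eq0; apply: contra nd => /eqP/cexp2pi_eq1.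
  rewrite rpredN => /intrP[q xq]; apply/dvdzP; exists q.
  apply/eqP; rewrite -(eqr_int R) intrM /=; apply/eqP; rewrite -xq /x divfK//.
apply/eqP; rewrite mulf_eq0; apply/orP; right.
rewrite -(inj_eq (mulfI n1)) mulr0 -subrX1 -cexp2piMn -mulr_natr mulNr divfK//.
by rewrite cexp2piN cexp2pi_int invr1 subrr.
Qed.

Variables (g g1 g2 : R -> C) (K : R).
Hypotheses (gg1 : forall x, cderiv g x (g1 x)) (g1g2 : forall x, cderiv g1 x (g2 x)).
Hypotheses (K0 : 0 <= K) (gK : forall x, cabs (g x) <= K / (1 + `|x|) ^+ 2)
  (g2K : forall x, cabs (g2 x) <= K / (1 + `|x|) ^+ 2).

Definition mesh (B : nat) : R := (B.*2.+1)%:R^-1.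

Lemma mesh_gt0 B : 0 < mesh B. Proof. by rewrite invr_gt0. Qed.

Lemma mesh_le1 B : mesh B <= 1. Proof. by rewrite invf_le1// ler1n. Qed.

Lemma mesh_range B : (B.*2.+1 * B)%:R * mesh B = B%:R :> R.
Proof. by rewrite /mesh natrM mulrAC divff ?mul1r// pnatr_eq0. Qed.

Definition dft (B : nat) (j : int) : C :=
  zsum (B.*2.+1 * B) (fun l => (mesh B)%:C *
    (g (l%:~R * mesh B) * cexp2pi (- (j%:~R * (l%:~R * mesh B))))).

(** Poisson summation is exact at finite level. With N = 2 B + 1 and mesh 1 / N, the N frequencies
    are all the characters modulo N, so only the samples with N dividing l survive; these are the
    integers in [- B, B]. *)
Lemma zsum_dft B : zsum B (dft B) = zsum B (fun m => g m%:~R).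
Proof.
transitivity (zsum (B.*2.+1 * B) (fun l => if (B.*2.+1%:Z %| l)%Z
    then g (l%:~R * mesh B) else 0)); last first.
  rewrite (zsum_multiples _ (fun l => g (l%:~R * mesh B)))//; apply: eq_zsum => m.
  by rewrite intrM /mesh mulfK// pnatr_eq0.
rewrite zsum_exchange; apply: eq_zsum => l.
rewrite (eq_zsum _ (g := fun j => ((mesh B)%:C * g (l%:~R * mesh B)) *
   cexp2pi (- (j%:~R * (l%:~R / B.*2.+1%:R))))); last first.
  by move=> j; rewrite -/(mesh B) mulrA.
rewrite zsumZ zsum_character; case: ifPn => _; last by rewrite mulr0.
rewrite mulrAC -(rmorph_nat (real_complex R)) -rmorphM /= mulVf ?pnatr_eq0//.
by rewrite mul1r.
Qed.

(** Up to pi / 4 the slope of sin is at least cos (pi / 4) >= 2 / 3; beyond, sin x >= 2 / 3 while x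
    <= 2. *)
Lemma sin_ge_third (x : R) : 0 <= x <= pi / 2 -> x / 3 <= sin x.
Proof.
move=> /andP[x0 xp].
have p2 : pi / 2 <= 2 :> R by exact/ltW/pihalf_lt2.
have c4 : (cos (pi / 4) : R) ^+ 2 = 2^-1.
  have : cos ((pi / 4) *+ 2) = 0 :> R.
    by rewrite (_ : (pi / 4) *+ 2 = pi / 2) ?cos_pihalf//; field.
  by rewrite cos_mulr2n; lra.
have p4 : 0 <= pi / 4 :> R by rewrite divr_ge0// pi_ge0.
have c40 : 0 <= cos (pi / 4) :> R.
  by apply: cos_ge0_pihalf; have := @pi_ge0 R; lra.
have c4b : 2 / 3 <= cos (pi / 4) :> R.
  by rewrite -(@ler_pXn2r _ 2) ?nnegrE// c4; lra.
have [x4|x4] := leP x (pi / 4).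
  have [xE|xn0] := eqVneq x 0; first by rewrite xE mul0r sin0.
  have {}x0 : 0 < x by rewrite lt0r xn0.
  have [|c /andP[c0 cx]] := @MVT R sin cos 0 x x0 (fun y _ => is_derive_sin y).
    by apply: continuous_subspaceT => y; exact: continuous_sin.
  rewrite sin0 !subr0 => ->; rewrite mulrC ler_wpM2r ?(ltW x0)//.
  move: c0 cx; rewrite !bnd_simp => c0 cx.
  have : cos (pi / 4) <= cos c :> R.
    rewrite leNgt; apply/negP; rewrite ltr_cos ?in_itv/=.
    - by move=> h; have := lt_le_trans h (le_trans (ltW cx) x4); rewrite ltxx.
    - by have := @pi_ge0 R; lra.
    - by have := @pi_ge0 R; lra.
  by lra.
have : sin (pi / 4) <= sin x :> R.
  rewrite leNgt; apply/negP; rewrite ltr_sin ?in_itv/=.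
  - by move=> h; have := lt_trans h x4; rewrite ltxx.
  - by have := @pi_ge0 R; lra.
  - by have := @pi_ge0 R; lra.
suff -> : sin (pi / 4) = cos (pi / 4) :> R by lra.
by rewrite -cosBpihalf -cosN; congr cos; field.
Qed.

(** The right-hand side is the eigenvalue of the negated second difference on a character of
    frequency y; for |y| <= 1 / 2 it vanishes only at y = 0. *)
Lemma two_sub_two_cos_ge (y : R) : `|y| <= 1 / 2 ->
  y ^+ 2 <= 2 - 2 * cos (2 * pi * y).
Proof.
wlog y0 : y / 0 <= y => [H y12|].
  have [/H|/ltW y0] := leP 0 y; first exact.
  have := H (- y); rewrite oppr_ge0 normrN sqrrN mulrN cosN; exact.
rewrite ger0_norm// => y12.
have h : pi * y / 3 <= sin (pi * y) :> R.
  apply: sin_ge_third; rewrite mulr_ge0 ?pi_ge0//= ler_pM2l ?pi_gt0//; lra.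
have -> : 2 * pi * y = (pi * y) *+ 2 by ring.
rewrite cos_mulr2n cos2sin2.
have p2 := @pi_ge2 R.
have : (2 * y / 3) ^+ 2 <= sin (pi * y) ^+ 2.
  rewrite lerXn2r ?nnegrE//; first by lra.
    by apply: sin_ge0_pi; rewrite mulr_ge0 ?pi_ge0//= ger_pMr ?pi_gt0//; lra.
  by apply: le_trans h; rewrite ler_wpM2r// ler_wpM2r//.
have := sqr_ge0 y; have -> : (2 * y / 3) ^+ 2 = 4 / 9 * y ^+ 2 by field.
by lra.
Qed.

(* Two summations by parts move the second difference of the character onto g. *)
Lemma cabs_dft_le B (j : int) : j != 0 -> `|j| <= B%:Z ->
  cabs (dft B j) <= 28 * K / j%:~R ^+ 2.
Proof.
move=> j0 jB; set h := mesh B; set N := B.*2.+1.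
have h0 : 0 < h := mesh_gt0 B.
have h1 : h <= 1 := mesh_le1 B.
pose y : R := j%:~R * h.
have y12 : `|y| <= 1 / 2.
  rewrite normrM (gtr0_norm h0) /h /mesh ler_pdivrMr// -intr_norm.
  have : (`|j|%:~R : R) <= B%:R by rewrite -[B%:R]/(B%:~R) ler_int.
  have -> : (B.*2.+1)%:R = 2 * B%:R + 1 :> R by rewrite -natr1 -muln2 natrM mulrC.
  by lra.
pose w (l : int) : C := cexp2pi (- (j%:~R * (l%:~R * h))).
pose G (l : int) : C := g (l%:~R * h).
pose c : R := 2 - 2 * cos (2 * pi * y).
have cy : y ^+ 2 <= c by exact: two_sub_two_cos_ge.
have y0 : 0 < y ^+ 2.
  by rewrite exprn_even_gt0//= mulf_neq0 ?intr_eq0// gt_eqF.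
have c0 : 0 < c by exact: lt_le_trans cy.
have cw l : c%:C * w l = 2 * w l - w (l + 1) - w (l - 1).
  have -> : w (l + 1) = w l * cexp2pi (- y).
    by rewrite /w -cexp2piD; congr cexp2pi; rewrite intrD /y; ring.
  have -> : w (l - 1) = w l * cexp2pi y.
    by rewrite /w -cexp2piD; congr cexp2pi; rewrite intrD mulrN1z /y; ring.
  have -> : c%:C = 2 - cexp2pi (- y) - cexp2pi y.
    rewrite /cexp2pi /cexp /= expR0 !mul1r mulrN cosN sinN /c.
    apply/eqP; rewrite eq_complex /=; apply/andP; split; apply/eqP; ring.
  by ring.
pose L := (N * B)%N.
pose S := zsum L (fun l => G l * w l).
have dE : dft B j = h%:C * S by rewrite /dft -zsumZ.
have SE : c%:C * S = zsum L (fun l => w l * (2 * G l - G (l - 1) - G (l + 1)))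
    - (G L%:Z * w (L%:Z + 1) - G (- L%:Z - 1) * w (- L%:Z))
    + (G (L%:Z + 1) * w L%:Z - G (- L%:Z) * w (- L%:Z - 1)).
  pose F1 (l : int) := G (l - 1) * w l; pose F2 (l : int) := G l * w (l - 1).
  have e1 : zsum L (fun l => G l * w (l + 1) - G (l - 1) * w l) =
      G L%:Z * w (L%:Z + 1) - G (- L%:Z - 1) * w (- L%:Z).
    transitivity (F1 (L%:Z + 1) - F1 (- L%:Z)); last by rewrite /F1 addrK.
    rewrite -zsum_telescope.
    by apply: eq_zsum => l; rewrite /F1 addrK.
  have e2 : zsum L (fun l => G (l + 1) * w l - G l * w (l - 1)) =
      G (L%:Z + 1) * w L%:Z - G (- L%:Z) * w (- L%:Z - 1).
    transitivity (F2 (L%:Z + 1) - F2 (- L%:Z)); last by rewrite /F2 addrK.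
    rewrite -zsum_telescope.
    by apply: eq_zsum => l; rewrite /F2 addrK.
  rewrite -e1 -e2 -zsumB -zsumD -zsumZ; apply: eq_zsum => l.
  by rewrite mulrCA cw; ring.
have hL : L%:R * h = B%:R := mesh_range B.
have cabsw l : cabs (w l) = 1 by exact: cabs_cexp2pi.
have Kh : 0 <= K * h by rewrite mulr_ge0// ltW.
(* At distance B or more the decay (1 + B)^-2 is below the mesh 1 / (2 B + 1), so a boundary term is
   no larger than the main error. *)
have bd x : B%:R <= `|x| -> cabs (g x) <= K * h.
  move=> Bx; apply: le_trans (gK x) _; rewrite ler_wpM2l//.
  rewrite /h /mesh lef_pV2 ?posrE ?exprn_gt0 ?ltr_wpDr//.
  apply: le_trans (_ : (1 + B%:R) ^+ 2 <= _); last first.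
    by rewrite lerXn2r ?nnegrE ?addr_ge0// lerD2l.
  rewrite -[1 in leRHS]/(1%:R) -natrD -natrX ler_nat; lia.
have G1 : cabs (G L%:Z) <= K * h by apply: bd; rewrite /G hL ger0_norm.
have G2 : cabs (G (- L%:Z)) <= K * h.
  by apply: bd; rewrite rmorphN mulNr normrN hL ger0_norm.
have G3 : cabs (G (L%:Z + 1)) <= K * h.
  apply: bd; rewrite intrD mulrDl hL mul1r ger0_norm ?addr_ge0// ?(ltW h0)//.
  by rewrite lerDl ltW.
have G4 : cabs (G (- L%:Z - 1)) <= K * h.
  apply: bd; rewrite -opprD mulrNz mulNr normrN.
  rewrite intrD mulrDl hL mul1r ger0_norm ?addr_ge0// ?(ltW h0)//.
  by rewrite lerDl ltW.
(* A second difference is two Taylor remainders, hence 8 K h^2 times the weight, and the weights sum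
   to at most 3 / h. The four boundary terms of size K h raise 24 to 28. *)
have main : cabs (zsum L (fun l => w l * (2 * G l - G (l - 1) - G (l + 1)))) <=
    24 * K * h.
  apply: le_trans (cabs_zsum _ _) _.
  apply: le_trans (_ : zsum L (fun l : int => (8 * K * h) * (h *
      ((1 + `|l%:~R * h|) ^+ 2)^-1)) <= _); last first.
    rewrite !zsumZ (_ : 24 * K * h = 8 * K * h * 3); last by ring.
    by rewrite ler_wpM2l ?zsum_inv_sqr// -mulrA mulr_ge0.
  apply: le_zsum => l; rewrite cabsM cabsw mul1r /G; set x := l%:~R * h.
  have -> : (l - 1)%:~R * h = x - h by rewrite intrB mulrBl mul1r.
  have -> : (l + 1)%:~R * h = x + h by rewrite intrD mulrDl mul1r.
  have t1 := @cabs_taylor2 _ g g1 g2 K x (x + h) gg1 g1g2 g2K K0.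
  have t2 := @cabs_taylor2 _ g g1 g2 K x (x - h) gg1 g1g2 g2K K0.
  have -> : 2 * g x - g (x - h) - g (x + h) =
    - (g (x + h) - g x - (x + h - x)%:C * g1 x)
    - (g (x - h) - g x - (x - h - x)%:C * g1 x) by ring.
  apply: le_trans (cabsB _ _) _; rewrite cabsN.
  have xh1 : x + h - x = h by ring.
  have xh2 : x - h - x = - h by ring.
  rewrite xh1 xh2 in t1 t2 *; rewrite normrN (gtr0_norm h0) in t1 t2.
  apply: le_trans (lerD (t1 h1) (t2 h1)) _.
  by rewrite le_eqVlt; apply/orP; left; apply/eqP; ring.
have cS : c * cabs S <= 28 * K * h.
  rewrite -[c]ger0_norm ?(ltW c0)// -cabs_real -cabsM SE.
  apply: le_trans (cabsD _ _) _; apply: le_trans (lerD (cabsB _ _) (cabsB _ _)) _.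
  have := lerD main (lexx (0 : R)).
  have n1 := cabsB (G L%:Z * w (L%:Z + 1)) (G (- L%:Z - 1) * w (- L%:Z)).
  rewrite !cabsM !cabsw !mulr1 in n1 *; lra.
rewrite dE cabsM cabs_real (gtr0_norm h0) ler_pdivlMr; last first.
  by rewrite exprn_even_gt0//= intr_eq0.
have -> : j%:~R ^+ 2 = y ^+ 2 / h ^+ 2 by rewrite /y; field; rewrite gt_eqF.
rewrite (_ : h * cabs S * _ = (y ^+ 2 * cabs S) / h); last first.
  by field; rewrite gt_eqF.
rewrite ler_pdivrMr//; apply: le_trans cS; rewrite ler_wpM2r ?cabs_ge0//.
Qed.

(** Telescoping of 1 / j^2 <= 1 / (j - 1) - 1 / j on both sides of 0. *)
Lemma zsum_tail (f : int -> C) c J M : (0 < J)%N -> (J <= M)%N ->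
  (forall j : int, j != 0 -> `|j| <= M%:Z -> cabs (f j) <= c / j%:~R ^+ 2) ->
  cabs (zsum M f - zsum J f) <= 2 * c * (J%:R^-1 - M%:R^-1).
Proof.
move=> J0; elim: M => [|M ih]; first by rewrite leqn0 => /eqP JE; rewrite JE in J0.
rewrite leq_eqVlt => /predU1P[<- _|]; first by rewrite !subrr cabs0 mulr0.
rewrite ltnS => JM fc.
have M0 : 0 < M%:R :> R by rewrite ltr0n (leq_trans J0).
have c0 : 0 <= c.
  have := fc 1 isT; rewrite expr1n divr1 => h; apply: le_trans (h _); first exact: cabs_ge0.
  by lia.
have f1 : cabs (f M.+1%:Z) <= c / M.+1%:R ^+ 2 by apply: (fc M.+1%:Z) => //; lia.
have f2 : cabs (f (- M.+1%:Z)) <= c / M.+1%:R ^+ 2.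
  by have := fc (- M.+1%:Z); rewrite rmorphN sqrrN; apply => //; lia.
have ihM : cabs (zsum M f - zsum J f) <= 2 * c * (J%:R^-1 - M%:R^-1).
  by apply: ih => // j j0 jM; apply: fc => //; lia.
rewrite zsumS addrAC; apply: le_trans (cabsD _ _) _.
apply: le_trans (lerD ihM (cabsD _ _)) _.
apply: le_trans (lerD (lexx _) (lerD f1 f2)) _.
have : c / M.+1%:R ^+ 2 <= c * (M%:R^-1 - M.+1%:R^-1).
  rewrite ler_wpM2l//; have -> : M%:R^-1 - M.+1%:R^-1 = (M%:R * M.+1%:R)^-1 :> R.
    by rewrite -natr1; field; rewrite !gt_eqF// addr_gt0.
  rewrite lef_pV2 ?posrE ?exprn_gt0 ?mulr_gt0// expr2 ler_wpM2r//.
  by rewrite ler_nat.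
set t := c / _; move=> tc.
rewrite [leRHS](_ : _ = 2 * c * (J%:R^-1 - M%:R^-1) +
  (c * (M%:R^-1 - M.+1%:R^-1) + c * (M%:R^-1 - M.+1%:R^-1))); last by ring.
by rewrite lerD2l lerD.
Qed.

(** Dominated convergence for series: the j^-2 bounds on [dft] and on a are uniform in B, so the
    frequencies beyond some J contribute little, and the finitely many others converge one by
    one. *)
Lemma poisson_of_dft (a : int -> nat -> C) K' :
  (forall j B, cabs (a j B) <= K' / (1 + `|j%:~R|) ^+ 2) ->
  (forall j, tends0 (fun B => cabs (dft B j - a j B))) ->
  tends0 (fun B => cabs (zsum B (fun m => g m%:~R) - zsum B (a^~ B))).
Proof.
move=> aK dfta e e0.
have K'0 : 0 <= K'.
  have := aK 0 0%N; rewrite normr0 addr0 expr1n divr1; exact: le_trans (cabs_ge0 _).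
pose c := 28 * K + K'.
have c0 : 0 <= c by rewrite addr_ge0// mulr_ge0.
have [J0 hJ] := @tends0_inv R (2 * c) (e / 2) (divr_gt0 e0 (ltr0n _ 2)).
pose J := J0.+1.
have hJ' : 2 * c / J%:R <= e / 2.
  by have := hJ J0 (leqnn _); rewrite [1 + _]addrC natr1.
have [B1 hB] : exists B1, forall B, (B1 <= B)%N ->
    zsum J (fun j => cabs (dft B j - a j B)) <= e / 2.
  exact: (@tends0_sum _ _ _ _ _ (fun i _ => dfta _)) (divr_gt0 e0 (ltr0n _ 2)).
exists (maxn B1 J) => B; rewrite geq_max => /andP[B1B JB].
rewrite -zsum_dft -zsumB -(subrK (zsum J (fun l => dft B l - a l B)) (zsum B _)).
apply: le_trans (cabsD _ _) _; rewrite [leRHS]splitr; apply: lerD; last first.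
  by apply: le_trans (cabs_zsum _ _) _; exact: hB.
apply: le_trans hJ'; apply: le_trans (@zsum_tail _ c J B _ _ _) _ => //.
  move=> j j0 jB; apply: le_trans (cabsB _ _) _.
  rewrite mulrDl; apply: lerD; first exact: cabs_dft_le.
  apply: le_trans (aK _ _) _; rewrite ler_wpM2l// lef_pV2 ?posrE.
  - rewrite -[leLHS]real_normK ?num_real// lerXn2r ?nnegrE ?addr_ge0//.
    by rewrite lerDr.
  - by rewrite exprn_gt0// ltr_wpDr.
  - by rewrite exprn_even_gt0//= intr_eq0.
rewrite ler_wpM2l ?mulr_ge0//.
by rewrite gerBl invr_ge0.
Qed.

End DiscreteFourier.

(** * Contour shifts for Gaussian Riemann sums *)

Section Gaussian.
Variable R : realType.
Local Notation C := R[i].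

Definition gk (k : nat) (u : C) : C := u ^+ k * cexp (- (pi%:C * u ^+ 2)).

(** The complex derivative of [gk k]. At k = 0 the truncated index [k.-1] carries the coefficient
    0. *)
Definition dgk (k : nat) (u : C) : C :=
  k%:R * gk k.-1 u - 2 * pi%:C * gk k.+1 u.

Lemma cderiv_gk k (u : R -> C) t a :
  cderiv u t a -> cderiv (fun x => gk k (u x)) t (a * dgk k (u t)).
Proof.
move=> ua; have hk := cderivX k ua; have h2 := cderivX 2 ua.
have he := cderiv_cexp (cderivM (cderiv_cst (- pi%:C) t) h2).
have := cderivM hk he.
move/cderiv_eq => /(_ (a * dgk k (u t))) h; apply: cderiv_ext (h _).
  by move=> x; rewrite /gk mulNr.
rewrite /dgk /gk mul0r add0r (mulNr pi%:C (u t ^+ 2)) [u t ^+ k.+1]exprS /= expr1.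
by move: (cexp _) (u t ^+ k) (u t ^+ k.-1) => e p q; ring.
Qed.

Definition ddgk (k : nat) (u : C) : C :=
  k%:R * dgk k.-1 u - 2 * pi%:C * dgk k.+1 u.

Lemma cderiv_dgk k (u : R -> C) t a :
  cderiv u t a -> cderiv (fun x => dgk k (u x)) t (a * ddgk k (u t)).
Proof.
move=> ua.
have h1 := cderivM (cderiv_cst k%:R t) (cderiv_gk k.-1 ua).
have h2 := cderivM (cderiv_cst (- (2 * pi%:C)) t) (cderiv_gk k.+1 ua).
have := cderivD h1 h2; move/cderiv_eq => /(_ (a * ddgk k (u t))) h.
apply: cderiv_ext (h _); first by move=> x; rewrite /dgk mulNr.
by rewrite /ddgk; ring.
Qed.

Section Rapid.
Variables (T : Type) (D : set T) (u : T -> R -> C) (d K M : R).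
Hypotheses (d0 : 0 < d)
  (uK : forall t x, D t -> d * x ^+ 2 - K <= complex.Re (u t x ^+ 2))
  (uM : forall t x, D t -> cabs (u t x) <= M * (1 + `|x|)).

Lemma rapid_gk k : rapid D (fun t x => gk k (u t x)).
Proof.
elim: k => [|k ih].
  have -> : (fun t x => gk 0 (u t x)) =
      (fun t x => cexp (- (pi%:C * u t x ^+ 2))).
    by apply/funext => t; apply/funext => x; rewrite /gk expr0 mul1r.
  apply: (@rapid_cexp _ _ _ _ (pi * d) (pi * K)); first by rewrite mulr_gt0 ?pi_gt0.
  move=> t x Dt; have := uK x Dt; case: (u t x ^+ 2) => a b /= h.
  rewrite mul0r subr0 (_ : pi * K - _ = - (pi * (d * x ^+ 2 - K))); last by ring.
  by rewrite lerN2 ler_pM2l ?pi_gt0.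
have -> : (fun t x => gk k.+1 (u t x)) = (fun t x => u t x * gk k (u t x)).
  by apply/funext => t; apply/funext => x; rewrite /gk exprS mulrA.
exact: rapidM uM ih.
Qed.

Lemma rapid_dgk k : rapid D (fun t x => dgk k (u t x)).
Proof.
have -> : (fun t x => dgk k (u t x)) =
  (fun t x => k%:R * gk k.-1 (u t x) + (- (2 * pi%:C)) * gk k.+1 (u t x)).
  by apply/funext => t; apply/funext => x; rewrite /dgk mulNr.
by apply: rapidD; apply: (rapidZ (a := fun=> _)); do ?exact: rapid_gk; move=> t _.
Qed.

Lemma rapid_ddgk k : rapid D (fun t x => ddgk k (u t x)).
Proof.
have -> : (fun t x => ddgk k (u t x)) =
  (fun t x => k%:R * dgk k.-1 (u t x) + (- (2 * pi%:C)) * dgk k.+1 (u t x)).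
  by apply/funext => t; apply/funext => x; rewrite /ddgk mulNr.
by apply: rapidD; apply: (rapidZ (a := fun=> _)); do ?exact: rapid_dgk; move=> t _.
Qed.

End Rapid.

(** The sector |arg lam| < pi / 4, that is, the square roots with positive real part of the w with
    Re w > 0. *)
Definition acute (lam : C) : Prop := `|complex.Im lam| < complex.Re lam.

Section Contour.
Variables (lam z : C).
Hypothesis lam_acute : acute lam.

Let eta : C := lam - 1.
Let lamt (t : R) : C := 1 + t%:C * eta.
Let ut (t x : R) : C := lamt t * x%:C + t%:C * z.
Let I01 : set R := [set t | 0 <= t <= 1].

(** The sector is convex and contains 1: writing lam_t = p + i q, one has p - |q| >= m along the
    whole segment, so Re lam_t^2 >= m^2. The shift t z adds a term linear in x, which half of m^2
    x^2 absorbs. *)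
Lemma contour_Re : exists d K M : R, [/\ 0 < d,
  forall t x, I01 t -> d * x ^+ 2 - K <= complex.Re (ut t x ^+ 2),
  forall t x, I01 t -> cabs (ut t x) <= M * (1 + `|x|) &
  forall t, I01 t -> cabs (lamt t) <= M].
Proof.
have := lam_acute; rewrite /acute; move lamE : lam => [a b] /= ab.
move zE : z => [c d].
pose m := Num.min 1 (a - `|b|).
have m0 : 0 < m by rewrite lt_min ltr01 subr_gt0.
have m1 : m <= 1 by rewrite ge_min lexx.
have mab : m <= a - `|b| by rewrite ge_min lexx orbT.
have a0 : 0 < a by apply: le_lt_trans ab.
pose Z := (1 + a + `|b|) * (`|c| + `|d|).
pose M := 1 + cabs eta + cabs z.
have lM t : I01 t -> cabs (lamt t) <= 1 + cabs eta.
  move=> /andP[t0 t1]; apply: le_trans (cabsD _ _) _; rewrite cabs1 lerD2l.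
  by rewrite cabsM cabs_real ger0_norm// ler_piMl// cabs_ge0.
have eg := cabs_ge0 eta; have zg := cabs_ge0 z.
exists (m ^+ 2 / 2), (2 * Z ^+ 2 / m ^+ 2 + d ^+ 2), M; split.
- by rewrite divr_gt0// exprn_gt0.
- move=> t x /andP[t0 t1].
  have [p pE] : {p | p = 1 - t + t * a} by eexists.
  have [q qD] : {q | q = t * b} by eexists.
  have -> : ut t x ^+ 2 = Complex (p * x + t * c) (q * x + t * d) ^+ 2.
    rewrite /ut /lamt /eta lamE zE; congr (_ ^+ 2).
    apply/eqP; rewrite eq_complex /=; apply/andP; split; apply/eqP; rewrite ?pE ?qD; ring.
  rewrite expr2 /=.
  have qE : `|q| = t * `|b| by rewrite qD normrM ger0_norm.
  have pq : m <= p - `|q|.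
    rewrite qE pE; have : t * m <= t * (a - `|b|) by rewrite ler_wpM2l.
    have : (1 - t) * m <= 1 - t by rewrite ler_piMr// subr_ge0.
    by lra.
  have p0 : 0 < p by have := normr_ge0 q; lra.
  have q2 : q ^+ 2 = `|q| ^+ 2 by rewrite real_normK ?num_real.
  have h1 : m ^+ 2 * x ^+ 2 <= (p ^+ 2 - q ^+ 2) * x ^+ 2.
    rewrite ler_wpM2r ?sqr_ge0// q2.
    have -> : p ^+ 2 - `|q| ^+ 2 = (p - `|q|) * (p + `|q|) by ring.
    rewrite expr2 ler_pM ?(ltW m0)//; have := normr_ge0 q; lra.
  have cr : `|t * (p * c - q * d)| <= Z.
    rewrite normrM (ger0_norm t0); apply: le_trans (_ : `|p * c - q * d| <= _).
      by rewrite ler_piMl.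
    apply: le_trans (ler_normB _ _) _; rewrite !normrM (gtr0_norm p0) qE /Z.
    have e1 : p <= 1 + a + `|b|.
      have : t * a <= a by rewrite ler_piMl// ltW.
      have := normr_ge0 b; rewrite pE; lra.
    have e2 : t * `|b| <= 1 + a + `|b|.
      have : t * `|b| <= `|b| by rewrite ler_piMl.
      lra.
    by rewrite mulrDr; apply: lerD; rewrite ler_wpM2r.
  have h2 : - (2 * (`|x| * Z)) <= 2 * (x * (t * (p * c - q * d))).
    have : `|x * (t * (p * c - q * d))| <= `|x| * Z by rewrite normrM ler_wpM2l.
    by rewrite ler_norml => /andP[]; lra.
  have h3 : 0 <= (m ^+ 2 / 2) * (`|x| - 2 * Z / m ^+ 2) ^+ 2.
    by rewrite mulr_ge0 ?sqr_ge0// divr_ge0// sqr_ge0.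
  have h3E : (m ^+ 2 / 2) * (`|x| - 2 * Z / m ^+ 2) ^+ 2 =
    m ^+ 2 / 2 * x ^+ 2 - 2 * (`|x| * Z) + 2 * Z ^+ 2 / m ^+ 2.
    rewrite -[x ^+ 2]real_normK ?num_real//; field.
    by rewrite gt_eqF.
  have h4 : (t * d) ^+ 2 <= d ^+ 2.
    by rewrite exprMn ler_piMl ?sqr_ge0// expr_le1.
  have h5 := sqr_ge0 (t * c).
  have -> : (p * x + t * c) * (p * x + t * c) - (q * x + t * d) * (q * x + t * d)
    = (p ^+ 2 - q ^+ 2) * x ^+ 2 + 2 * (x * (t * (p * c - q * d)))
      + (t * c) ^+ 2 - (t * d) ^+ 2 by ring.
  by lra.
- move=> t x It; have /andP[t0 t1] := It.
  apply: le_trans (cabsD _ _) _; rewrite !cabsM !cabs_real (ger0_norm t0).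
  have e1 : cabs (lamt t) * `|x| <= (1 + cabs eta) * `|x| by rewrite ler_wpM2r ?lM.
  have e2 : t * cabs z <= cabs z by rewrite ler_piMl ?cabs_ge0.
  have e3 : 0 <= cabs z * `|x| by rewrite mulr_ge0.
  by rewrite /M; lra.
- by move=> t It; apply: le_trans (lM _ It) _; rewrite /M; lra.
Qed.

(* Along lam_t = 1 + t (lam - 1), z_t = t z the t-derivative of the integrand
   lam_t g(u) is the x-derivative of (lam_t' x + z_t') g(u), so that it has a
   small Riemann sum. *)
Lemma riemann_gk_contour k : exists K, forall L (h : R), 0 < h -> h <= 1 ->
  cabs (zsum L (fun l => h%:C * (lam * gk k (lam * (l%:~R * h)%:C + z))) -
        zsum L (fun l => h%:C * gk k (l%:~R * h)%:C)) <=
  2 * K / (1 + L%:R * h) ^+ 2 + 12 * K * h.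
Proof.
have [d [K0 [M [d0 uK uM lM]]]] := contour_Re.
have M0 : 0 <= M.
  by apply: le_trans (cabs_ge0 (lamt 0)) (lM _ _); rewrite /I01 /= lexx ler01.
pose s (x : R) : C := eta * x%:C + z.
have sM (t x : R) : I01 t -> cabs (s x) <= (cabs eta + cabs z) * (1 + `|x|).
  move=> _; apply: le_trans (cabsD _ _) _; rewrite cabsM cabs_real.
  have := cabs_ge0 eta; have : 0 <= cabs z * `|x| by rewrite mulr_ge0 ?cabs_ge0.
  by lra.
pose H (t x : R) : C := s x * gk k (ut t x).
pose H1 (t x : R) : C := eta * gk k (ut t x) + s x * (lamt t * dgk k (ut t x)).
pose H2 (t x : R) : C := 2 * eta * lamt t * dgk k (ut t x) +
  s x * (lamt t ^+ 2 * ddgk k (ut t x)).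
have rH : rapid I01 H by apply: (rapidM sM); exact: (rapid_gk d0 uK uM).
have rH2 : rapid I01 H2.
  apply: rapidD.
    apply: (rapidZ (a := fun t => 2 * eta * lamt t) (K := cabs (2 * eta) * M)).
      by move=> t It; rewrite cabsM ler_wpM2l ?cabs_ge0 ?lM.
    exact: (rapid_dgk d0 uK uM).
  apply: (rapidM sM).
  apply: (rapidZ (a := fun t => lamt t ^+ 2) (K := M ^+ 2)).
    by move=> t It; rewrite cabsX lerXn2r ?nnegrE ?cabs_ge0 ?lM.
  exact: (rapid_ddgk d0 uK uM).
have [KH KH0 bH] := rapid_bound rH; have [KH2 KH20 bH2] := rapid_bound rH2.
pose K := KH + KH2; have KK0 : 0 <= K by rewrite addr_ge0.
have dutx t x : cderiv (ut t) x (lamt t).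
  have := cderivD (cderivM (cderiv_cst (lamt t) x) (cderiv_id x)) (cderiv_cst (t%:C * z) x).
  by move/cderiv_eq; apply; rewrite mul0r add0r mulr1 addr0.
have dlt t : cderiv lamt t eta.
  have := cderivD (cderiv_cst 1 t) (cderivM (cderiv_id t) (cderiv_cst eta t)).
  by move/cderiv_eq; apply; rewrite mulr0 addr0 mul1r add0r.
have dutt t x : cderiv (fun t => ut t x) t (s x).
  have := cderivD (cderivM (dlt t) (cderiv_cst x%:C t)) (cderivM (cderiv_id t) (cderiv_cst z t)).
  by move/cderiv_eq; apply; rewrite !mulr0 !addr0 mul1r.
have ds x : cderiv s x eta.
  have := cderivD (cderivM (cderiv_cst eta x) (cderiv_id x)) (cderiv_cst z x).
  by move/cderiv_eq; apply; rewrite mul0r add0r mulr1 addr0.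
have dH t x : cderiv (H t) x (H1 t x).
  exact: cderivM (ds x) (cderiv_gk k (dutx t x)).
have dH1 t x : cderiv (H1 t) x (H2 t x).
  have h1 := cderivM (cderiv_cst eta x) (cderiv_gk k (dutx t x)).
  have h2 := cderivM (ds x) (cderivM (cderiv_cst (lamt t) x) (cderiv_dgk k (dutx t x))).
  by apply: (cderiv_eq (cderivD h1 h2)); rewrite /H2; ring.
exists K => L h h0 h1.
pose S (t : R) := zsum L (fun l => h%:C * (lamt t * gk k (ut t (l%:~R * h)))).
have dS t : cderiv S t (zsum L (fun l => h%:C * H1 t (l%:~R * h))).
  apply: cderiv_sum => i; set x := _ * h.
  have := cderivM (cderiv_cst h%:C t) (cderivM (dlt t) (cderiv_gk k (dutt t x))).
  by move/cderiv_eq; apply; rewrite /H1; ring.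
have <- : S 1 = zsum L (fun l => h%:C * (lam * gk k (lam * (l%:~R * h)%:C + z))).
  apply: eq_zsum => l; rewrite /ut /lamt mul1r /eta.
  by rewrite (_ : (1 : R)%:C * z = z) ?mul1r// addrC subrK.
have <- : S 0 = zsum L (fun l => h%:C * gk k (l%:~R * h)%:C).
  apply: eq_zsum => l; rewrite /ut /lamt.
  by rewrite (_ : (0 : R)%:C = 0)// !mul0r !addr0 !mul1r.
have leK (K1 : R) x : K1 <= K -> K1 / (1 + `|x|) ^+ 2 <= K / (1 + `|x|) ^+ 2.
  by move=> ?; rewrite ler_wpM2r// invr_ge0 exprn_ge0// addr_ge0.
have dSK t : 0 <= t <= 1 -> cabs (zsum L (fun l => h%:C * H1 t (l%:~R * h))) <=
    2 * K / (1 + L%:R * h) ^+ 2 + 12 * K * h.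
  move=> It; apply: (riemann_sum_deriv L (dH t) (dH1 t) KK0) => // x.
    by apply: le_trans (bH _ _ It) _; apply: leK; rewrite lerDl.
  by apply: le_trans (bH2 _ _ It) _; apply: leK; rewrite lerDr.
by have := cabs_mvt ler01 (fun t _ => dS t) dSK; rewrite subr0 mulr1.
Qed.

End Contour.

End Gaussian.

(** * Poisson summation for Gaussians with polynomial factors *)

Section GaussianPoisson.
Variable R : realType.
Local Notation C := R[i].
Local Notation iota := (Complex 0 1 : C).

Lemma acute_neq0 (lam : C) : acute lam -> lam != 0.
Proof.
move=> h; apply/eqP => l0; move: h; rewrite l0 /acute /= normr0 ltxx; exact.
Qed.

Lemma acuteV (lam : C) : acute lam -> acute lam^-1.
Proof.
case: lam => a b; rewrite /acute /= => ab.
have a0 : 0 < a by apply: le_lt_trans ab.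
have n0 : 0 < a ^+ 2 + b ^+ 2 by rewrite ltr_pwDl ?sqr_ge0// exprn_gt0.
have i0 : 0 < (a ^+ 2 + b ^+ 2)^-1 by rewrite invr_gt0.
by rewrite normrN normrM (gtr0_norm i0) ltr_pM2r.
Qed.

Lemma acute1 : acute (1 : C).
Proof. by rewrite /acute /= normr0 ltr01. Qed.

Lemma acute_scale (c : R) (lam : C) : 0 < c -> acute lam -> acute (c%:C * lam).
Proof.
case: lam => a b c0; rewrite /acute /= !mul0r subr0 addr0 => ab.
by rewrite normrM (gtr0_norm c0) ltr_pM2l.
Qed.

Lemma affine_Re (lam z : C) : acute lam -> exists d K M : R, [/\ 0 < d,
  forall x : R, d * x ^+ 2 - K <= complex.Re ((lam * x%:C + z) ^+ 2) &
  forall x : R, cabs (lam * x%:C + z) <= M * (1 + `|x|)].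
Proof.
move=> /contour_Re-/(_ z)[d [K [M [d0 h1 h2 _]]]].
have E (x : R) : (1 + (1 : R)%:C * (lam - 1)) * x%:C + (1 : R)%:C * z = lam * x%:C + z.
  by rewrite (_ : (1 : R)%:C = 1)//; ring.
have I1 : 0 <= (1 : R) <= 1 by rewrite ler01 lexx.
exists d, K, M; split => // x; first by rewrite -E; exact: h1.
by rewrite -E; exact: h2.
Qed.

Lemma rapid_gk_affine (lam z : C) k : acute lam ->
  rapid [set: unit] (fun _ x => gk k (lam * x%:C + z)).
Proof.
move=> /affine_Re-/(_ z)[d [K [M [d0 h1 h2]]]].
exact: (@rapid_gk _ _ _ (fun _ x => lam * x%:C + z) d K M d0 (fun _ x _ => h1 x) (fun _ x _ => h2 x)).
Qed.

Lemma rapid_ddgk_affine (lam z : C) k : acute lam ->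
  rapid [set: unit] (fun _ x => ddgk k (lam * x%:C + z)).
Proof.
move=> /affine_Re-/(_ z)[d [K [M [d0 h1 h2]]]].
exact: (@rapid_ddgk _ _ _ (fun _ x => lam * x%:C + z) d K M d0 (fun _ x _ => h1 x) (fun _ x _ => h2 x)).
Qed.

Lemma rapid_sum T (D : set T) I (r : seq I) (f : I -> T -> R -> C) :
  (forall i, rapid D (f i)) -> rapid D (fun t x => \sum_(i <- r) f i t x).
Proof.
move=> h; elim: r => [|i r ih].
  by move=> m; exists 0 => t x _; rewrite big_nil cabs0 mulr0.
have -> : (fun t x => \sum_(j <- i :: r) f j t x) =
    (fun t x => f i t x + \sum_(j <- r) f j t x).
  by apply/funext => t; apply/funext => x; rewrite big_cons.
exact: rapidD.
Qed.

Lemma zsum_le B (f : int -> R) K :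
  (forall j, f j <= K / (1 + `|j%:~R|) ^+ 2) -> 0 <= K -> zsum B f <= 3 * K.
Proof.
move=> fK K0.
have := @zsum_inv_sqr R B 1 ltr01 (lexx _); rewrite mul1r => /(ler_wpM2l K0).
rewrite -zsumZ [K * 3]mulrC => h; apply: le_trans h; apply: le_zsum => l.
by rewrite mulr1; exact: fK.
Qed.

Lemma cabs_zsum_le B (f : int -> C) K :
  (forall j, cabs (f j) <= K / (1 + `|j%:~R|) ^+ 2) -> cabs (zsum B f) <= 3 * K.
Proof.
move=> fK; apply: le_trans (cabs_zsum _ _) _; apply: (zsum_le _ fK).
have := fK 0; rewrite normr0 addr0 expr1n divr1; exact: le_trans (cabs_ge0 _).
Qed.

Lemma rapid_shift_bound T (D : set T) (f : T -> R -> C) (b : R) : rapid D f ->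
  exists K, forall t (j : int), D t ->
    cabs (f t (b - j%:~R)) <= K / (1 + `|j%:~R|) ^+ 2.
Proof.
move=> /rapid_bound[K K0 fK]; exists (K * (1 + `|b|) ^+ 2) => t j Dt.
apply: le_trans (fK _ _ Dt) _; set y := b - j%:~R.
have p (x : R) : 0 < 1 + `|x| by rewrite ltr_wpDr.
rewrite -mulrA ler_wpM2l// ler_pdivlMr ?exprn_gt0// ler_pdivrMl ?exprn_gt0//.
rewrite -exprMn lerXn2r ?nnegrE ?mulr_ge0 ?(ltW (p _))//.
have : `|j%:~R| <= `|b| + `|y| :> R.
  by rewrite -[j%:~R](subKr b) -/y; exact: ler_normB.
have : 0 <= `|b| * `|y| by rewrite mulr_ge0.
by lra.
Qed.

(** The k-th Gaussian moment as a Riemann sum on [- B, B]. *)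
Definition mu (k B : nat) : C :=
  zsum (B.*2.+1 * B) (fun l => (mesh R B)%:C * gk k (l%:~R * mesh R B)%:C).

Lemma cabs_mu_le k : exists K, forall B, cabs (mu k B) <= K.
Proof.
have := @rapid_gk_affine 1 0 k acute1 => /rapid_bound[K K0 gK].
exists (K * 3) => B; apply: le_trans (cabs_zsum _ _) _.
have h0 := mesh_gt0 R B; have h1 := mesh_le1 R B.
apply: le_trans (ler_wpM2l K0 (zsum_inv_sqr (B.*2.+1 * B) h0 h1)).
rewrite -!zsumZ; apply: le_zsum => l; rewrite cabsM cabs_real gtr0_norm//.
rewrite mulrCA ler_wpM2l ?(ltW h0)//.
by have := gK tt (l%:~R * mesh R B) I; rewrite mul1r addr0.
Qed.

(** The Fourier integral of [gaussx k (lam ^+ 2) b] after the substitution x = (u + i b / lam) / lam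
    and binomial expansion, with m i in place of the i-th moment in u. The moments are a parameter
    because they are first the Riemann sums [mu] and only later their limits. *)
Definition ghat (lam : C) (k : nat) (m : nat -> C) (b : R) : C :=
  lam ^- k.+1 * \sum_(i < k.+1)
    (iota ^+ i *+ 'C(k, i) * m (k - i)%N * gk i (lam^-1 * b%:C)).

Definition gaussx (k : nat) (w : C) (b x : R) : C :=
  x%:C ^+ k * cexp (- (pi%:C * w * x%:C ^+ 2)) * cexp2pi (b * x).

(* Completing the square, with u = lam x - i b / lam. *)
Lemma gaussxE k lam (b x : R) : lam != 0 ->
  gaussx k (lam ^+ 2) b x = lam ^- k * \sum_(i < k.+1)
    (iota ^+ i *+ 'C(k, i) * gk (k - i) (lam * x%:C - iota * (lam^-1 * b%:C))
      * gk i (lam^-1 * b%:C)).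
Proof.
move=> l0; set y := lam^-1 * b%:C; set u := lam * x%:C - _.
have xE : x%:C = lam^-1 * (u + iota * y) by rewrite /u subrK mulKf.
have EE : cexp (- (pi%:C * lam ^+ 2 * x%:C ^+ 2)) * cexp2pi (b * x) =
    cexp (- (pi%:C * u ^+ 2)) * cexp (- (pi%:C * y ^+ 2)).
  rewrite /cexp2pi -!cexpD; congr cexp.
  have -> : Complex 0 (2 * pi * (b * x)) = 2 * pi%:C * iota * (b%:C * x%:C).
    rewrite (_ : (2 : C) = (2 : R)%:C); last by rewrite rmorph_nat.
    by apply/eqP; rewrite eq_complex /=; apply/andP; split; apply/eqP; ring.
  have i2 : iota ^+ 2 = -1 by exact: sqr_i.
  have bE : b%:C = lam * y by rewrite /y mulrA divff ?mul1r.
  have -> : u ^+ 2 = lam ^+ 2 * x%:C ^+ 2 - 2 * iota * (lam * y) * x%:C + iota ^+ 2 * y ^+ 2.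
    by rewrite /u; ring.
  by rewrite i2 -bE; ring.
rewrite /gaussx -mulrA EE {1}xE exprMn exprVn exprDn -mulrA; congr (_ * _).
rewrite mulr_suml; apply: eq_bigr => i _; rewrite /gk exprMn.
move: (u ^+ (k - i)) (y ^+ i) (iota ^+ i) (cexp _) (cexp _) 'C(k, i) => p q r e f n.
by ring.
Qed.

Lemma gaussx_twist k w (b x : R) (j : int) :
  gaussx k w b x * cexp2pi (- (j%:~R * x)) = gaussx k w (b - j%:~R) x.
Proof.
by rewrite /gaussx -mulrA -cexp2piD; congr (_ * cexp2pi _); ring.
Qed.

Lemma gaussx_bounds k lam b : acute lam -> exists (g1 g2 : R -> C) (K : R),
  [/\ 0 <= K,
     forall x, cderiv (gaussx k (lam ^+ 2) b) x (g1 x) /\ cderiv g1 x (g2 x),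
     forall x, cabs (gaussx k (lam ^+ 2) b x) <= K / (1 + `|x|) ^+ 2 &
     forall x, cabs (g2 x) <= K / (1 + `|x|) ^+ 2].
Proof.
move=> al; have l0 := acute_neq0 al; set y := lam^-1 * b%:C.
pose c i := lam ^- k * (iota ^+ i *+ 'C(k, i) * gk i y).
pose z := - (iota * y).
pose g (x : R) := \sum_(i < k.+1) c i * gk (k - i) (lam * x%:C + z).
pose g1 (x : R) := \sum_(i < k.+1) c i * (lam * dgk (k - i) (lam * x%:C + z)).
pose g2 (x : R) := \sum_(i < k.+1) c i * (lam * (lam * ddgk (k - i) (lam * x%:C + z))).
have gE : gaussx k (lam ^+ 2) b = g.
  apply/funext => x; rewrite gaussxE// mulr_sumr; apply: eq_bigr => i _.
  by rewrite /c -/y -/z; ring.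
have du x : cderiv (fun x : R => lam * x%:C + z) x lam.
  have := cderivD (cderivM (cderiv_cst lam x) (cderiv_id x)) (cderiv_cst z x).
  by move/cderiv_eq; apply; rewrite mul0r add0r mulr1 addr0.
have dg x : cderiv g x (g1 x).
  apply: cderiv_sum => i.
  have := cderivM (cderiv_cst (c i) x) (cderiv_gk (k - i) (du x)).
  by move/cderiv_eq; apply; rewrite mul0r add0r.
have dg1 x : cderiv g1 x (g2 x).
  apply: cderiv_sum => i.
  have := cderivM (cderiv_cst (c i) x)
    (cderivM (cderiv_cst lam x) (cderiv_dgk (k - i) (du x))).
  by move/cderiv_eq; apply; rewrite !mul0r !add0r.
have rg : rapid [set: unit] (fun _ => g).
  apply: rapid_sum => i; apply: (rapidZ (a := fun=> c i) (K := cabs (c i))) => //.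
  exact: rapid_gk_affine.
have rg2 : rapid [set: unit] (fun _ => g2).
  apply: rapid_sum => i; apply: (rapidZ (a := fun=> c i) (K := cabs (c i))) => //.
  do 2!apply: (rapidZ (a := fun=> lam) (K := cabs lam)) => //.
  exact: rapid_ddgk_affine.
have [K K0 gK] := rapid_bound rg; have [K2 K20 g2K] := rapid_bound rg2.
have leK (K1 x : R) : K1 <= K + K2 ->
    K1 / (1 + `|x|) ^+ 2 <= (K + K2) / (1 + `|x|) ^+ 2.
  by move=> ?; rewrite ler_wpM2r// invr_ge0 exprn_ge0// addr_ge0.
exists g1, g2, (K + K2); split => [||x|x].
- exact: addr_ge0.
- by rewrite gE.
- by rewrite gE; apply: le_trans (gK tt x I) _; apply: leK; rewrite lerDl.
- by apply: le_trans (g2K tt x I) _; apply: leK; rewrite lerDr.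
Qed.

(** A twist by the frequency j replaces b by b - j. One factor lam goes inside the sums, as the dz =
    lam dx of [riemann_gk_contour]. *)
Lemma dft_gaussx k lam b B j : lam != 0 ->
  dft (gaussx k (lam ^+ 2) b) B j = lam ^- k.+1 * \sum_(i < k.+1)
    (iota ^+ i *+ 'C(k, i) *
      zsum (B.*2.+1 * B) (fun l => (mesh R B)%:C * (lam * gk (k - i)
        (lam * (l%:~R * mesh R B)%:C - iota * (lam^-1 * (b - j%:~R)%:C)))) *
      gk i (lam^-1 * (b - j%:~R)%:C)).
Proof.
move=> l0; rewrite /dft; set y := lam^-1 * _.
under eq_zsum => l do rewrite gaussx_twist gaussxE// -/y mulrCA mulr_sumr.
rewrite zsumZ; set h := mesh R B; set L := (_ * B)%N.
transitivity (lam ^- k * \sum_(i < k.+1) (iota ^+ i *+ 'C(k, i) *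
    zsum L (fun l => h%:C * gk (k - i) (lam * (l%:~R * h)%:C - iota * y)) * gk i y)).
  congr (_ * _); rewrite /zsum exchange_big; apply: eq_bigr => i _.
  by rewrite mulr_sumr mulr_suml; apply: eq_bigr => l _ /=; ring.
rewrite !mulr_sumr; apply: eq_bigr => i _.
under [in RHS]eq_zsum => l do rewrite mulrCA.
rewrite [in RHS]zsumZ exprS invfM; move: (zsum _ _) (lam ^- k) => Z q.
by field.
Qed.

Lemma rapid_ghat (T : Type) (m : T -> nat -> C) k lam K : acute lam ->
  (forall t i, (i <= k)%N -> cabs (m t i) <= K) ->
  rapid [set: T] (fun t => ghat lam k (m t)).
Proof.
move=> al mK; apply: (rapidZ (a := fun=> _) (K := cabs (lam ^- k.+1))) => //.
apply: rapid_sum => i.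
apply: (rapidZ (a := fun t => iota ^+ i *+ 'C(k, i) * m t (k - i)%N)
  (K := cabs (iota ^+ i *+ 'C(k, i)) * K)).
  by move=> t _; rewrite cabsM ler_wpM2l ?cabs_ge0// mK// leq_subr.
have h := @rapid_gk_affine _ 0 i (acuteV al).
move=> p; have [M hM] := h p; exists M => _ x _.
by have := hM tt x I; rewrite addr0.
Qed.

(** The moments are the Riemann sums of the same level B, so no Gaussian integral has to be known:
    the contour shift compares a Riemann sum on a shifted line with the one on the real line. *)
Lemma poisson_gaussx_mu k lam b : acute lam ->
  tends0 (fun B => cabs (zsum B (fun m => gaussx k (lam ^+ 2) b m%:~R) -
    zsum B (fun j => ghat lam k (mu^~ B) (b - j%:~R)))).
Proof.
move=> al; have l0 := acute_neq0 al.
have [g1 [g2 [K [K0 dg gK g2K]]]] := gaussx_bounds k b al.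
have [mK muK] : exists mK, forall i B, (i <= k)%N -> cabs (mu i B) <= mK.
  elim: k {dg gK g2K} => [|k [mK ih]].
    have [L h] := cabs_mu_le 0; exists L => i B; rewrite leqn0 => /eqP ->; exact: h.
  have [L h] := cabs_mu_le k.+1; exists (Num.max mK L) => i B.
  rewrite leq_eqVlt => /predU1P[->|]; first by rewrite le_max h orbT.
  by rewrite ltnS => /ih; rewrite le_max => ->.
have rgh : rapid [set: nat] (fun B => ghat lam k (mu^~ B)).
  by apply: (rapid_ghat al (K := mK)) => B i ik; exact: muK.
have [K' aK] := rapid_shift_bound b rgh.
apply: (@poisson_of_dft _ _ g1 g2 K (fun x => (dg x).1) (fun x => (dg x).2) K0 gK g2K
  (fun j B => ghat lam k (mu^~ B) (b - j%:~R)) K') => [j B|j]; first exact: aK.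
set y := lam^-1 * (b - j%:~R)%:C.
pose D i B := zsum (B.*2.+1 * B) (fun l => (mesh R B)%:C * (lam * gk (k - i)
   (lam * (l%:~R * mesh R B)%:C + - (iota * y)))) - mu (k - i) B.
have D0 i : tends0 (fun B => cabs (D i B)).
  have [K1 hK1] := riemann_gk_contour (- (iota * y)) al (k - i).
  have h1 := @tends0_inv R (`|2 * K1| + `|12 * K1|).
  apply: tends0_le h1; exists 0%N => B _.
  apply: le_trans (hK1 _ _ (mesh_gt0 R B) (mesh_le1 R B)) _.
  rewrite mesh_range [leRHS]mulrDl; apply: lerD.
    apply: le_trans (_ : `|2 * K1| / (1 + B%:R) ^+ 2 <= _).
      by rewrite ler_wpM2r ?ler_norm// invr_ge0 exprn_ge0.
    rewrite ler_wpM2l// lef_pV2 ?posrE ?exprn_gt0 ?ltr_wpDr//.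
    by rewrite ler_eXnr// lerDl.
  apply: le_trans (_ : `|12 * K1| * mesh R B <= _).
    by rewrite ler_wpM2r ?ler_norm// ltW// mesh_gt0.
  rewrite ler_wpM2l// /mesh lef_pV2 ?posrE// ?ltr_wpDr//.
  by rewrite -[1]/(1%:R) -natrD ler_nat; lia.
pose c i := lam ^- k.+1 * (iota ^+ i *+ 'C(k, i) * gk i y).
have := @tends0_sum R _ (index_enum 'I_k.+1) xpredT _
  (fun i _ => tends0Z (cabs_ge0 (c i)) (D0 i)).
apply: tends0_le; exists 0%N => B _; rewrite dft_gaussx// -/y /ghat -/y -mulrBr -sumrB.
rewrite mulr_sumr; apply: le_trans (cabs_sum _ _ _) _; apply: ler_sum => i _.
rewrite -cabsM /D /c le_eqVlt; apply/orP; left; apply/eqP; congr cabs; ring.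
Qed.

Lemma poisson_gaussx_lim k lam b (m : nat -> C) : acute lam ->
  (forall i, (i <= k)%N -> ctends (mu i) (m i)) ->
  tends0 (fun B => cabs (zsum B (fun l => gaussx k (lam ^+ 2) b l%:~R) -
    zsum B (fun j => ghat lam k m (b - j%:~R)))).
Proof.
move=> al mum.
pose G i B := zsum B (fun j : int => gk i (lam^-1 * (b - j%:~R)%:C)).
have Gb i : exists K, forall B, cabs (G i B) <= K.
  have [K hK] := rapid_shift_bound b (@rapid_gk_affine _ 0 i (acuteV al)).
  exists (3 * K) => B; apply: cabs_zsum_le => j.
  by have := hK tt j I; rewrite addr0.
pose c i := lam ^- k.+1 * (iota ^+ i *+ 'C(k, i)).
have h i : (i < k.+1)%N ->
    tends0 (fun B => cabs (c i * (G i B * (mu (k - i) B - m (k - i)%N)))).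
  move=> ik; have [K hK] := Gb i.
  have := tends0Z (cabs_ge0 (c i)) (tends0_cabsM hK (mum (k - i)%N (leq_subr _ _))).
  by apply: tends0_le; exists 0%N => B _; rewrite -cabsM.
have := tends0D (poisson_gaussx_mu k b al)
  (@tends0_sum R _ (index_enum 'I_k.+1) xpredT _ (fun i _ => h i (ltn_ord i))).
apply: tends0_le; exists 0%N => B _.
set X := zsum B _; set Y := zsum B _; set Z := zsum B _.
rewrite (_ : X - Y = (X - Z) + (Z - Y)); last by ring.
apply: le_trans (cabsD _ _) _; rewrite lerD2l.
apply: le_trans (cabs_sum _ _ _).
rewrite le_eqVlt; apply/orP; left; apply/eqP; congr cabs.
rewrite /Z /Y /ghat !zsumZ -mulrBr /zsum exchange_big /= [X in _ - X]exchange_big /=.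
rewrite -sumrB mulr_sumr; apply: eq_bigr => i _.
rewrite -!mulr_sumr /c /G /zsum; ring.
Qed.

Lemma zsum_odd (f : int -> C) B : (forall l, f (- l) = - f l) -> zsum B f = 0.
Proof.
move=> fN; have f0 : f 0 = 0.
  have := fN 0; rewrite oppr0 => /eqP; rewrite -subr_eq0 opprK -mulr2n.
  by rewrite mulrn_eq0 => /eqP.
by elim: B => [|B ih]; rewrite ?zsum0// zsumS ih fN subrr addr0.
Qed.

Lemma mu1 B : mu 1 B = 0.
Proof.
apply: zsum_odd => l; rewrite mulrNz mulNr rmorphN /gk !expr1 sqrrN; ring.
Qed.

Lemma Re_zsum_gk0_ge1 B :
  1 <= complex.Re (zsum B (fun j : int => gk 0 (j%:~R : R)%:C)).
Proof.
have e (j : int) : complex.Re (gk 0 (j%:~R : R)%:C) = expR (- (pi * j%:~R ^+ 2)).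
  by rewrite /gk expr0 mul1r -rmorphXn -rmorphM -rmorphN cexp_real.
rewrite /zsum cRe_sum -/(zsum B (fun j : int => complex.Re (gk 0 (j%:~R : R)%:C))).
elim: B => [|B ih]; first by rewrite zsum0 e expr0n mulr0 oppr0 expR0.
by rewrite zsumS -[leLHS]addr0 lerD// !e addr_ge0 ?expR_ge0.
Qed.

(** For lam = 1 and b = 0 the two sides of Poisson summation are T and [mu 0 B] times the same T. As
    Re T >= 1, this factor tends to 1. *)
Lemma ctends_mu0 : ctends (mu 0) 1.
Proof.
have := poisson_gaussx_mu 0 0 acute1.
apply: tends0_le; exists 0%N => B _.
set T := zsum B (fun j : int => gk 0 (j%:~R : R)%:C).
have -> : zsum B (fun m : int => gaussx 0 (1 ^+ 2) 0 m%:~R) = T.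
  apply: eq_zsum => m; rewrite /gaussx /gk mul0r cexp2pi0 !expr0 !expr1n.
  by rewrite !mul1r mulr1 mulr1.
have -> : zsum B (fun j : int => ghat 1 0 (mu^~ B) (0 - j%:~R)) = mu 0 B * T.
  rewrite -zsumZ; apply: eq_zsum => j; rewrite /ghat big_ord1 /= bin0 expr0 mulr1n.
  by rewrite expr1n invr1 !mul1r sub0r rmorphN /gk sqrrN !expr0.
rewrite (_ : T - mu 0 B * T = - (mu 0 B - 1) * T); last by ring.
rewrite cabsM cabsN ler_peMr ?cabs_ge0//.
by apply: le_trans (Re_zsum_gk0_ge1 B) _; apply: le_trans (ler_norm _) (Re_le_cabs _).
Qed.

(** Integration by parts: the derivative of u exp (- pi u^2) is the zeroth integrand minus 2 pi
    times the second one, and its Riemann sums tend to 0. *)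
Lemma ctends_mu2 : ctends (mu 2) (2 * pi%:C)^-1.
Proof.
have p0 : pi%:C != 0 :> C.
  by rewrite (fmorph_eq0 (real_complex R)) gt_eqF// pi_gt0.
have du x : cderiv (fun x : R => x%:C) x 1 by exact: cderiv_id.
have d1 x : cderiv (fun x : R => gk 1 x%:C) x (dgk 1 x%:C).
  by apply: (cderiv_eq (cderiv_gk 1 (du x))); rewrite mul1r.
have d2 x : cderiv (fun x : R => dgk 1 x%:C) x (ddgk 1 x%:C).
  by apply: (cderiv_eq (cderiv_dgk 1 (du x))); rewrite mul1r.
have [K K0 gK] := rapid_bound (@rapid_gk_affine 1 0 1 acute1).
have [K' K'0 g2K] := rapid_bound (@rapid_ddgk_affine 1 0 1 acute1).
have leK (K1 x : R) : K1 <= K + K' ->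
    K1 / (1 + `|x|) ^+ 2 <= (K + K') / (1 + `|x|) ^+ 2.
  by move=> ?; rewrite ler_wpM2r// invr_ge0 exprn_ge0// addr_ge0.
have KK0 : 0 <= K + K' by rewrite addr_ge0.
have h : tends0 (fun B => cabs (mu 0 B - 2 * pi%:C * mu 2 B)).
  apply: tends0_le (@tends0_inv R (14 * (K + K'))); exists 0%N => B _.
  have -> : mu 0 B - 2 * pi%:C * mu 2 B =
      zsum (B.*2.+1 * B) (fun l => (mesh R B)%:C * dgk 1 (l%:~R * mesh R B)%:C).
    rewrite /mu -zsumZ -zsumB; apply: eq_zsum => l; rewrite /dgk; ring.
  apply: le_trans (riemann_sum_deriv (B.*2.+1 * B) d1 d2 KK0 _ _ (mesh_gt0 R B) (mesh_le1 R B)) _.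
  - move=> x; apply: le_trans (leK K x _); last by rewrite lerDl.
    by have := gK tt x I; rewrite mul1r addr0.
  - move=> x; apply: le_trans (leK K' x _); last by rewrite lerDr.
    by have := g2K tt x I; rewrite mul1r addr0.
  rewrite mesh_range (_ : 14 * (K + K') / _ = 2 * (K + K') / (1 + B%:R) + 12 * (K + K') / (1 + B%:R)); last by ring.
  apply: lerD.
    rewrite ler_wpM2l ?mulr_ge0// lef_pV2 ?posrE ?exprn_gt0 ?ltr_wpDr//.
    by rewrite ler_eXnr// lerDl.
  rewrite ler_wpM2l ?mulr_ge0// /mesh lef_pV2 ?posrE// ?ltr_wpDr//.
  by rewrite -[1]/(1%:R) -natrD ler_nat; lia.
have := tends0Z (cabs_ge0 (2 * pi%:C)^-1) (tends0D ctends_mu0 h).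
apply: tends0_le; exists 0%N => B _.
rewrite (_ : mu 2 B - _ = (2 * pi%:C)^-1 * ((mu 0 B - 1) - (mu 0 B - 2 * pi%:C * mu 2 B))); last first.
  by move: p0; move: (pi%:C) => p p0; field.
by rewrite cabsM ler_wpM2l ?cabs_ge0//; exact: cabsB.
Qed.

(** Degrees up to 2 suffice, since a monomial x_i x_j has degree at most 2 in each coordinate;
    beyond them the value is the default 0. *)
Definition gauss_moment (k : nat) : C :=
  nth 0 [:: 1; 0; (2 * pi%:C)^-1] k.

Lemma poisson_gaussx k lam b : (k <= 2)%N -> acute lam ->
  tends0 (fun B => cabs (zsum B (fun l => gaussx k (lam ^+ 2) b l%:~R) -
    zsum B (fun j => ghat lam k gauss_moment (b - j%:~R)))).
Proof.
move=> k2 al; apply: poisson_gaussx_lim al _ => i ik.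
case: i ik => [|[|[|i]]] ik; rewrite /gauss_moment /=.
- exact: ctends_mu0.
- by apply: tends0_le (@tends0_cst0 R); exists 0%N => B _; rewrite mu1 subr0 cabs0.
- exact: ctends_mu2.
- by have := leq_trans ik k2.
Qed.

Lemma ghatE lam k (b : R) : (k <= 2)%N -> lam != 0 ->
  ghat lam k gauss_moment b = lam^-1 * cexp (- (pi%:C * (b%:C / lam) ^+ 2)) *
    nth 0 [:: 1; iota * b%:C / lam ^+ 2;
      (2 * pi%:C * lam ^+ 2)^-1 - b%:C ^+ 2 / lam ^+ 4] k.
Proof.
move=> k2 l0; have p0 : pi%:C != 0 :> C.
  by rewrite (fmorph_eq0 (real_complex R)) gt_eqF// pi_gt0.
rewrite /ghat /gk; set e := cexp (- (pi%:C * (lam^-1 * b%:C) ^+ 2)).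
have -> : cexp (- (pi%:C * (b%:C / lam) ^+ 2)) = e by rewrite [b%:C / lam]mulrC.
case: k k2 => [|[|[|k]]]//= _.
- by rewrite big_ord1 /= bin0 !expr0 expr1 mulr1n !mulr1 !mul1r.
- rewrite !big_ord_recr big_ord0 /= /gauss_moment !subSS subn0 /= bin0 bin1.
  by rewrite !mulr1n; field.
- rewrite !big_ord_recr big_ord0 /= /gauss_moment !subSS subn0 /= bin0 bin1 binn.
  rewrite !mulr1n (_ : iota ^+ 2 = -1); last exact: sqr_i.
  by move: e p0; move: (pi%:C) => p e p0; field; rewrite p0 l0.
Qed.

End GaussianPoisson.

(** * Unordered sums *)

Section UnorderedSums.
Variables (R : realType) (T : choiceType).
Local Notation C := R[i].
Implicit Types (D : set T) (f g : T -> R) (F : {fset T}).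

(** The body of [lattice_sum] over any [choiceType], convertible to it on column vectors. *)
Definition usum D f : R :=
  fine (\esum_(x in D) (Num.max (f x) 0)%:E)
  - fine (\esum_(x in D) (Num.max (- f x) 0)%:E).

(** Applied to absolute values this is absolute summability with an explicit bound; uniformity in a
    parameter is expressed by a common K. *)
Definition sbound D f (K : R) : Prop :=
  forall F, [set` F] `<=` D -> \sum_(x <- F) f x <= K.

Lemma sbound_ge0 D f K : sbound D f K -> 0 <= K.
Proof.
move=> /(_ fset0); rewrite big_seq_fset0; apply.
by rewrite set_fset0; exact: sub0set.
Qed.

Lemma sbound_le D f g K : (forall x, D x -> f x <= g x) ->
  sbound D g K -> sbound D f K.
Proof.
move=> fg gK F FD; apply: le_trans (gK F FD).
by rewrite big_seq [leRHS]big_seq; apply: ler_sum => x xF; apply: fg; exact: FD.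
Qed.

Lemma sboundZ D f K c : 0 <= c -> sbound D f K ->
  sbound D (fun x => c * f x) (c * K).
Proof. by move=> c0 fK F FD; rewrite -mulr_sumr ler_wpM2l// fK. Qed.

Lemma sboundD D f g K L : sbound D f K -> sbound D g L ->
  sbound D (fun x => f x + g x) (K + L).
Proof. by move=> fK gL F FD; rewrite big_split lerD ?fK ?gL. Qed.

Lemma esum_sbound D f K : (forall x, 0 <= f x) -> sbound D f K ->
  (\esum_(x in D) (f x)%:E <= K%:E)%E.
Proof.
move=> f0 fK; apply: ge_ereal_sup => _ [A [finA AD] <-].
rewrite fsbig_finite//= sumEFin lee_fin; apply: fK.
by rewrite fset_setK.
Qed.

Lemma sbound_summable D f K : sbound D (fun x => `|f x|) K ->
  summable D (fun x => (f x)%:E).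
Proof.
move=> fK; rewrite /summable.
apply: le_lt_trans (ltry K); under eq_esum => x _ do rewrite abse_EFin.
exact: esum_sbound.
Qed.

Lemma ler_sum_subset (r s : seq T) f : uniq r -> uniq s -> {subset r <= s} ->
  (forall x, 0 <= f x) -> \sum_(x <- r) f x <= \sum_(x <- s) f x.
Proof.
move=> ur us rs f0; rewrite [leRHS](bigID (fun x => x \in r)) /=.
have -> : \sum_(x <- r) f x = \sum_(x <- s | x \in r) f x.
  rewrite -[RHS]big_filter; apply: perm_big; apply: uniq_perm => //.
    by rewrite filter_uniq.
  by move=> x; rewrite mem_filter; case: (boolP (x \in r)) => //= /rs ->.
by rewrite lerDl sumr_ge0.
Qed.

Lemma eventually_cover D (s : nat -> seq T) (r : seq T) :
  (forall x, D x -> exists B0, forall B, (B0 <= B)%N -> x \in s B) ->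
  (forall x, x \in r -> D x) ->
  exists B0, forall B, (B0 <= B)%N -> {subset r <= s B}.
Proof.
move=> sx; elim: r => [_|x r ih xD]; first by exists 0%N.
have [|B1 h1] := ih; first by move=> y yr; apply: xD; rewrite inE yr orbT.
have [B2 h2] := sx x (xD x (mem_head _ _)).
exists (maxn B1 B2) => B; rewrite geq_max => /andP[B1B B2B] y.
by rewrite inE => /predU1P[->|]; [exact: h2|exact: h1].
Qed.

Let finsum_le_esum D f F : (forall x, 0 <= f x) -> [set` F] `<=` D ->
  ((\sum_(x <- F) f x)%:E <= \esum_(x in D) (f x)%:E)%E.
Proof.
move=> f0 FD; apply: esum_ge; exists [set` F]; first by split => //; exact: finite_fset.
by rewrite fsbig_finite//= set_fsetK sumEFin.
Qed.

Let approx_nonneg D f K : (forall x, 0 <= f x) -> sbound D f K ->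
  forall e, 0 < e -> exists2 F0, [set` F0] `<=` D &
    forall F, [set` F] `<=` D -> (F0 `<=` F)%fset ->
    `|\sum_(x <- F) f x - fine (\esum_(x in D) (f x)%:E)| <= e.
Proof.
move=> f0 fK e e0; set S := \esum_(x in D) _.
have Sfin : S \is a fin_num.
  rewrite ge0_fin_numE; first exact: le_lt_trans (esum_sbound f0 fK) (ltry _).
  by apply: esum_ge0 => x _; rewrite lee_fin.
have : (S - e%:E < S)%E by rewrite lteBlDr// lteDl// lte_fin.
move=> /ereal_sup_gt[_ [A [finA AD] <-]].
rewrite fsbig_finite//= sumEFin -(fineK Sfin) => h.
exists (fset_set A); first by rewrite fset_setK.
move=> F FD AF.
have h1 : \sum_(x <- F) f x <= fine S.
  by rewrite -lee_fin (fineK Sfin); exact: finsum_le_esum.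
have h2 : \sum_(x <- fset_set A) f x <= \sum_(x <- F) f x.
  by apply: ler_sum_subset; [exact: fset_uniq|exact: fset_uniq|exact/fsubsetP|].
have h3 : fine S - e < \sum_(x <- fset_set A) f x by rewrite -lte_fin.
by rewrite ler_norml; apply/andP; split; lra.
Qed.

Lemma usum_approx D f K : sbound D (fun x => `|f x|) K ->
  forall e, 0 < e -> exists2 F0, [set` F0] `<=` D &
    forall F, [set` F] `<=` D -> (F0 `<=` F)%fset ->
    `|\sum_(x <- F) f x - usum D f| <= e.
Proof.
move=> fK e e0.
have pK : sbound D (fun x => Num.max (f x) 0) K.
  by apply: sbound_le fK => x _; rewrite ge_max ler_norm normr_ge0.
have nK : sbound D (fun x => Num.max (- f x) 0) K.
  by apply: sbound_le fK => x _; rewrite ge_max normr_ge0 andbT -normrN ler_norm.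
have e2 : 0 < e / 2 by rewrite divr_gt0.
have p0 x : 0 <= Num.max (f x) 0 by rewrite le_max lexx orbT.
have n0 x : 0 <= Num.max (- f x) 0 by rewrite le_max lexx orbT.
have [F1 F1D h1] := approx_nonneg p0 pK e2.
have [F2 F2D h2] := approx_nonneg n0 nK e2.
exists (F1 `|` F2)%fset; first by rewrite set_fsetU subUset.
move=> F FD; rewrite fsubUset => /andP[/(h1 _ FD) {}h1 /(h2 _ FD) {}h2].
have -> : \sum_(x <- F) f x =
    \sum_(x <- F) Num.max (f x) 0 - \sum_(x <- F) Num.max (- f x) 0.
  rewrite -sumrB; apply: eq_bigr => x _.
  by have [h|h] := leP (f x) 0; [rewrite max_l|rewrite max_r]; lra.
rewrite /usum; move: h1 h2; rewrite !ler_norml => /andP[h1 h2] /andP[h3 h4].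
by apply/andP; split; lra.
Qed.

Definition csum D (f : T -> C) : C :=
  Complex (usum D (fun x => complex.Re (f x))) (usum D (fun x => complex.Im (f x))).

Lemma csum_approx D (f : T -> C) K : sbound D (fun x => cabs (f x)) K ->
  forall e, 0 < e -> exists2 F0, [set` F0] `<=` D &
    forall F, [set` F] `<=` D -> (F0 `<=` F)%fset ->
    cabs (\sum_(x <- F) f x - csum D f) <= e.
Proof.
move=> fK e e0; have e2 : 0 < e / 2 by rewrite divr_gt0.
have rK : sbound D (fun x => `|complex.Re (f x)|) K.
  by apply: sbound_le fK => x _; exact: Re_le_cabs.
have iK : sbound D (fun x => `|complex.Im (f x)|) K.
  by apply: sbound_le fK => x _; exact: Im_le_cabs.
have [F1 F1D h1] := usum_approx rK e2.
have [F2 F2D h2] := usum_approx iK e2.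
exists (F1 `|` F2)%fset; first by rewrite set_fsetU subUset.
move=> F FD; rewrite fsubUset => /andP[/(h1 _ FD) {}h1 /(h2 _ FD) {}h2].
apply: le_trans (cabs_le_ReIm _) _; rewrite [leRHS]splitr; apply: lerD.
  by rewrite -cRe_sum in h1; move: h1; case: (\sum_(x <- F) f x) => a b.
by rewrite -cIm_sum in h2; move: h2; case: (\sum_(x <- F) f x) => a b.
Qed.

Lemma csum_le D (f : T -> C) K : sbound D (fun x => cabs (f x)) K ->
  cabs (csum D f) <= K.
Proof.
move=> fK; apply/ler_addgt0Pr => e e0; have [F0 F0D h] := csum_approx fK e0.
rewrite -(subKr (\sum_(x <- F0) f x) (csum D f)).
apply: le_trans (cabsB _ _) _; apply: lerD; last exact: h.
by apply: le_trans (cabs_sum _ _ _) _; exact: fK.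
Qed.

Lemma csum_unique D (f : T -> C) K s : sbound D (fun x => cabs (f x)) K ->
  (forall e, 0 < e -> exists2 F0, [set` F0] `<=` D &
    forall F, [set` F] `<=` D -> (F0 `<=` F)%fset ->
    cabs (\sum_(x <- F) f x - s) <= e) -> csum D f = s.
Proof.
move=> fK fs; apply/eqP; rewrite -subr_eq0 -cabs_eq0 eq_le cabs_ge0 andbT.
apply/ler_addgt0Pr => e e0; rewrite add0r.
have e2 : 0 < e / 2 by rewrite divr_gt0.
have [F1 F1D h1] := csum_approx fK e2; have [F2 F2D h2] := fs _ e2.
pose F := (F1 `|` F2)%fset; have FD : [set` F] `<=` D by rewrite set_fsetU subUset.
rewrite (_ : csum D f - s = (\sum_(x <- F) f x - s) - (\sum_(x <- F) f x - csum D f)); last by ring.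
apply: le_trans (cabsB _ _) _; rewrite [leRHS]splitr; apply: lerD.
  by apply: h2 => //; exact: fsubsetUr.
by apply: h1 => //; exact: fsubsetUl.
Qed.

Lemma csumD D (f g : T -> C) K L : sbound D (fun x => cabs (f x)) K ->
  sbound D (fun x => cabs (g x)) L ->
  csum D (fun x => f x + g x) = csum D f + csum D g.
Proof.
move=> fK gL; apply: (@csum_unique _ _ (K + L)) => [|e e0].
  by apply: sbound_le (sboundD fK gL) => x _; exact: cabsD.
have e2 : 0 < e / 2 by rewrite divr_gt0.
have [F1 F1D h1] := csum_approx fK e2; have [F2 F2D h2] := csum_approx gL e2.
exists (F1 `|` F2)%fset; first by rewrite set_fsetU subUset.
move=> F FD; rewrite fsubUset => /andP[/(h1 _ FD) {}h1 /(h2 _ FD) {}h2].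
rewrite big_split /= opprD addrACA; apply: le_trans (cabsD _ _) _.
by rewrite [leRHS]splitr lerD.
Qed.

Lemma csumZ D (f : T -> C) c K : sbound D (fun x => cabs (f x)) K ->
  csum D (fun x => c * f x) = c * csum D f.
Proof.
move=> fK; apply: (@csum_unique _ _ (cabs c * K)) => [|e e0].
  by apply: sbound_le (sboundZ (cabs_ge0 c) fK) => x _; rewrite cabsM.
have c1 : 0 < 1 + cabs c by rewrite ltr_wpDr ?cabs_ge0.
have [F0 F0D h] := csum_approx fK (divr_gt0 e0 c1).
exists F0 => // F FD FF; rewrite -mulr_sumr -mulrBr cabsM.
apply: le_trans (ler_wpM2l (cabs_ge0 c) (h F FD FF)) _.
by rewrite mulrA ler_pdivrMr// mulrC ler_wpM2l ?(ltW e0)// lerDr.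
Qed.

Lemma csum_sum D I (r : seq I) (f : I -> T -> C) (K : I -> R) :
  (forall i, sbound D (fun x => cabs (f i x)) (K i)) ->
  csum D (fun x => \sum_(i <- r) f i x) = \sum_(i <- r) csum D (f i).
Proof.
move=> fK.
have b s : sbound D (fun x => cabs (\sum_(i <- s) f i x)) (\sum_(i <- s) K i).
  elim: s => [|i s ih].
    move=> F _; rewrite big_nil big1// => x _; by rewrite big_nil cabs0.
  rewrite big_cons; apply: sbound_le (sboundD (fK i) ih) => x _.
  by rewrite big_cons; exact: cabsD.
elim: r => [|i r ih].
  rewrite big_nil; apply: (@csum_unique _ _ 0) => [F _|e e0].
    by rewrite big1// => x _; rewrite big_nil cabs0.
  exists fset0; first by rewrite set_fset0; exact: sub0set.
  by move=> F _ _; rewrite big1 ?subr0 ?cabs0 ?ltW// => x _; rewrite big_nil.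
rewrite big_cons -ih -(csumD (fK i) (b r)); congr csum.
by apply/funext => x; rewrite big_cons.
Qed.

Lemma eq_csum D (f g : T -> C) K : sbound D (fun x => cabs (f x)) K ->
  (forall x, D x -> f x = g x) -> csum D f = csum D g.
Proof.
move=> fK fg; apply/esym.
have gK : sbound D (fun x => cabs (g x)) K.
  by apply: sbound_le fK => x Dx; rewrite fg.
apply: (csum_unique gK) => e e0; have [F0 F0D h] := csum_approx fK e0.
exists F0 => // F FD FF; rewrite (_ : \sum_(x <- F) g x = \sum_(x <- F) f x); first exact: h.
by rewrite big_seq [RHS]big_seq; apply: eq_bigr => x xF; rewrite fg//; exact: FD.
Qed.

(** Absolute summability makes the limit independent of the exhaustion; the two sides of the
    inversion formula use different ones. *)
Lemma csum_exhaust D (f : T -> C) K (s : nat -> seq T) :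
  sbound D (fun x => cabs (f x)) K ->
  (forall B, uniq (s B)) -> (forall B x, x \in s B -> D x) ->
  (forall x, D x -> exists B0, forall B, (B0 <= B)%N -> x \in s B) ->
  ctends (fun B => \sum_(x <- s B) f x) (csum D f).
Proof.
move=> fK us sD sx e e0; have [F0 F0D h] := csum_approx fK e0.
have [B0 hB] := eventually_cover sx F0D.
exists B0 => B /hB {}hB.
have -> : \sum_(x <- s B) f x = \sum_(x <- [fset x in s B]%fset) f x.
  apply: perm_big; apply: uniq_perm; [exact: us|exact: fset_uniq|].
  by move=> x; rewrite in_fset.
apply: h; first by move=> x /=; rewrite in_fset; exact: sD.
by apply/fsubsetP => x xF; rewrite in_fset; exact: hB.
Qed.

(** Bridges [theta], a sum over L, and the gradient, a sum over L without 0. *)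
Lemma csum_setD1 D (f : T -> C) K x0 : sbound D (fun x => cabs (f x)) K ->
  f x0 = 0 -> csum (D `\ x0) f = csum D f.
Proof.
move=> fK f0.
have fK' : sbound (D `\ x0) (fun x => cabs (f x)) K.
  by move=> F FD; apply: fK => x /FD[].
apply: (csum_unique fK') => e e0; have [F0 F0D h] := csum_approx fK e0.
have E (F : {fset T}) : \sum_(x <- F) f x = \sum_(x <- (F `\ x0)%fset) f x.
  have [xF|xF] := boolP (x0 \in F); last by rewrite mem_fsetD1.
  by rewrite (big_fsetD1 x0)//= f0 add0r.
exists (F0 `\ x0)%fset.
  by move=> x /=; rewrite in_fsetD1 => /andP[/eqP xx0 /F0D].
move=> F FD FF; pose G := (x0 |` F0 `|` F)%fset.
have [Dx0|Dx0] := pselect (D x0).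
  have -> : \sum_(x <- F) f x = \sum_(x <- G) f x.
    rewrite E [RHS]E; suff -> : (F `\ x0 = G `\ x0)%fset by [].
    apply/fsetP => x.
    rewrite !inE; case: eqVneq => //= xx0.
    have [xF0|//] := boolP (x \in F0).
    by rewrite (fsubsetP FF)// in_fsetD1 xx0.
  apply: h.
    move=> x /=; rewrite !inE -orbA => /or3P[/eqP->//|/F0D//|/FD[]//].
  by apply/fsubsetP => x xF0; rewrite !inE xF0 orbT.
apply: h; first by move=> x /FD[].
apply: fsubset_trans FF; apply/fsubsetP => x xF0; rewrite in_fsetD1 xF0 andbT.
by apply/eqP => xx0; apply: Dx0; rewrite -xx0; exact: F0D.
Qed.

Lemma usumE D f : usum D f = complex.Re (csum D (fun x => (f x)%:C)).
Proof. by []. Qed.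

End UnorderedSums.

(** * Orthogonal frames in integral lattices *)

Section DotProduct.
Variables (R : realType) (n : nat).
Implicit Types (x y z : 'cV[R]_n) (A B : 'M[R]_n).

Lemma dotE x y : dot x y = \sum_i x i 0 * y i 0.
Proof. by rewrite /dot mxE; apply: eq_bigr => i _; rewrite mxE. Qed.

Lemma dotC x y : dot x y = dot y x.
Proof. by rewrite !dotE; apply: eq_bigr => i _; rewrite mulrC. Qed.

Lemma dotDl x y z : dot (x + y) z = dot x z + dot y z.
Proof. by rewrite /dot linearD mulmxDl mxE. Qed.

Lemma dotNl x z : dot (- x) z = - dot x z.
Proof. by rewrite /dot linearN mulNmx mxE. Qed.

Lemma dotZl (a : R) x z : dot (a *: x) z = a * dot x z.
Proof. by rewrite /dot linearZ /= -scalemxAl mxE. Qed.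

Lemma dot_suml I (r : seq I) (P : pred I) (F : I -> 'cV[R]_n) z :
  dot (\sum_(i <- r | P i) F i) z = \sum_(i <- r | P i) dot (F i) z.
Proof.
apply: (big_morph (fun x => dot x z)) => [x y|]; first exact: dotDl.
by rewrite dotE big1// => i _; rewrite mxE mul0r.
Qed.

Lemma dotZr (a : R) x z : dot z (a *: x) = a * dot z x.
Proof. by rewrite dotC dotZl dotC. Qed.

Lemma dot_sumr I (r : seq I) (P : pred I) (F : I -> 'cV[R]_n) z :
  dot z (\sum_(i <- r | P i) F i) = \sum_(i <- r | P i) dot z (F i).
Proof. by rewrite dotC dot_suml; apply: eq_bigr => i _; rewrite dotC. Qed.

Lemma dot_ge0 x : 0 <= dot x x.
Proof. by rewrite dotE; apply: sumr_ge0 => i _; rewrite -expr2 sqr_ge0. Qed.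

Lemma dot_eq0 x : (dot x x == 0) = (x == 0).
Proof.
apply/idP/eqP => [|->]; last by rewrite dotE big1// => i _; rewrite mxE mul0r.
rewrite dotE psumr_eq0 => [|i _]; last by rewrite -expr2 sqr_ge0.
move=> /allP h; apply/matrixP => i j; rewrite ord1 mxE.
by have := h i (mem_index_enum _); rewrite /= -expr2 sqrf_eq0 => /eqP.
Qed.

Lemma qformE A x : qform A x = \sum_i \sum_j A i j * (x i 0 * x j 0).
Proof.
rewrite /qform mxE; under eq_bigr => j _ do rewrite mxE mulr_suml.
rewrite exchange_big; apply: eq_bigr => i _; apply: eq_bigr => j _.
by rewrite mxE; ring.
Qed.

Lemma qformD A B x : qform (A + B) x = qform A x + qform B x.
Proof. by rewrite /qform mulmxDr mulmxDl mxE. Qed.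

Lemma qformZ (a : R) A x : qform (a *: A) x = a * qform A x.
Proof. by rewrite /qform -scalemxAr -scalemxAl mxE. Qed.

Lemma qformB A B x : qform (A - B) x = qform A x - qform B x.
Proof. by rewrite -scaleN1r qformD qformZ mulN1r. Qed.

Lemma qform1 x : qform 1%:M x = dot x x.
Proof. by rewrite /qform mulmx1. Qed.

Lemma qform0 A : qform A 0 = 0.
Proof. by rewrite /qform mulmx0 mxE. Qed.

Lemma qform_le A x : `|qform A x| <= (\sum_i \sum_j `|A i j|) * dot x x.
Proof.
have le_dot i : `|x i 0| ^+ 2 <= dot x x.
  rewrite real_normK ?num_real// dotE (bigD1 i) //= -expr2 lerDl.
  by apply: sumr_ge0 => j _; rewrite -expr2 sqr_ge0.
rewrite qformE mulr_suml; apply: le_trans (ler_norm_sum _ _ _) _.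
apply: ler_sum => i _; rewrite mulr_suml; apply: le_trans (ler_norm_sum _ _ _) _.
apply: ler_sum => j _; rewrite normrM ler_wpM2l// normrM.
have := le_dot i; have := le_dot j; have := sqr_ge0 (`|x i 0| - `|x j 0|).
by move: (dot x x) => q; nra.
Qed.

End DotProduct.

(** * Orthogonal frames by Gram-Schmidt inside the lattice *)

Section Frame.
Variables (R : realType) (n : nat) (L : set 'cV[R]_n).
Hypotheses (L0 : L 0) (LB : forall x y, L x -> L y -> L (x - y))
  (Lint : forall x y, L x -> L y -> dot x y \is a Num.int).

Lemma lattice_closedN x : L x -> L (- x).
Proof. by move=> Lx; rewrite -sub0r; apply: LB. Qed.

Lemma lattice_closedD x y : L x -> L y -> L (x + y).
Proof. by move=> Lx Ly; rewrite -(opprK y); apply: LB => //; exact: lattice_closedN. Qed.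

Lemma lattice_closed_sum I (r : seq I) (F : I -> 'cV[R]_n) :
  (forall i, L (F i)) -> L (\sum_(i <- r) F i).
Proof. by move=> h; elim/big_ind: _ => // x y; exact: lattice_closedD. Qed.

Lemma lattice_closedZ (a : R) x : a \is a Num.int -> L x -> L (a *: x).
Proof.
move=> /intrP[z ->] Lx; rewrite scaler_int.
have Ln k : L (x *+ k).
  by elim: k => [|k ih]; rewrite ?mulr0n// mulrS; apply: lattice_closedD.
by case: z => k; [exact: Ln|rewrite NegzE mulrNz; apply: lattice_closedN; exact: Ln].
Qed.

(** Gram-Schmidt without leaving L: the new vector b is scaled by the product D of the squared
    norms, which makes the coefficients D (b . v_i) / (v_i . v_i) integers. *)
Lemma orthogonal_rows (B : 'M[R]_n) k : B \in unitmx -> (forall j, L (col j B)) ->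
  (k <= n)%N -> exists V : 'M[R]_(k, n), [/\ forall i, L (row i V)^T,
    forall i j, i != j -> dot (row i V)^T (row j V)^T = 0 &
    forall i, (row i V)^T != 0].
Proof.
move=> uB LcB; elim: k => [_|k ih kn].
  by exists 0; split => -[].
have [V [LV oV nV]] := ih (ltnW kn).
have [j jV] : exists j, ~~ (row j B^T <= V)%MS.
  apply/existsP; rewrite -negb_forall; apply/negP => /forallP h.
  have : (B^T <= V)%MS by apply/row_subP.
  move=> /mxrankS; rewrite mxrank_tr (mxrank_unit uB) => nk.
  by have := leq_trans nk (rank_leq_row V); rewrite leqNgt kn.
pose b := (row j B^T)^T; pose v i := (row i V)^T.
have Lb : L b by rewrite /b tr_row trmxK.
pose d i := dot (v i) (v i).
have d0 i : d i != 0 by rewrite /d dot_eq0 nV.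
pose D := \prod_i d i.
pose c i := D * dot b (v i) / d i.
have dint i : d i \is a Num.int by apply: Lint; exact: LV.
have cint i : c i \is a Num.int.
  rewrite /c /D (bigD1 i) //= (mulrC (d i)) mulrAC mulfK//.
  apply: rpredM; last by apply: Lint => //; exact: LV.
  by apply: rpred_prod => l _; exact: dint.
pose w := D *: b - \sum_i c i *: v i.
have Lw : L w.
  apply: LB; first by apply: lattice_closedZ => //; apply: rpred_prod => l _; exact: dint.
  by apply: lattice_closed_sum => i; apply: lattice_closedZ => //; exact: LV.
have ow i : dot w (v i) = 0.
  rewrite /w dotDl dotNl dotZl dot_suml (bigD1 i) //= big1 => [|l li].
    by rewrite dotZl addr0 -/(d i) /c divfK// subrr.
  by rewrite dotZl oV// mulr0.
have w0 : w != 0.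
  apply: contra jV => /eqP w0.
  have D0 : D != 0 by apply/prodf_neq0.
  have : D *: b = \sum_i c i *: v i by apply/eqP; rewrite -subr_eq0 -/w w0.
  move=> /(congr1 (fun x => D^-1 *: x^T)); rewrite linearZ /= scalerA mulVf// scale1r.
  rewrite /b trmxK => ->; apply: scalemx_sub; rewrite linear_sum /=.
  apply: summx_sub => i _; rewrite linearZ /= trmxK; apply: scalemx_sub.
  exact: row_sub.
have rowu (l : 'I_1) : (row (lshift k l) (col_mx w^T V))^T = w.
  by rewrite rowKu; apply/matrixP => p q; rewrite !mxE !ord1.
have rowd l : (row (rshift 1 l) (col_mx w^T V))^T = v l by rewrite rowKd.
exists (col_mx w^T V : 'M[R]_(1 + k, n)); split => [i|i l|i].
- by case: (@split_ordP 1 k i) => l ->; rewrite ?rowu ?rowd//; exact: LV.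
- case: (@split_ordP 1 k i) => i' ->; case: (@split_ordP 1 k l) => l' ->; rewrite ?rowu ?rowd.
  + by rewrite !ord1 eqxx.
  + by move=> _; exact: ow.
  + by move=> _; rewrite dotC; exact: ow.
  + by move=> h; apply: oV; apply: contra h => /eqP ->.
- by case: (@split_ordP 1 k i) => l ->; rewrite ?rowu ?rowd//; exact: nV.
Qed.

Record frame (d : 'I_n -> nat) (v : 'I_n -> 'cV[R]_n) : Prop := Frame {
  frame_gt0 : forall i, (0 < d i)%N;
  frame_dot : forall i j, dot (v i) (v j) = (d i)%:R *+ (i == j);
  frame_in : forall i, L (v i);
  frame_expand : forall x, x = \sum_i (dot x (v i) / (d i)%:R) *: v i }.

Lemma frame_exists (B : 'M[R]_n) : B \in unitmx -> (forall j, L (col j B)) ->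
  exists d v, frame d v.
Proof.
move=> uB LcB; have [V [LV oV nV]] := orthogonal_rows uB LcB (leqnn n).
pose v i := (row i V)^T.
have dn i : exists d : nat, (0 < d)%N && (dot (v i) (v i) == d%:R).
  have := Lint (LV i) (LV i); have := dot_ge0 (v i).
  move=> h /intrP[z zE]; move: h; rewrite zE ler0z => z0.
  exists `|z|%N; rewrite natr_absz ger0_norm// eqxx andbT absz_gt0.
  by rewrite -(intr_eq0 R) -zE dot_eq0 nV.
pose d i := xchoose (dn i).
have dP i : (0 < d i)%N /\ dot (v i) (v i) = (d i)%:R.
  by have /andP[? /eqP] := xchooseP (dn i).
have dot_v i j : dot (v i) (v j) = (d i)%:R *+ (i == j).
  have [<-|ij] := eqVneq i j; first by rewrite mulr1n; case: (dP i).
  by rewrite mulr0n; exact: oV.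
exists d, v; split => // [i|x]; first by case: (dP i).
pose W : 'M[R]_n := \matrix_(i, j) (V i j / (d i)%:R).
have WV : V *m W^T = 1%:M.
  apply/matrixP => i j; rewrite !mxE.
  have := dot_v i j; rewrite dotE => h.
  transitivity ((d i)%:R *+ (i == j) / (d j)%:R : R).
    rewrite -h mulr_suml; apply: eq_bigr => l _; rewrite !mxE; ring.
  have [<-|ij] := eqVneq i j; last by rewrite mulr0n mul0r.
  by rewrite divff// pnatr_eq0 -lt0n; case: (dP i).
(* A one-sided inverse of a square matrix is two-sided; in this order the identity is the expansion
   in the frame. *)
have {}WV : W^T *m V = 1%:M by exact: mulmx1C.
rewrite -{1}[x]mul1mx -WV -mulmxA; apply/matrixP => i j; rewrite ord1 mxE summxE.
apply: eq_bigr => l _; rewrite !mxE dotE mulrC.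
rewrite [in RHS]mulrAC -[RHS]mulrA; congr (_ * _).
by apply: eq_bigr => p _; rewrite !mxE mulrC.
Qed.

End Frame.

(** * Coordinates with respect to a frame *)

Section Coordinates.
Variables (R : realType) (n : nat) (L : set 'cV[R]_n).
Hypotheses (L0 : L 0) (LB : forall x y, L x -> L y -> L (x - y))
  (Lint : forall x y, L x -> L y -> dot x y \is a Num.int)
  (Ldual : forall x, (forall y, L y -> dot x y \is a Num.int) -> L x).
Variables (d : 'I_n -> nat) (v : 'I_n -> 'cV[R]_n).
Hypothesis fv : frame L d v.

Let d0 i : (d i)%:R != 0 :> R.
Proof. by rewrite pnatr_eq0 -lt0n (frame_gt0 fv). Qed.

(** The coordinates are inner products with the v_i, so the integral m parametrize the dual of the
    rectangular lattice spanned by the frame; L lies between the two. *)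
Definition frame_vec (m : 'I_n -> int) : 'cV[R]_n :=
  \sum_i ((m i)%:~R / (d i)%:R) *: v i.

Lemma dot_frame_vec m i : dot (frame_vec m) (v i) = (m i)%:~R.
Proof.
rewrite dot_suml (bigD1 i) //= big1 => [|l li].
  by rewrite addr0 dotZl (frame_dot fv) eqxx mulr1n divfK.
by rewrite dotZl (frame_dot fv) (negbTE li) mulr0.
Qed.

Lemma frame_vec_inj m m' : frame_vec m = frame_vec m' -> m =1 m'.
Proof.
move=> h i; apply/eqP; rewrite -(eqr_int R) -!dot_frame_vec h eqxx//.
Qed.

(** The floor is exact on L, where these inner products are integers. *)
Definition frame_coord (x : 'cV[R]_n) : {ffun 'I_n -> int} :=
  [ffun i => Num.floor (dot x (v i))].

Lemma frame_coordK x : L x -> frame_vec (frame_coord x) = x.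
Proof.
move=> Lx; rewrite [RHS](frame_expand fv); apply: eq_bigr => i _.
by rewrite ffunE; congr (_ / _ *: _); apply/eqP; rewrite -intrEfloor; apply: Lint => //; exact: (frame_in fv).
Qed.

Lemma dot_frame_vec2 m m' :
  dot (frame_vec m) (frame_vec m') = \sum_i (m i)%:~R * (m' i)%:~R / (d i)%:R.
Proof.
rewrite [X in dot _ X]/frame_vec dot_sumr; apply: eq_bigr => i _.
by rewrite dotZr dot_frame_vec; ring.
Qed.

Lemma frame_vecP m : L (frame_vec m) <->
  (forall m', L (frame_vec m') ->
     (\sum_i (m i)%:~R * (m' i)%:~R / (d i)%:R : R) \is a Num.int).
Proof.
split=> [Lm m' Lm'|h]; first by rewrite -dot_frame_vec2; exact: Lint.
apply: Ldual => y Ly; rewrite -(frame_coordK Ly) dot_frame_vec2; apply: h.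
by rewrite frame_coordK.
Qed.

Lemma frame_vec_periodic m (q : 'I_n -> int) :
  L (frame_vec m) -> L (frame_vec (fun i => m i + q i * (d i)%:Z)).
Proof.
move=> Lm; have -> : frame_vec (fun i => m i + q i * (d i)%:Z) =
    frame_vec m + \sum_i (q i)%:~R *: v i.
  rewrite -big_split; apply: eq_bigr => i _ /=; rewrite -scalerDl; congr (_ *: _).
  by rewrite intrD intrM mulrDl (mulfK (d0 i)).
apply: lattice_closedD => //; apply: (lattice_closed_sum L0 LB) => i.
by apply: lattice_closedZ; rewrite ?intr_int//; exact: (frame_in fv).
Qed.

Definition frame_form (H : 'M[R]_n) (i j : 'I_n) : R :=
  ((v i)^T *m H *m v j) 0 0 / ((d i)%:R * (d j)%:R).

Lemma qform_frame_vec H m : qform H (frame_vec m) =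
  \sum_i \sum_j frame_form H i j * ((m i)%:~R * (m j)%:~R).
Proof.
have fE i j : ((v i)^T *m H *m v j) 0 0 = dot (v i) (H *m v j).
  by rewrite /dot mulmxA.
rewrite /qform -mulmxA -/(dot _ _) [X in dot X _]/frame_vec dot_suml.
apply: eq_bigr => i _; rewrite dotZl /frame_vec mulmx_sumr dot_sumr mulr_sumr.
apply: eq_bigr => j _; rewrite -scalemxAr dotZr /frame_form fE invfM; ring.
Qed.

(** The projections v_i v_i^T / d_i onto the axes of the frame add up to the identity. *)
Lemma frame_form_trace H : \sum_i (d i)%:R * frame_form H i i = \tr H.
Proof.
have E i : (d i)%:R * frame_form H i i = (d i)%:R^-1 * \tr (H *m (v i *m (v i)^T)).
  rewrite mulmxA mxtrace_mulC mulmxA /mxtrace big_ord1 /frame_form.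
  by move: (_ 0 0) (d0 i) => X di0; field.
rewrite (eq_bigr _ (fun i _ => E i)).
have -> : \sum_i (d i)%:R^-1 * \tr (H *m (v i *m (v i)^T)) =
    \tr (H *m \sum_i (d i)%:R^-1 *: (v i *m (v i)^T)).
  rewrite mulmx_sumr linear_sum /=; apply: eq_bigr => i _.
  by rewrite -scalemxAr linearZ.
suff -> : \sum_i (d i)%:R^-1 *: (v i *m (v i)^T) = 1%:M by rewrite mulmx1.
apply/matrixP => p q.
have := frame_expand fv (delta_mx q 0) => /matrixP/(_ p 0).
rewrite !mxE eqxx andbT => ->; rewrite !summxE; apply: eq_bigr => i _.
rewrite !mxE big_ord1 !mxE dotE (bigD1 q) //= big1 => [|l lq].
  by rewrite mxE !eqxx mul1r addr0; ring.
by rewrite mxE (negbTE lq) mul0r.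
Qed.

End Coordinates.

(** * Theta series of an integral self-dual lattice *)

Section Theta.
Variables (R : realType) (n : nat) (L : set 'cV[R]_n).
Local Notation C := R[i].
Local Notation iota := (Complex 0 1 : C).
Hypotheses (L0 : L 0) (LB : forall x y, L x -> L y -> L (x - y))
  (Lint : forall x y, L x -> L y -> dot x y \is a Num.int)
  (Ldual : forall x, (forall y, L y -> dot x y \is a Num.int) -> L x).
Variables (d : 'I_n -> nat) (v : 'I_n -> 'cV[R]_n).
Hypothesis fv : frame L d v.

Let d0 i : (d i)%:R != 0 :> R.
Proof. by rewrite pnatr_eq0 -lt0n (frame_gt0 fv). Qed.

Let dz0 i : (d i)%:Z != 0.
Proof. by have := frame_gt0 fv i; lia. Qed.

Local Notation vec := (frame_vec d v).
Let Lam (m : 'I_n -> int) : bool := `[< L (vec m) >].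
Let dmax := \max_i d i.

(** One ordinal type serves all coordinates, whatever the d_i; [inord] loses nothing because a
    residue is below d_i <= [dmax]. *)
Definition residue (m : 'I_n -> int) : {ffun 'I_n -> 'I_dmax.+1} :=
  [ffun i => inord (absz (m i %% d i)%Z)].

Lemma residueE m i : (residue m i)%:Z = (m i %% (d i)%:Z)%Z.
Proof.
have h1 := modz_ge0 (m i) (dz0 i).
have h2 := ltz_pmod (m i) (d := (d i)%:Z) (frame_gt0 fv i).
have h3 : (d i <= dmax)%N by exact: leq_bigmax.
rewrite ffunE inordK; first by rewrite gez0_abs.
by move: h1 h2; move: (m i %% d i)%Z => -[] k //=; lia.
Qed.

(** Representatives of L modulo the rectangular lattice spanned by the frame. *)
Definition glue : {set {ffun 'I_n -> 'I_dmax.+1}} :=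
  [set c : {ffun 'I_n -> 'I_dmax.+1} | [forall i, (c i < d i)%N] && Lam (fun i => (c i)%:Z)].

Lemma residue_glue m : L (vec m) -> residue m \in glue.
Proof.
move=> Lm; rewrite inE; apply/andP; split.
  apply/forallP => i; rewrite -ltz_nat residueE.
  by rewrite ltz_pmod// ltz_nat; exact: frame_gt0 fv i.
apply/asboolP.
have -> : (fun i => (residue m i)%:Z) =
    (fun i => m i + - (m i %/ (d i)%:Z)%Z * (d i)%:Z).
  by apply/funext => i; rewrite residueE /modz mulNr.
exact: frame_vec_periodic.
Qed.

Definition chi (m c : 'I_n -> int) : C :=
  cexp2pi (\sum_i (m i)%:~R * (c i)%:~R / (d i)%:R).

Lemma chiD m c c' : chi m (fun i => c i + c' i) = chi m c * chi m c'.
Proof.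
rewrite /chi -cexp2piD -big_split; congr cexp2pi; apply: eq_bigr => i _ /=.
by rewrite intrD; ring.
Qed.

Lemma chi_residue m c : chi m (fun i => (residue c i)%:Z) = chi m c.
Proof.
have q1 q : chi m (fun i => q i * (d i)%:Z) = 1.
  rewrite /chi -[RHS](cexp2pi_int R (\sum_i m i * q i)); congr cexp2pi.
  rewrite rmorph_sum; apply: eq_bigr => i _ /=.
  by rewrite !intrM mulrA mulfK//; exact: d0.
transitivity (chi m (fun i => (residue c i)%:Z + (c i %/ (d i)%:Z)%Z * (d i)%:Z)).
  by rewrite chiD q1 mulr1.
by congr chi; apply/funext => i; rewrite residueE addrC -divz_eq.
Qed.

(** If m lies outside L, self-duality gives y in L with [chi m y != 1], and translation by y
    permutes the representatives. The average of the characters thus replaces the condition m in L,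
    which leaves sums over full boxes that factor. *)
Lemma sum_chi m : \sum_(c in glue) chi m (fun i => (c i)%:Z) =
  (if Lam m then #|glue|%:R else 0).
Proof.
case: ifPn => [/asboolP Lm|/asboolP nLm].
  rewrite (eq_bigr (fun=> 1)) ?sumr_const// => c; rewrite inE => /andP[_ /asboolP Lc].
  have /intrP[k kE] := (frame_vecP Lint Ldual fv m).1 Lm _ Lc.
  by rewrite /chi kE cexp2pi_int.
have [y Ly ny] : exists2 y, L (vec y) & chi m y != 1.
  apply: contrapT => h; apply: nLm; apply/(frame_vecP Lint Ldual fv) => y Ly.
  apply: cexp2pi_eq1; apply/eqP/negPn/negP => ny; apply: h.
  by exists y.
pose h (c : {ffun 'I_n -> 'I_dmax.+1}) := residue (fun i => (c i)%:Z + y i).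
have hC c : c \in glue -> h c \in glue.
  rewrite inE => /andP[_ /asboolP Lc]; apply: residue_glue.
  suff -> : vec (fun i => (c i)%:Z + y i) = vec (fun i => (c i)%:Z) + vec y.
    exact: lattice_closedD.
  rewrite /frame_vec -big_split; apply: eq_bigr => i _ /=.
  by rewrite intrD mulrDl scalerDl.
have hinj : {in glue &, injective h}.
  move=> c c'; rewrite !inE => /andP[/forallP cd _] /andP[/forallP cd' _].
  move=> /ffunP hh; apply/ffunP => i; apply/val_inj => /=.
  have := congr1 (fun k : 'I__ => (k : nat)%:Z) (hh i); rewrite !residueE.
  move=> /eqP; rewrite eqz_modDr => /eqP; rewrite !modz_small.
  - by move=> [].
  - by rewrite ltz_nat cd'.
  - by rewrite ltz_nat cd.
have imh : h @: glue = glue.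
  apply/eqP; rewrite eqEcard card_in_imset// leqnn andbT.
  by apply/fintype.subsetP => _ /imsetP[c cC ->]; exact: hC.
set S := \sum_(c in glue) _.
have SE : S = S * chi m y.
  rewrite {1}/S -{1}imh big_imset//= mulr_suml; apply: eq_bigr => c _.
  by rewrite chi_residue chiD.
apply/eqP; have : S * (chi m y - 1) == 0 by rewrite mulrBr -SE mulr1 subrr.
by rewrite mulf_eq0 subr_eq0 (negbTE ny) orbF.
Qed.

Lemma glue_gt0 : (0 < #|glue|)%N.
Proof.
apply/card_gt0P; exists (residue (fun=> 0)); apply: residue_glue.
suff -> : vec (fun=> 0) = 0 by [].
by rewrite /frame_vec big1// => i _; rewrite mul0r scale0r.
Qed.

Definition box B (b : {ffun 'I_n -> 'I_B.*2.+1}) (i : 'I_n) : int := (b i)%:Z - B%:Z.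

Lemma prod_zsum (A : comPzRingType) B (F : 'I_n -> int -> A) :
  \prod_i zsum B (F i) = \sum_(b : {ffun 'I_n -> 'I_B.*2.+1}) \prod_i F i (box b i).
Proof. by rewrite /zsum bigA_distr_bigA. Qed.

Lemma box_inj B (b b' : {ffun 'I_n -> 'I_B.*2.+1}) : box b =1 box b' -> b = b'.
Proof.
move=> h; apply/ffunP => i; apply/val_inj => /=; have := h i; rewrite /box; lia.
Qed.

Lemma box_cover B (m : 'I_n -> int) : (forall i, `|m i| <= B%:Z) ->
  exists b : {ffun 'I_n -> 'I_B.*2.+1}, box b =1 m.
Proof.
move=> mB; exists [ffun i => inord (absz (m i + B%:Z))] => i.
rewrite /box ffunE inordK; have := mB i; lia.
Qed.

Definition box_points B : seq 'cV[R]_n :=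
  [seq vec (box b) | b <- enum [pred b : {ffun 'I_n -> 'I_B.*2.+1} | Lam (box b)]].

Lemma box_points_uniq B : uniq (box_points B).
Proof.
rewrite map_inj_uniq ?enum_uniq// => b b' /(frame_vec_inj fv); exact: box_inj.
Qed.

Lemma box_points_in B x : x \in box_points B -> L x.
Proof. by move=> /mapP[b]; rewrite mem_enum inE => /asboolP Lb ->. Qed.

Lemma box_points_cover x : L x ->
  exists B0, forall B, (B0 <= B)%N -> x \in box_points B.
Proof.
move=> Lx; set m := frame_coord v x.
exists (\max_i absz (m i)) => B hB.
have [|b bm] := @box_cover B m.
  by move=> i; have := leq_trans (leq_bigmax i) hB; lia.
have xE : x = vec (box b).
  by rewrite -(frame_coordK Lint fv Lx) -/m; congr vec; apply/funext => i; rewrite bm.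
apply/mapP; exists b => //; rewrite mem_enum inE; apply/asboolP; by rewrite -xE.
Qed.

Lemma sum_box_points (V : nmodType) B (f : 'cV[R]_n -> V) :
  \sum_(x <- box_points B) f x =
  \sum_(b : {ffun 'I_n -> 'I_B.*2.+1} | Lam (box b)) f (vec (box b)).
Proof. by rewrite big_map big_enum. Qed.

Lemma expR_sum I (r : seq I) (F : I -> R) :
  expR (\sum_(i <- r) F i) = \prod_(i <- r) expR (F i).
Proof. by apply: (big_morph expR) => [x y|]; [exact: expRD|exact: expR0]. Qed.

(** A finite part of L lies in a box; summing over the whole box instead gives a product of bounded
    one-variable sums. *)
Lemma sbound_gauss (b : R) : 0 < b ->
  exists K, sbound L (fun x => expR (- (b * dot x x))) K.
Proof.
move=> b0.
have h l : exists K, forall B, zsum B (fun j : int =>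
    expR (- (b * (j%:~R * j%:~R / (d l)%:R))) : R) <= K.
  pose c := b / (d l)%:R.
  have c0 : 0 < c by rewrite divr_gt0// ltr0n (frame_gt0 fv).
  have rE : rapid [set: unit] (fun _ (x : R) => cexp (- (c * x ^+ 2))%:C).
    by apply: (rapid_cexp (K := 0) c0) => t x _; rewrite /= sub0r.
  have [K K0 EK] := rapid_bound rE.
  exists (3 * K) => B; apply: zsum_le => // j.
  have := EK tt j%:~R I; rewrite cabs_cexp /= => h; apply: le_trans h.
  rewrite ler_expR le_eqVlt; apply/orP; left; apply/eqP; rewrite /c; ring.
have [K KP] := choice h.
exists (\prod_l K l) => F FL.
have [B0 hB] := eventually_cover box_points_cover FL.
have := ler_sum_subset (fset_uniq F) (box_points_uniq B0) (hB _ (leqnn _))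
  (fun x => expR_ge0 (- (b * dot x x))).
move=> h1; apply: le_trans h1 _; rewrite sum_box_points.
apply: le_trans (_ : \sum_(c : {ffun 'I_n -> 'I_B0.*2.+1}) \prod_l
   expR (- (b * ((box c l)%:~R * (box c l)%:~R / (d l)%:R))) <= _).
  rewrite [leRHS](bigID (fun c => Lam (box c))) /= -[leLHS]addr0; apply: lerD.
    apply: ler_sum => c _; rewrite -expR_sum (dot_frame_vec2 fv) mulr_sumr -sumrN//.
  by apply: sumr_ge0 => c _; apply: prodr_ge0 => l _; exact: expR_ge0.
rewrite -(prod_zsum B0 (fun l (j : int) => expR (- (b * (j%:~R * j%:~R / (d l)%:R))) : R)).
apply: ler_prod => l _; rewrite KP andbT.
by apply: sumr_ge0 => i _; exact: expR_ge0.
Qed.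

(** Half of the exponent pays for the polynomial: y^m <= m! (2 / b)^m exp (b y / 2). *)
Lemma sbound_monomial_gauss m (b : R) : 0 < b ->
  exists K, sbound L (fun x => dot x x ^+ m * expR (- (b * dot x x))) K.
Proof.
move=> b0; have b2 : 0 < b / 2 by rewrite divr_gt0.
have [K hK] := sbound_gauss b2.
pose c := m`!%:R * (b / 2) ^- m.
have c0 : 0 <= c by rewrite mulr_ge0// invr_ge0 exprn_ge0// ltW.
exists (c * K); apply: sbound_le (sboundZ c0 hK) => x _.
have y0 := dot_ge0 x; set y := dot x x in y0 *.
have -> : - (b * y) = - (b / 2 * y) - (b / 2 * y) by field.
rewrite expRD mulrA ler_wpM2r ?expR_ge0// expRN ler_pdivrMr ?expR_gt0//.
rewrite /c mulrAC ler_pdivlMr ?exprn_gt0// -exprMn [y * _]mulrC.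
have by0 : 0 <= b / 2 * y by rewrite mulr_ge0// ltW.
case: m {c c0} => [|m].
  by rewrite expr0 fact0 mul1r -[leLHS]expR0 ler_expR.
rewrite -ler_pdivrMl ?ltr0n ?fact_gt0// [leLHS]mulrC.
by apply: le_trans (expR_ge1Dxn m by0); rewrite lerDr.
Qed.

Variable H : 'M[R]_n.
Hypothesis trH : \tr H = 0.

Definition theta_term (w : C) (x : 'cV[R]_n) : C :=
  (qform H x)%:C * cexp (- (pi%:C * w * (dot x x)%:C)).

Definition theta (w : C) : C := csum L (theta_term w).

Lemma cabs_theta_term w x :
  cabs (theta_term w x) = `|qform H x| * expR (- (pi * complex.Re w * dot x x)).
Proof.
rewrite cabsM cabs_real cabs_cexp; congr (_ * expR _).
by case: w => a b /=; ring.
Qed.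

Lemma sbound_theta y : 0 < y -> exists K, forall w, y <= complex.Re w ->
  sbound L (fun x => cabs (theta_term w x)) K.
Proof.
move=> y0; have py : 0 < pi * y by rewrite mulr_gt0// pi_gt0.
have [K hK] := sbound_monomial_gauss 1 py.
pose M := \sum_i \sum_j `|H i j|.
have M0 : 0 <= M by do 2![apply: sumr_ge0 => ? _].
exists (M * K) => w yw; apply: sbound_le (sboundZ M0 hK) => x _.
rewrite cabs_theta_term expr1 mulrA; apply: ler_pM; rewrite ?normr_ge0 ?expR_ge0//.
- exact: qform_le.
- by rewrite ler_expR lerN2 ler_wpM2r ?dot_ge0// ler_pM2l ?pi_gt0.
Qed.

(** The exponent of the l-th coordinate in the monomial x_i x_j. *)
Let kk (i j l : 'I_n) : nat := (l == i) + (l == j).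

Let prod_kk (F : 'I_n -> C) i j : \prod_l F l ^+ kk i j l = F i * F j.
Proof.
have E k : \prod_l F l ^+ (l == k) = F k.
  rewrite (bigD1 k) //= eqxx expr1 big1 ?mulr1// => l /negbTE ->.
  by rewrite expr0.
rewrite -[in RHS](E i) -[in RHS](E j) -big_split; apply: eq_bigr => l _.
by rewrite exprD.
Qed.

Let kk_le2 i j l : (kk i j l <= 2)%N.
Proof. by rewrite /kk; case: (l == i); case: (l == j). Qed.

(** Its square is the coefficient of m_l^2 in lam^2 |x|^2 for x = [frame_vec d v m]. *)
Definition axis_root (lam : C) (l : 'I_n) : C := ((Num.sqrt (d l)%:R)^-1)%:C * lam.

Lemma axis_root_acute lam l : acute lam -> acute (axis_root lam l).
Proof.
by apply: acute_scale; rewrite invr_gt0 sqrtr_gt0 ltr0n (frame_gt0 fv).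
Qed.

Lemma axis_root2 lam l : axis_root lam l ^+ 2 = ((d l)%:R^-1)%:C * lam ^+ 2.
Proof. by rewrite exprMn -rmorphXn exprVn sqr_sqrtr. Qed.

Let Hf i j : C := (frame_form d v H i j)%:C.

Let prod_gaussx (k : 'I_n -> nat) (w : 'I_n -> C) (b x : 'I_n -> R) :
  \prod_l gaussx (k l) (w l) (b l) (x l) = \prod_l (x l)%:C ^+ k l *
    cexp (\sum_l - (pi%:C * w l * (x l)%:C ^+ 2)) * cexp2pi (\sum_l b l * x l).
Proof. by rewrite cexp_sum cexp2pi_sum -!big_split. Qed.

Let sum_box_theta B lam :
  \sum_(x <- box_points B) theta_term (lam ^+ 2) x =
  #|glue|%:R^-1 * \sum_(c in glue) \sum_i \sum_j Hf i j *
    \prod_l zsum B (fun m => gaussx (kk i j l) (axis_root lam l ^+ 2)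
        ((c l)%:R / (d l)%:R) m%:~R).
Proof.
have G0 : #|glue|%:R != 0 :> C by rewrite pnatr_eq0 -lt0n glue_gt0.
apply: (mulfI G0); rewrite mulrA divff// mul1r sum_box_points.
rewrite big_mkcond mulr_sumr /=.
transitivity (\sum_(b : {ffun 'I_n -> 'I_B.*2.+1}) \sum_(c in glue)
    chi (box b) (fun i => (c i)%:Z) * theta_term (lam ^+ 2) (vec (box b))).
  apply: eq_bigr => b _; rewrite -mulr_suml sum_chi.
  by case: ifP; rewrite ?mulr0 ?mul0r.
rewrite exchange_big; apply: eq_bigr => c _ /=.
under eq_bigr => b _.
  rewrite /theta_term (qform_frame_vec _ _ H) rmorph_sum mulr_suml mulr_sumr.
  under eq_bigr => i _ do rewrite rmorph_sum mulr_suml mulr_sumr.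
  over.
rewrite exchange_big; apply: eq_bigr => i _ /=.
rewrite exchange_big; apply: eq_bigr => j _ /=.
rewrite prod_zsum mulr_sumr; apply: eq_bigr => b _.
rewrite (prod_gaussx (kk i j) (fun l => axis_root lam l ^+ 2)
  (fun l => (c l)%:R / (d l)%:R) (fun l => (box b l)%:~R)) prod_kk.
have -> : \sum_l (c l)%:R / (d l)%:R * (box b l)%:~R =
    \sum_l (box b l)%:~R * ((c l)%:Z)%:~R / (d l)%:R :> R.
  by apply: eq_bigr => l _; rewrite mulrC mulrA.
rewrite -/(chi (box b) (fun l => (c l)%:Z)).
have -> : \sum_l - (pi%:C * axis_root lam l ^+ 2 * (box b l)%:~R%:C ^+ 2) =
    - (pi%:C * lam ^+ 2 * (dot (vec (box b)) (vec (box b)))%:C).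
  rewrite (dot_frame_vec2 fv) rmorph_sum mulr_sumr -sumrN; apply: eq_bigr => l _.
  by rewrite axis_root2 !rmorphM expr2 /=; ring.
by rewrite /Hf; move: (frame_form d v H i j) => h; rewrite !rmorphM /=; ring.
Qed.

Let dual_sum B lam : C :=
  #|glue|%:R^-1 * \sum_(c in glue) \sum_i \sum_j Hf i j *
    \prod_l zsum B (fun m => ghat (axis_root lam l) (kk i j l) (@gauss_moment R)
        ((c l)%:R / (d l)%:R - m%:~R)).

Let dual_sum_diff lam : acute lam -> tends0 (fun B =>
  cabs (\sum_(x <- box_points B) theta_term (lam ^+ 2) x - dual_sum B lam)).
Proof.
move=> al.
pose X (c : {ffun 'I_n -> 'I_dmax.+1}) i j l B :=
  zsum B (fun m => gaussx (kk i j l) (axis_root lam l ^+ 2)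
        ((c l)%:R / (d l)%:R) m%:~R).
pose Y (c : {ffun 'I_n -> 'I_dmax.+1}) i j l B :=
  zsum B (fun m => ghat (axis_root lam l) (kk i j l) (@gauss_moment R)
        ((c l)%:R / (d l)%:R - m%:~R)).
have bX c i j l : exists K, forall B, cabs (X c i j l B) <= K.
  have [g1 [g2 [K [_ _ h _]]]] :=
    gaussx_bounds (kk i j l) ((c l)%:R / (d l)%:R) (axis_root_acute l al).
  by exists (3 * K) => B; apply: cabs_zsum_le => m; exact: h.
have bY c i j l : exists K, forall B, cabs (Y c i j l B) <= K.
  have [M mM] : exists M, forall i, cabs (@gauss_moment R i) <= M.
    exists (1 + cabs (2 * pi%:C : C)^-1) => -[|[|[|k]]].
    - by rewrite (_ : gauss_moment R 0 = 1)// cabs1 lerDl cabs_ge0.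
    - by rewrite (_ : gauss_moment R 1 = 0)// cabs0 addr_ge0 ?cabs_ge0.
    - by rewrite (_ : gauss_moment R 2 = (2 * pi%:C)^-1)// lerDr.
    - rewrite (_ : gauss_moment R k.+3 = 0) ?cabs0 ?addr_ge0 ?cabs_ge0//.
      by rewrite /gauss_moment nth_default.
  have h := @rapid_ghat R unit (fun=> @gauss_moment R) (kk i j l) _ M
    (axis_root_acute l al) (fun _ i _ => mM i).
  have [K hK] := rapid_shift_bound ((c l)%:R / (d l)%:R) h.
  by exists (3 * K) => B; apply: cabs_zsum_le => m; exact: (hK tt).
have P c i j : tends0 (fun B => cabs (\prod_l X c i j l B - \prod_l Y c i j l B)).
  have [KX hX] := choice (bX c i j); have [KY hY] := choice (bY c i j).
  apply: (@tends0_prodB _ _ _ _ _ (fun l => Num.max (KX l) (KY l))) => [l B|l B|l].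
  - by rewrite le_max hX.
  - by rewrite le_max hY orbT.
  - exact: poisson_gaussx (kk_le2 i j l) (axis_root_acute l al).
have S : tends0 (fun B => \sum_(c in glue) \sum_i \sum_j
    cabs (Hf i j) * cabs (\prod_l X c i j l B - \prod_l Y c i j l B)).
  apply: tends0_sum => c _; apply: tends0_sum => i _; apply: tends0_sum => j _.
  exact: tends0Z (cabs_ge0 _) (P c i j).
have := tends0Z (cabs_ge0 (#|glue|%:R^-1)) S.
apply: tends0_le; exists 0%N => B _.
rewrite sum_box_theta /dual_sum -mulrBr cabsM ler_wpM2l ?cabs_ge0// -sumrB.
apply: le_trans (cabs_sum _ _ _) _; apply: ler_sum => c _; rewrite -sumrB.
apply: le_trans (cabs_sum _ _ _) _; apply: ler_sum => i _; rewrite -sumrB.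
apply: le_trans (cabs_sum _ _ _) _; apply: ler_sum => j _.
by rewrite -mulrBr cabsM.
Qed.

(** The dual frequency c_l / d_l - b_l equals y_l / d_l for this integer y_l, and y is again a point
    of L, in the class of c. Since these points do not fill boxes, they need an exhaustion of their
    own. *)
Let shifted B (p : {ffun 'I_n -> 'I_dmax.+1} * {ffun 'I_n -> 'I_B.*2.+1}) (l : 'I_n) : int :=
  (p.1 l)%:Z + - box p.2 l * (d l)%:Z.

Let dual_points B : seq 'cV[R]_n :=
  [seq vec (shifted p) | p <- enum
    [pred p : {ffun 'I_n -> 'I_dmax.+1} * {ffun 'I_n -> 'I_B.*2.+1} | p.1 \in glue]].

Let dual_points_uniq B : uniq (dual_points B).
Proof.
rewrite map_inj_in_uniq ?enum_uniq// => -[c b] [c' b'].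
rewrite !mem_enum !inE /= => /andP[/forallP cd _] /andP[/forallP cd' _].
move=> /(frame_vec_inj fv) h.
have cc : c = c'.
  apply/ffunP => i; apply/val_inj => /=.
  have := congr1 (fun k : int => (k %% (d i)%:Z)%Z) (h i); rewrite /shifted /=.
  rewrite ![_ + _ * _]addrC !modzMDl !modz_small; first by move=> [].
  - by rewrite ltz_nat cd'.
  - by rewrite ltz_nat cd.
rewrite cc; congr pair; apply: box_inj => i; have := h i.
rewrite /shifted /= cc => /addrI; rewrite !mulNr => /oppr_inj.
exact: (mulIf (dz0 i)).
Qed.

Let dual_points_in B x : x \in dual_points B -> L x.
Proof.
move=> /mapP[[c b]]; rewrite mem_enum !inE /= => /andP[_ /asboolP Lc] ->.
exact: frame_vec_periodic.
Qed.

Let dual_points_cover x : L x ->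
  exists B0, forall B, (B0 <= B)%N -> x \in dual_points B.
Proof.
move=> Lx; set m := frame_coord v x.
exists (\max_i absz (m i %/ (d i)%:Z)%Z) => B hB.
have [|b bm] := @box_cover B (fun i => - (m i %/ (d i)%:Z)%Z).
  move=> i; have := leq_trans (leq_bigmax i) hB; rewrite normrN.
  by move: (m i %/ _)%Z => k; lia.
have mE : shifted (residue m, b) = m.
  apply/funext => i; rewrite /shifted /= bm opprK residueE addrC; exact/esym/divz_eq.
have xE : x = vec (shifted (residue m, b)).
  by rewrite mE (frame_coordK Lint fv Lx).
apply/mapP; exists (residue m, b) => //; rewrite mem_enum inE /=.
by apply: residue_glue; rewrite (frame_coordK Lint fv Lx).
Qed.

Let prod_nth_kk (A B : 'I_n -> C) i j :
  \prod_l nth 0 [:: 1; A l; B l] (kk i j l) = if i == j then B i else A i * A j.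
Proof.
have [<-|ij] := eqVneq i j.
  rewrite (bigD1 i) //= /kk eqxx /= big1 ?mulr1// => l /negbTE ->.
  by [].
rewrite (bigD1 i) //= (bigD1 j) //= 1?eq_sym// /kk !eqxx (negbTE ij) eq_sym (negbTE ij) /=.
by rewrite big1 ?mulr1// => l /andP[/negbTE -> /negbTE ->].
Qed.

Let root_const : R := \prod_l Num.sqrt (d l)%:R.

Let dual_sumE B lam : acute lam -> dual_sum B lam =
  - (#|glue|%:R^-1 * root_const%:C * lam ^- n * lam ^- 4) *
    \sum_(x <- dual_points B) theta_term (lam ^- 2) x.
Proof.
move=> al; have l0 := acute_neq0 al.
have s0 l : Num.sqrt (d l)%:R != 0 :> R by rewrite gt_eqF// sqrtr_gt0 ltr0n (frame_gt0 fv).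
have a0 l : axis_root lam l != 0 by exact: acute_neq0 (axis_root_acute l al).
have p0 : pi%:C != 0 :> C by rewrite (fmorph_eq0 (real_complex R)) gt_eqF// pi_gt0.
rewrite /dual_sum -!(mulrA #|glue|%:R^-1) -mulrN -(mulrA #|glue|%:R^-1); congr (_ * _).
rewrite big_map big_enum /=.
rewrite (eq_bigl (fun p => (p.1 \in glue) && xpredT p.2)); last by move=> p; rewrite andbT.
rewrite -(pair_big (fun c => c \in glue) xpredT (fun c b => theta_term (lam ^- 2) (vec (shifted (c, b))))) /=.
rewrite mulr_sumr; apply: eq_bigr => c _.
under eq_bigr => i _ do under eq_bigr => j _ do rewrite prod_zsum mulr_sumr.
under eq_bigr => i _ do rewrite exchange_big.
rewrite exchange_big mulr_sumr; apply: eq_bigr => b _ /=.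
set y := shifted (c, b).
have yE l : (c l)%:R / (d l)%:R - (box b l)%:~R = (y l)%:~R / (d l)%:R :> R.
  rewrite /y /shifted /= intrD intrM mulrDl mulfK//; last exact: d0.
  by rewrite mulrNz.
pose A l : C := iota * (y l)%:~R%:C / lam ^+ 2.
pose Bq l : C := (d l)%:R%:C / (2 * pi%:C * lam ^+ 2) - (y l)%:~R%:C ^+ 2 / lam ^+ 4.
have dC l : (d l)%:R%:C != 0 :> C by rewrite (fmorph_eq0 (real_complex R)) d0.
have gE i j : \prod_l ghat (axis_root lam l) (kk i j l) (@gauss_moment R)
      ((c l)%:R / (d l)%:R - (box b l)%:~R) =
    root_const%:C * lam ^- n * cexp (- (pi%:C * lam ^- 2 * (dot (vec y) (vec y))%:C)) *
      (if i == j then Bq i else A i * A j).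
  rewrite -prod_nth_kk (dot_frame_vec2 fv) rmorph_sum mulr_sumr -sumrN cexp_sum.
  have -> : root_const%:C * lam ^- n = \prod_l (axis_root lam l)^-1.
    rewrite /root_const rmorph_prod -exprVn -[X in _ ^+ X](card_ord n) -prodr_const.
    rewrite -big_split; apply: eq_bigr => l _ /=; rewrite /axis_root invfM -fmorphV.
    by rewrite /= invrK.
  rewrite -!big_split; apply: eq_bigr => l _ /=.
  rewrite yE ghatE ?kk_le2//; congr (_ * cexp _ * _).
    rewrite expr_div_n axis_root2 !rmorphM !fmorphV /=.
    by move: (dC l) p0; move: (d l)%:R%:C (pi%:C) => D p D0 p0; field; rewrite l0 D0.
  have e1 : iota * ((y l)%:~R / (d l)%:R)%:C / axis_root lam l ^+ 2 = A l.
    rewrite axis_root2 rmorphM !fmorphV /= /A.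
    by move: (dC l); move: (d l)%:R%:C => D D0; field; rewrite l0 D0.
  have e2 : (2 * pi%:C * axis_root lam l ^+ 2)^-1 -
      ((y l)%:~R / (d l)%:R)%:C ^+ 2 / axis_root lam l ^+ 4 = Bq l.
    rewrite (exprM _ 2 2) axis_root2 rmorphM !fmorphV /= /Bq.
    by move: (dC l) p0; move: (d l)%:R%:C (pi%:C) => D p D0 p0; field; rewrite l0 D0 p0.
  by rewrite e1 e2.
under eq_bigr => i _ do under eq_bigr => j _ do rewrite gE.
(* The excess of a diagonal entry over the product form; weighted by the diagonal of H, these
   excesses add up to a multiple of tr H. *)
have AB i : Bq i = A i * A i + (d i)%:R%:C / (2 * pi%:C * lam ^+ 2).
  have i2 : iota ^+ 2 = -1 by exact: sqr_i.
  rewrite /A /Bq (_ : _ * (iota * _ / _) = iota ^+ 2 * ((y i)%:~R%:C ^+ 2 / lam ^+ 4)); last by field.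
  by rewrite i2; ring.
(* The square of [iota] is the source of the minus sign in the inversion formula. *)
have AA i j : A i * A j = - lam ^- 4 * ((y i)%:~R * (y j)%:~R)%:C.
  have i2 : iota ^+ 2 = -1 by exact: sqr_i.
  rewrite /A rmorphM /= (_ : _ * (iota * _ / _) = iota ^+ 2 * lam ^- 4 * ((y i)%:~R%:C * (y j)%:~R%:C)); last by field.
  by rewrite i2; ring.
set e := cexp _; set r := root_const%:C * _.
transitivity (r * e * (- lam ^- 4 * (qform H (vec y))%:C +
   (\sum_i (d i)%:R * frame_form d v H i i)%:C / (2 * pi%:C * lam ^+ 2))).
  rewrite (qform_frame_vec _ _ H) !rmorph_sum mulr_sumr mulr_suml -big_split mulr_sumr /=.
  apply: eq_bigr => i _.
  have -> : \sum_j Hf i j * (r * e * (if i == j then Bq i else A i * A j)) =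
      \sum_j Hf i j * (r * e * (A i * A j)) +
      Hf i i * (r * e * ((d i)%:R%:C / (2 * pi%:C * lam ^+ 2))).
    rewrite (bigD1 i) //= [X in _ = X + _](bigD1 i) //= eqxx AB.
    rewrite (eq_bigr (fun j => Hf i j * (r * e * (A i * A j)))); first by ring.
    by move=> j ji; rewrite eq_sym (negbTE ji).
  rewrite [in RHS]mulrDr; congr (_ + _).
    rewrite rmorph_sum !mulr_sumr; apply: eq_bigr => j _.
    by rewrite AA /Hf; move: (frame_form _ _ _ _ _) => h; rewrite !rmorphM /=; ring.
  by rewrite /Hf; move: (frame_form _ _ _ _ _) => h; rewrite rmorphM /=; ring.
rewrite (frame_form_trace fv) trH mul0r addr0 /theta_term -/y -/e /r; ring.
Qed.

(* The trace condition removes the second Gaussian moment, which is the only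
   obstruction to the weight n/2 + 2 transformation law. *)
Theorem theta_functional : exists2 k : R, 0 < k & forall lam, acute lam ->
  theta (lam ^+ 2) = - (k%:C * lam ^- n * lam ^- 4) * theta (lam ^- 2).
Proof.
exists (#|glue|%:R^-1 * root_const).
  rewrite mulr_gt0// ?invr_gt0 ?ltr0n ?glue_gt0//.
  by apply: prodr_gt0 => l _; rewrite sqrtr_gt0 ltr0n (frame_gt0 fv).
move=> lam al.
have Re2 (m : C) : acute m -> 0 < complex.Re (m ^+ 2).
  case: m => a b; rewrite /acute /= => ab.
  have a0 : 0 <= a by apply: le_trans (ltW ab).
  by rewrite subr_gt0 -!expr2 -[b ^+ 2]real_normK ?num_real// ltrXn2r ?nnegrE.
have [K1 h1] := sbound_theta (Re2 _ al).
have [K2 h2] := sbound_theta (Re2 _ (acuteV al)); rewrite exprVn in h2.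
have t1 := csum_exhaust (h1 _ (lexx _)) box_points_uniq box_points_in box_points_cover.
have t2 := csum_exhaust (h2 _ (lexx _)) dual_points_uniq dual_points_in dual_points_cover.
apply: (ctends_unique (ctends_diff t1 (dual_sum_diff al))).
have := ctendsZ (- (#|glue|%:R^-1 * root_const%:C * lam ^- n * lam ^- 4)) t2.
rewrite rmorphM fmorphV rmorph_nat /=.
by congr (ctends _ _); apply/funext => B; rewrite dual_sumE.
Qed.

End Theta.

(** * Vanishing of cusp forms of small weight *)

Section Numerics.
Variable R : realType.

Lemma pi_ge_31_10 : 31 / 10 <= pi :> R.
Proof.
have p0 := @pi_gt0 R.
have c3 : cos (pi / 3) = 1 / 2 :> R.
  have c0 : 0 < cos (pi / 3) :> R by apply: cos_gt0_pihalf; lra.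
  have : cos (pi / 3 + (pi / 3) *+ 2) = -1 :> R.
    by rewrite (_ : pi / 3 + (pi / 3) *+ 2 = pi) ?cospi//; field.
  rewrite cosD cos_mulr2n sin_mulr2n => h.
  have s2 := sin2cos2 (pi / 3 : R).
  move: h s2 c0; set c := cos _; set s := sin _ => h s2 c0.
  (* This is cos (3 x) + 1 = 4 c^3 - 3 c + 1 at x = pi / 3, factored. *)
  have {h s2} : (c + 1) * (2 * c - 1) ^+ 2 = 0.
    have -> : (c + 1) * (2 * c - 1) ^+ 2 = (c * (c ^+ 2 *+ 2 - 1) - s * ((c * s) *+ 2) + 1)
       + 2 * c * (s ^+ 2 - (1 - c ^+ 2)) by ring.
    by rewrite h s2; ring.
  move/eqP; rewrite mulf_eq0 sqrf_eq0 => /orP[] /eqP; lra.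
have c6 : cos (pi / 6) ^+ 2 = 3 / 4 :> R.
  have := cos_mulr2n (pi / 6 : R); rewrite (_ : (pi / 6) *+ 2 = pi / 3); last by field.
  by rewrite c3; lra.
have c60 : 0 < cos (pi / 6) :> R by apply: cos_gt0_pihalf; lra.
have c12 : cos (pi / 6) = 1 - 2 * sin (pi / 12) ^+ 2 :> R.
  have := cos_mulr2n (pi / 12 : R); rewrite (_ : (pi / 12) *+ 2 = pi / 6); last by field.
  by rewrite cos2sin2; lra.
have x0 : 0 < pi / 12 :> R by rewrite divr_gt0.
have s12 : sin (pi / 12) <= pi / 12 :> R.
  have [|c /andP[cl cr]] := @MVT R sin cos 0 (pi / 12) x0 (fun y _ => is_derive_sin y).
    by apply: continuous_subspaceT => y; exact: continuous_sin.
  rewrite sin0 !subr0 => ->; apply: ler_piMl; first exact: ltW.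
  exact: cos_le1.
have s120 : 0 <= sin (pi / 12) :> R by apply: sin_ge0_pi; lra.
rewrite leNgt; apply/negP => p31.
have : sin (pi / 12) ^+ 2 <= (31 / 120) ^+ 2 :> R.
  by rewrite lerXn2r ?nnegrE//; lra.
(* 97 / 56 is a convergent of sqrt 3 from above, so 97 / 112 just exceeds the true value of cos (pi
   / 6). *)
move=> h; have c6l : 97 / 112 <= cos (pi / 6) :> R by rewrite c12; lra.
have : (97 / 112) ^+ 2 <= cos (pi / 6) ^+ 2 :> R.
  by rewrite lerXn2r ?nnegrE//; lra.
by rewrite c6; lra.
Qed.

(** Six squarings of 1 + 1 / 64 <= exp (1 / 64), each result rounded down to a small fraction. *)
Lemma expR1_ge_43_16 : 43 / 16 <= expR 1 :> R.
Proof.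
have dbl (y z m : R) : 0 <= y -> y <= z ^+ 2 -> 0 <= z -> z <= expR m ->
    y <= expR (m * 2).
  move=> y0 yz z0 zm; apply: le_trans yz _.
  by rewrite -[2]/(2%:R) expRM_natr lerXn2r ?nnegrE ?expR_ge0.
have h0 : 65 / 64 <= expR (1 / 64) :> R.
  by apply: le_trans (expR_ge1Dx _); lra.
have h1 : 164 / 159 <= expR (1 / 64 * 2) :> R by apply: dbl h0; lra.
have h2 : 50 / 47 <= expR (1 / 64 * 2 * 2) :> R by apply: dbl h1; lra.
have h3 : 43 / 38 <= expR (1 / 64 * 2 * 2 * 2) :> R by apply: dbl h2; lra.
have h4 : 242 / 189 <= expR (1 / 64 * 2 * 2 * 2 * 2) :> R by apply: dbl h3; lra.
have h5 : 241 / 147 <= expR (1 / 64 * 2 * 2 * 2 * 2 * 2) :> R by apply: dbl h4; lra.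
have h6 : 43 / 16 <= expR (1 / 64 * 2 * 2 * 2 * 2 * 2 * 2) :> R by apply: dbl h5; lra.
apply: le_trans h6 _; rewrite le_eqVlt; apply/orP; left; apply/eqP; congr expR.
by field.
Qed.

Lemma expRN_pi_le : expR (- pi) <= 1 / 21 :> R.
Proof.
have p31 := pi_ge_31_10; have e1 := expR1_ge_43_16.
have h : 21 <= expR pi :> R.
  apply: le_trans (_ : expR (1 * 3%:R + 1 / 10) <= _); last by rewrite ler_expR; lra.
  rewrite expRD expRM_natr.
  have h1 : (43 / 16) ^+ 3 <= expR 1 ^+ 3 :> R by rewrite lerXn2r ?nnegrE ?expR_ge0; lra.
  have h2 := expR_ge1Dx (1 / 10 : R).
  apply: le_trans (_ : (43 / 16) ^+ 3 * (1 + 1 / 10) <= _); first by lra.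
  by apply: ler_pM; [lra|lra|exact: h1|exact: h2].
by rewrite expRN -div1r ler_pdivrMr ?expR_gt0//; lra.
Qed.

Lemma expRN_arc_le : expR (- (pi * (18 / 25))) <= 9 / 80 :> R.
Proof.
have p31 := pi_ge_31_10; have e1 := expR1_ge_43_16.
have h : 80 / 9 <= expR (pi * (18 / 25)) :> R.
  apply: le_trans (_ : expR (1 * 2%:R + 29 / 125) <= _); last by rewrite ler_expR; lra.
  rewrite expRD expRM_natr.
  have h1 : (43 / 16) ^+ 2 <= expR 1 ^+ 2 :> R by rewrite lerXn2r ?nnegrE ?expR_ge0; lra.
  have h2 := expR_ge1Dx (29 / 125 : R).
  apply: le_trans (_ : (43 / 16) ^+ 2 * (1 + 29 / 125) <= _); first by lra.
  by apply: ler_pM; [lra|lra|exact: h1|exact: h2].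
have i9 : (80 / 9)^-1 = 9 / 80 :> R by field.
rewrite expRN -i9 lef_pV2 ?posrE ?expR_gt0//; lra.
Qed.

(* The constants come from weight 14, the largest weight needed: with s = 2 Re w
   the function s ^ 7 e ^ (- pi s) is maximal at s = 7 / pi. *)
Lemma cusp_contraction (s r rho : R) : 43 / 25 <= s ->
  r = expR (- pi) -> rho = expR (- (pi * (s - 1))) ->
  s ^+ 7 * (rho * (rho / (1 - rho) + r / (1 - r))) <= 97 / 100.
Proof.
move=> s0 rE rhoD; have p31 := pi_ge_31_10; have e1 := expR1_ge_43_16.
have r21 : r <= 1 / 21 by rewrite rE expRN_pi_le.
have r0 : 0 <= r by rewrite rE expR_ge0.
have rho0 : 0 <= rho by rewrite rhoD expR_ge0.
set t := s - 43 / 25; have t0 : 0 <= t by rewrite /t; lra.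
have rhoE : rho = expR (- (pi * (18 / 25))) * expR (- (pi * t)).
  by rewrite -expRD rhoD /t; congr expR; lra.
have et1 : expR (- (pi * t)) <= 1.
  by rewrite -[leRHS]expR0 ler_expR oppr_le0 mulr_ge0 ?pi_ge0.
have rho9 : rho <= 9 / 80.
  rewrite rhoE; apply: le_trans (_ : expR (- (pi * (18 / 25))) * 1 <= _).
    by rewrite ler_wpM2l ?expR_ge0.
  by rewrite mulr1; exact: expRN_arc_le.
(* The maximum is at s = 43 / 25: with t = s - 43 / 25, (1 + 25 t / 43)^7 <= exp (175 t / 43) <= exp
   (2 pi t), which the decay of rho^2 cancels. *)
have first : s ^+ 7 * rho ^+ 2 <= 57 / 100.
  have sE : s = 43 / 25 * (1 + t / (43 / 25)) by rewrite /t; field.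
  have e2 : (1 + t / (43 / 25)) ^+ 7 <= expR (pi * t) ^+ 2.
    apply: le_trans (_ : expR (t / (43 / 25)) ^+ 7 <= _).
      by rewrite lerXn2r ?nnegrE ?expR_ge0 ?expR_ge1Dx// addr_ge0// divr_ge0//; lra.
    rewrite -!expRM_natr ler_expR (_ : t / (43 / 25) * 7%:R = t * (175 / 43)); last by field.
    by rewrite (mulrC pi) -mulrA ler_wpM2l//; lra.
  have e3 : expR (pi * t) ^+ 2 * rho ^+ 2 <= (9 / 80) ^+ 2.
    rewrite -exprMn rhoE mulrCA -expRD subrr expR0 mulr1.
    by rewrite lerXn2r ?nnegrE ?expR_ge0 ?expRN_arc_le//; lra.
  have k7 : (43 / 25) ^+ 7 <= 448 / 10 :> R.
    have k2 : (43 / 25) ^+ 2 <= 74 / 25 :> R by lra.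
    have k3 : (74 / 25) ^+ 3 <= 26 :> R by lra.
    rewrite (_ : (43 / 25) ^+ 7 = ((43 / 25) ^+ 2) ^+ 3 * (43 / 25)); last by ring.
    have : ((43 / 25) ^+ 2) ^+ 3 <= (74 / 25) ^+ 3 :> R.
      by rewrite lerXn2r ?nnegrE ?exprn_ge0//; lra.
    by lra.
  rewrite {1}sE exprMn -mulrA.
  apply: le_trans (_ : 448 / 10 * (9 / 80) ^+ 2 <= _); last by lra.
  apply: ler_pM; [lra| |exact: k7|].
    by rewrite mulr_ge0 ?sqr_ge0// exprn_ge0// addr_ge0// divr_ge0//; lra.
  by apply: le_trans e3; rewrite ler_wpM2r ?sqr_ge0.
(* The tangent bound x <= exp (x - 1), sharp at x = 1, is applied to x = pi s / 7 and yields (7 /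
   (pi e))^7. *)
have second : s ^+ 7 * (rho * r) <= 3 / 10.
  have -> : rho * r = expR (- (pi * s)) by rewrite rE rhoD -expRD; congr expR; ring.
  have q : pi * s / 7 <= expR (pi * s / 7 - 1).
    by apply: le_trans (expR_ge1Dx _); lra.
  have ps0 : 0 <= pi * s / 7 by rewrite divr_ge0 ?mulr_ge0 ?pi_ge0//; lra.
  have {}q : (pi * s / 7) ^+ 7 * expR (- (pi * s)) <= expR (- 7%:R).
    have : (pi * s / 7) ^+ 7 <= expR (pi * s / 7 - 1) ^+ 7.
      by rewrite lerXn2r ?nnegrE ?expR_ge0.
    move=> /(ler_wpM2r (expR_ge0 (- (pi * s)))) h; apply: le_trans h _.
    rewrite -expRM_natr -expRD ler_expR le_eqVlt; apply/orP; left; apply/eqP.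
    by field.
  have E7 : expR (- 7%:R) <= (16 / 43) ^+ 7 :> R.
    have E1 : expR (- 1) <= 16 / 43 :> R.
      have i9 : (43 / 16)^-1 = 16 / 43 :> R by field.
      rewrite expRN -i9 lef_pV2 ?posrE ?expR_gt0//; lra.
    have p0 : 0 <= 16 / 43 :> R by lra.
    by rewrite -[- 7%:R]mulN1r expRM_natr lerXn2r ?nnegrE ?expR_ge0.
  have p7 : (31 / 70) ^+ 7 * s ^+ 7 <= (pi * s / 7) ^+ 7.
    have l0 : 0 <= 31 / 70 * s by lra.
    have lp : 31 / 70 * s <= pi * s / 7.
      rewrite (_ : pi * s / 7 = pi / 7 * s); last by field.
      by rewrite ler_wpM2r//; lra.
    by rewrite -exprMn lerXn2r ?nnegrE.
  have h : (31 / 70) ^+ 7 * (s ^+ 7 * expR (- (pi * s))) <= (16 / 43) ^+ 7.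
    rewrite mulrA; apply: le_trans (_ : (pi * s / 7) ^+ 7 * expR (- (pi * s)) <= _).
      by rewrite ler_wpM2r ?expR_ge0.
    exact: le_trans E7.
  have num : (16 / 43) ^+ 7 <= (31 / 70) ^+ 7 * (3 / 10) :> R.
    have g2 : (37 / 44) ^+ 2 <= 17 / 24 :> R by lra.
    have g20 : 0 <= (37 / 44) ^+ 2 :> R by lra.
    have g24 : 0 <= 17 / 24 :> R by lra.
    have g6 : ((37 / 44) ^+ 2) ^+ 3 <= (17 / 24) ^+ 3 :> R by rewrite lerXn2r ?nnegrE.
    have g7 : (37 / 44) ^+ 7 <= 3 / 10 :> R.
      rewrite (_ : (37 / 44) ^+ 7 = ((37 / 44) ^+ 2) ^+ 3 * (37 / 44)); last by ring.
      by lra.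
    have u0 : 0 <= 16 / 43 :> R by lra.
    have u1 : 16 / 43 <= 31 / 70 * (37 / 44) :> R by lra.
    have u2 : 0 <= 31 / 70 * (37 / 44) :> R by lra.
    have u3 : 0 <= (31 / 70) ^+ 7 :> R by apply: exprn_ge0; lra.
    apply: le_trans (_ : (31 / 70 * (37 / 44)) ^+ 7 <= _).
      by rewrite lerXn2r ?nnegrE.
    by rewrite exprMn ler_wpM2l.
  have c0 : 0 < (31 / 70) ^+ 7 :> R by rewrite exprn_gt0//; lra.
  by rewrite -(ler_pM2l c0); exact: le_trans num.
have s7 : 0 <= s ^+ 7 by rewrite exprn_ge0//; lra.
have i1 : (1 - rho)^-1 <= 80 / 71.
  by rewrite -[leRHS]invrK lef_pV2 ?posrE ?invr_gt0; lra.
have i2 : (1 - r)^-1 <= 21 / 20.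
  by rewrite -[leRHS]invrK lef_pV2 ?posrE ?invr_gt0; lra.
rewrite (_ : _ * (_ * _) = s ^+ 7 * rho ^+ 2 * (1 - rho)^-1 +
  s ^+ 7 * (rho * r) * (1 - r)^-1); last by ring.
apply: le_trans (_ : 57 / 100 * (80 / 71) + 3 / 10 * (21 / 20) <= _); last by lra.
apply: lerD; apply: ler_pM => //; rewrite ?invr_ge0 ?mulr_ge0 ?exprn_ge0//; lra.
Qed.

End Numerics.

(** * Fourier coefficients and the estimate near the cusp *)

Section CuspVanishing.
Variables (R : realType) (n : nat) (L : set 'cV[R]_n) (H : 'M[R]_n).
Local Notation C := R[i].
Hypothesis even_dot : forall x, L x -> exists k : nat, dot x x = (2 * k)%:R.
Hypothesis bounded : forall y, 0 < y -> exists K, forall w : C, y <= complex.Re w ->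
  sbound L (fun x => cabs (theta_term H w x)) K.

Let th (w : C) : C := theta L H w.
Let term (w : C) x : C := theta_term H w x.

Lemma theta_term_shift (y t u : R) x k : dot x x = (2 * k)%:R ->
  term (Complex y (t + u)) x = term (Complex y t) x * cexp2pi (- (u * k%:R)).
Proof.
move=> xk; rewrite /term /theta_term -[RHS]mulrA; congr (_ * _).
rewrite /cexp2pi -cexpD; congr cexp; rewrite xk natrM.
by apply/eqP; rewrite eq_complex /=; apply/andP; split; apply/eqP; ring.
Qed.

Lemma theta_periodic (y t : R) (z : int) : 0 < y ->
  th (Complex y (t + z%:~R)) = th (Complex y t).
Proof.
move=> y0; have [K hK] := bounded y0.
apply: (@eq_csum _ _ _ _ _ K) => [|x /even_dot[k xk]]; first exact: hK.
have := theta_term_shift y t z%:~R xk; rewrite /term => ->.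
rewrite -[k%:R]/(k%:~R) -intrM cexp2piN cexp2pi_int.
by rewrite invr1 mulr1.
Qed.

Let part (m : nat) (w : C) x : C := if dot x x == (2 * m)%:R then term w x else 0.
Let tail (N : nat) (w : C) x : C := if (2 * N)%:R <= dot x x then term w x else 0.

Let cabs_part_term m w x : cabs (part m w x) <= cabs (term w x).
Proof. by rewrite /part; case: ifP => _ //; rewrite cabs0 cabs_ge0. Qed.

(** Half of the exponent keeps the sum bounded, and the other half is at most exp (- pi y N) on the
    terms kept. The weak rate 1 / (1 + N) is enough for [tends0_inv]. *)
Lemma tail_bound y : 0 < y -> exists2 K, 0 <= K & forall N w, y <= complex.Re w ->
  sbound L (fun x => cabs (tail N w x)) (K / (1 + N%:R)).
Proof.
move=> y0; have y2 : 0 < y / 2 by rewrite divr_gt0.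
have [K hK] := bounded y2; have K0 := sbound_ge0 (hK _ (lexx (complex.Re (y / 2)%:C))).
pose c := Num.min 1 (pi * y).
have py : 0 < pi * y by rewrite mulr_gt0 ?pi_gt0.
have c0 : 0 < c by rewrite lt_min ltr01.
exists (K / c) => [|N w yw]; first by rewrite divr_ge0// ltW.
have eN : expR (- (pi * y * N%:R)) <= (c * (1 + N%:R))^-1.
  rewrite expRN lef_pV2 ?posrE ?expR_gt0 ?mulr_gt0 ?ltr_wpDr//.
  apply: le_trans (expR_ge1Dx _); rewrite mulrDr mulr1; apply: lerD.
    by rewrite ge_min lexx.
  by rewrite ler_wpM2r// ge_min lexx orbT.
have -> : K / c / (1 + N%:R) = (c * (1 + N%:R))^-1 * K.
  by rewrite invfM; ring.
apply: sbound_le (sboundZ (ltW _) (hK _ (lexx (complex.Re (y / 2)%:C)))) => [x Lx|]; last first.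
  by rewrite invr_gt0 mulr_gt0// ltr_wpDr.
rewrite /tail; case: ifPn => [Nx|_]; last first.
  by rewrite cabs0 mulr_ge0 ?cabs_ge0// invr_ge0 mulr_ge0 ?(ltW c0)// addr_ge0.
apply: le_trans (ler_wpM2r (cabs_ge0 _) eN); rewrite !cabs_theta_term mulrCA.
rewrite ler_wpM2l// -expRD ler_expR /=.
have q0 := dot_ge0 x; set q := dot x x in Nx q0 *.
have h1 : pi * y * q <= pi * complex.Re w * q by rewrite ler_wpM2r// ler_pM2l ?pi_gt0.
have h2 : pi * y * (2 * N%:R) <= pi * y * q by rewrite ler_pM2l// -natrM.
by lra.
Qed.

Let half : C := Complex (1 / 2) 0.
Let r : R := expR (- pi).
Let qw (w : C) : C := cexp (- (2 * pi%:C * w)).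

Let r0 : 0 < r := expR_gt0 _.
Let r1 : r < 1.
Proof. by rewrite -expR0 ltr_expR oppr_lt0 pi_gt0. Qed.

Let rC0 : r%:C != 0 :> C.
Proof. by rewrite (fmorph_eq0 (real_complex R)) gt_eqF. Qed.

Let partE m w x : L x -> part m w x = (qw w / r%:C) ^+ m * part m half x.
Proof.
move=> /even_dot[k xk]; rewrite /part; case: ifP => [/eqP xm|_]; last by rewrite mulr0.
rewrite /term /theta_term xm mulrCA; congr (_ * _).
rewrite /qw /r -cexp_real -cexpN -cexpD -cexpMn -cexpD; congr cexp.
rewrite rmorph_nat natrM (_ : half = 2^-1).
  by rewrite rmorphN -mulr_natr /=; field.
apply: (mulfI (_ : (2 : C) != 0)) => //; rewrite divff// /half.
have -> : (2 : C) = (2 : R)%:C by rewrite rmorph_nat.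
by apply/eqP; rewrite eq_complex /=; apply/andP; split; apply/eqP; field.
Qed.

Let term_split M w x : L x -> term w x = \sum_(m < M) part m w x + tail M w x.
Proof.
move=> /even_dot[k xk]; rewrite /part /tail xk ler_nat leq_pmul2l//.
have e (m : nat) : ((2 * k)%:R == (2 * m)%:R :> R) = (k == m).
  by rewrite eqr_nat eqn_pmul2l.
case: leqP => [Mk|kM].
  rewrite big1 ?add0r// => m _; rewrite e; case: eqP => // km.
  by have := leq_trans (ltn_ord m) Mk; rewrite km ltnn.
rewrite addr0 (bigD1 (Ordinal kM)) //= e eqxx big1 ?addr0// => m /negbTE mk.
by rewrite e eq_sym (_ : (nat_of_ord m == k) = false)// -mk.
Qed.

(** The m-th Fourier coefficient times exp (- pi m). With this normalization the supremum of |theta|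
    on Re w = 1 / 2 bounds it without a further factor. *)
Let coef (m : nat) : C := csum L (part m half).

Let half_Re : 0 < complex.Re half. Proof. by rewrite /= divr_gt0. Qed.

Let part_bound w : 0 < complex.Re w -> exists K, forall m,
  sbound L (fun x => cabs (part m w x)) K.
Proof.
move=> /bounded[K hK]; exists K => m.
exact: (sbound_le (fun x _ => cabs_part_term m w x) (hK w (lexx _))).
Qed.

Let theta_split M w : 0 < complex.Re w ->
  th w = \sum_(m < M) (qw w / r%:C) ^+ m * coef m + csum L (tail M w).
Proof.
move=> w0; have [K hK] := bounded w0; have [Kp hKp] := part_bound w0.
have [Kt _ hKt] := tail_bound w0; have [Kh hKh] := part_bound half_Re.
rewrite /th /theta (eq_csum (hK w (lexx _)) (fun x Lx => term_split M w Lx)).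
have sp : sbound L (fun x => cabs (\sum_(m < M) part m w x)) (\sum_(m < M) Kp).
  apply: sbound_le (_ : sbound L (fun x => \sum_(m < M) cabs (part m w x)) _).
    by move=> x _; exact: cabs_sum.
  move=> F FL; rewrite exchange_big; apply: ler_sum => m _; exact: hKp.
rewrite (csumD sp (hKt M w (lexx _))); congr (_ + _).
rewrite (csum_sum _ (fun m : 'I_M => hKp m)); apply: eq_bigr => m _.
rewrite (eq_csum (hKp m) (fun x Lx => partE m w Lx)).
by rewrite (csumZ _ (hKh m)).
Qed.

(* An N-point average over the horizontal line Re w = 1/2 isolates the
   coefficients with index congruent to m modulo N. *)
Let cabs_coef_le S m : (forall t, cabs (th (Complex (1 / 2) t)) <= S) ->
  cabs (coef m) <= S.
Proof.
move=> thS; have [Kt Kt0 hKt] := tail_bound half_Re.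
have [K0 hK0] := part_bound half_Re.
have [K hK] := bounded half_Re.
have hKx t : sbound L (fun x => cabs (term (Complex (1 / 2) t) x)) K by exact: hK.
rewrite -subr_le0; apply: tends0_const_le.
(* Once B >= m, an index congruent to m modulo 2 B + 1 and different from m is at least B, so the
   aliases all lie in the tail. *)
apply: tends0_le (@tends0_inv R Kt); exists m => B mB.
have h0 := mesh_gt0 R B; set h := mesh R B in h0 *.
pose a x : C := h%:C * zsum B (fun j =>
  cexp2pi (j%:~R * (m%:R * h)) * term (Complex (1 / 2) (j%:~R * h)) x).
have avg : csum L a = h%:C * zsum B (fun j =>
    cexp2pi (j%:~R * (m%:R * h)) * th (Complex (1 / 2) (j%:~R * h))).
  have hz j : sbound L (fun x => cabs (cexp2pi (j%:~R * (m%:R * h)) *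
      term (Complex (1 / 2) (j%:~R * h)) x)) K.
    by apply: sbound_le (hKx (j%:~R * h)) => x _; rewrite cabsM cabs_cexp2pi mul1r.
  have hs : sbound L (fun x => cabs (zsum B (fun j => cexp2pi (j%:~R * (m%:R * h)) *
      term (Complex (1 / 2) (j%:~R * h)) x))) (\sum_(i < B.*2.+1) K).
    apply: sbound_le (_ : sbound L (fun x => zsum B (fun j =>
       cabs (cexp2pi (j%:~R * (m%:R * h)) * term (Complex (1 / 2) (j%:~R * h)) x))) _).
      by move=> x _; exact: cabs_zsum.
    by move=> F FL; rewrite exchange_big; apply: ler_sum => i _; exact: hz.
  rewrite (csumZ _ hs) (csum_sum _ (fun i : 'I_B.*2.+1 => hz _)); congr (_ * _).
  by apply: eq_bigr => i _; rewrite (csumZ _ (hKx _)).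
have avg_le : cabs (csum L a) <= S.
  rewrite avg cabsM cabs_real gtr0_norm//.
  have zS : cabs (zsum B (fun j => cexp2pi (j%:~R * (m%:R * h)) *
      th (Complex (1 / 2) (j%:~R * h)))) <= B.*2.+1%:R * S.
    apply: le_trans (cabs_zsum _ _) _.
    apply: le_trans (_ : zsum B (fun=> S) <= _).
      by apply: le_zsum => j; rewrite cabsM cabs_cexp2pi mul1r.
    by rewrite /zsum sumr_const card_ord mulr_natl.
  apply: le_trans (ler_wpM2l (ltW h0) zS) _.
  by rewrite mulrA /h /mesh mulVf ?mul1r// pnatr_eq0.
have a_part x : L x -> cabs (a x - part m half x) <= cabs (tail B half x).
  move=> /even_dot[k xk].
  have aE : a x = if (B.*2.+1%:Z %| k%:Z - m%:Z)%Z then term half x else 0.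
    rewrite /a (eq_zsum _ (g := fun j => term half x *
        cexp2pi (- (j%:~R * ((k%:Z - m%:Z)%:~R / B.*2.+1%:R))))); last first.
      move=> j; rewrite -[j%:~R * h]add0r (theta_term_shift _ _ _ xk) mulrCA -cexp2piD.
      by congr (_ * cexp2pi _); rewrite /h /mesh intrB; ring.
    rewrite zsumZ zsum_character; case: ifP => _; last by rewrite !mulr0.
    by rewrite mulrCA -(rmorph_nat (real_complex R)) -rmorphM /= /h /mesh mulVf ?mulr1.
  rewrite aE /part xk eqr_nat eqn_pmul2l//.
  have [->|km] := eqVneq k m; first by rewrite subrr dvdz0 subrr cabs0 cabs_ge0.
  rewrite subr0; case: ifP => [dv|_]; last by rewrite cabs0 cabs_ge0.
  rewrite /tail xk ler_nat leq_pmul2l//.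
  suff -> : (B <= k)%N by [].
  move/dvdzP: dv => [q qE]; rewrite leqNgt; apply/negP => kB.
  have : q = 0 by nia.
  by move=> q0; move: qE; rewrite q0 mul0r => /eqP; rewrite subr_eq0 => /eqP[kme]; rewrite kme eqxx in km.
have bd : sbound L (fun x => cabs (a x - part m half x)) (Kt / (1 + B%:R)).
  exact: sbound_le a_part (hKt B half (lexx _)).
have coefE : coef m = csum L a - csum L (fun x => a x - part m half x).
  have ha : sbound L (fun x => cabs (a x)) (Kt / (1 + B%:R) + K0).
    apply: sbound_le (sboundD bd (hK0 m)) => x _.
    by rewrite -{1}(subrK (part m half x) (a x)); exact: cabsD.
  have hN : sbound L (fun x => cabs (- 1 * (a x - part m half x))) (Kt / (1 + B%:R)).
    by apply: sbound_le bd => x _; rewrite mulN1r cabsN.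
  rewrite -mulN1r -(csumZ _ bd) -(csumD ha hN); apply: (eq_csum (hK0 m)) => x _.
  by rewrite mulN1r; ring.
rewrite lerBlDl coefE; apply: le_trans (cabsB _ _) _; apply: lerD => //.
exact: csum_le.
Qed.

Lemma geometric_le (x : R) k : 0 <= x -> x < 1 ->
  \sum_(i < k) x ^+ i <= (1 - x)^-1.
Proof.
move=> x0 x1; have h : 0 < 1 - x by rewrite subr_gt0.
rewrite -[leRHS]div1r ler_pdivlMr// mulrC.
rewrite (_ : (1 - x) * _ = 1 - x ^+ k) ?gerBl ?exprn_ge0//.
by rewrite -opprB mulNr -subrX1 opprB.
Qed.

(** The coefficient of index 0 is zero, and subtracting the multiple Q / a of theta(1) = 0 removes
    that of index 1. For m >= 2 the factor of [coef m] is then at most rho^m + rho r^(m - 1), and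
    two geometric series remain. *)
Lemma cusp_estimate S w (rho : R) : th 1 = 0 ->
  (forall t, cabs (th (Complex (1 / 2) t)) <= S) -> 1 / 2 < complex.Re w ->
  rho = expR (- (pi * (2 * complex.Re w - 1))) ->
  cabs (th w) <= S * (rho * (rho / (1 - rho) + r / (1 - r))).
Proof.
move=> th1 thS w12 rhoE; have S0 : 0 <= S by exact: le_trans (cabs_ge0 _) (thS 0).
have w0 : 0 < complex.Re w by lra.
have rho0 : 0 < rho by rewrite rhoE expR_gt0.
have rho1 : rho < 1.
  by rewrite rhoE -[ltRHS]expR0 ltr_expR oppr_lt0 mulr_gt0 ?pi_gt0//; lra.
set Q := qw w; set a := qw 1.
have aE : a = r%:C ^+ 2.
  rewrite /a /qw /r -cexp_real -cexpMn; congr cexp.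
  by rewrite rmorphN mulr1 -mulr_natr /=; ring.
have Qrho : cabs (Q / r%:C) = rho.
  rewrite cabsM cabsV cabs_real gtr0_norm// cabs_cexp rhoE /r -expRN -expRD.
  have -> : complex.Re (- (2 * pi%:C * w)) = - (2 * pi * complex.Re w).
    have -> : (2 : C) = (2 : R)%:C by rewrite rmorph_nat.
    by case: (w) => ? ? /=; ring.
  by congr expR; ring.
have a0 : a != 0 by rewrite aE expf_neq0.
have coef0 : coef 0 = 0.
  rewrite /coef (_ : part 0 half = fun=> 0); last first.
    apply/funext => x; rewrite /part muln0; case: eqP => // /eqP.
    by rewrite dot_eq0 => /eqP ->; rewrite /term /theta_term qform0 mul0r.
  apply: (@csum_unique _ _ _ _ 0) => [F _|e e0].
    by rewrite big1// => x _; rewrite cabs0.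
  exists fset0; first by rewrite set_fset0; exact: sub0set.
  by move=> F _ _; rewrite big1// subr0 cabs0 ltW.
have [Kw Kw0 hKw] := tail_bound w0.
have Re1 : 0 < complex.Re (1 : C) by rewrite /= ltr01.
have [K1 K10 hK1] := tail_bound Re1.
rewrite -subr_le0; apply: tends0_const_le.
apply: tends0_le (@tends0_inv R (Kw + cabs (Q / a) * K1)); exists 2 => M.
case: M => [//|[//|M]] _.
have E : th w = \sum_(i < M) ((Q / r%:C) ^+ i.+2 - Q / a * (a / r%:C) ^+ i.+2) * coef i.+2
    + (csum L (tail M.+2 w) - Q / a * csum L (tail M.+2 1)).
  have -> : th w = th w - Q / a * th 1 by rewrite th1 mulr0 subr0.
  rewrite (theta_split M.+2 w0) (theta_split M.+2 Re1) -/Q -/a.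
  rewrite !big_ord_recl /= coef0 !mulr0 !add0r !expr1.
  have -> : \sum_(i < M) ((Q / r%:C) ^+ i.+2 - Q / a * (a / r%:C) ^+ i.+2) * coef i.+2 =
     \sum_(i < M) (Q / r%:C) ^+ bump 0 (bump 0 i) * coef (bump 0 (bump 0 i)) -
     Q / a * \sum_(i < M) (a / r%:C) ^+ bump 0 (bump 0 i) * coef (bump 0 (bump 0 i)).
    by rewrite mulr_sumr -sumrB; apply: eq_bigr => i _; rewrite mulrBl mulrA.
  by move: (\sum_(i < M) _) (\sum_(i < M) _) (csum _ _) (csum _ _) => X Y Z T; field; rewrite a0 rC0.
have main : cabs (\sum_(i < M) ((Q / r%:C) ^+ i.+2 - Q / a * (a / r%:C) ^+ i.+2) *
    coef i.+2) <= S * (rho * (rho / (1 - rho) + r / (1 - r))).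
  apply: le_trans (cabs_sum _ _ _) _.
  apply: le_trans (_ : \sum_(i < M) S * (rho * (rho * rho ^+ i + r * r ^+ i)) <= _).
    apply: ler_sum => i _; rewrite cabsM mulrC; apply: ler_pM; rewrite ?cabs_ge0//.
      exact: cabs_coef_le.
    apply: le_trans (cabsB _ _) _; rewrite cabsX Qrho.
    have -> : Q / a * (a / r%:C) ^+ i.+2 = Q / r%:C * (r%:C * r%:C ^+ i).
      have -> : a / r%:C = r%:C by rewrite aE expr2 mulfK.
      rewrite aE [_ ^+ i.+2]exprS [_ ^+ i.+1]exprS.
      by move: rC0; move: (r%:C ^+ i) (r%:C) => p z z0; field.
    rewrite cabsM Qrho cabsM cabsX cabs_real (gtr0_norm r0) mulrDr.
    by rewrite !exprS.
  rewrite -mulr_sumr ler_wpM2l// -mulr_sumr ler_wpM2l ?(ltW rho0)//.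
  rewrite big_split -!mulr_sumr /=; apply: lerD; rewrite ler_wpM2l ?(ltW rho0) ?(ltW r0)//.
    by apply: geometric_le; rewrite ?ltW.
  by apply: geometric_le; rewrite ?ltW.
rewrite lerBlDl E; apply: le_trans (cabsD _ _) _; apply: lerD => //.
apply: le_trans (cabsB _ _) _; rewrite mulrDl; apply: lerD.
  exact: csum_le (hKw _ _ (lexx _)).
rewrite cabsM -mulrA ler_wpM2l ?cabs_ge0//.
exact: csum_le (hK1 _ _ (lexx _)).
Qed.

End CuspVanishing.

(** * Inversion, translation and the contraction of the supremum *)

Section ModularInvariance.
Variables (R : realType) (n j : nat) (L : set 'cV[R]_n) (H : 'M[R]_n).
Local Notation C := R[i].
Hypothesis even_dot : forall x, L x -> exists k : nat, dot x x = (2 * k)%:R.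
Hypothesis bounded : forall y, 0 < y -> exists K, forall w : C, y <= complex.Re w ->
  sbound L (fun x => cabs (theta_term H w x)) K.
Hypotheses (nj : n = (8 * j)%N) (j3 : (j <= 3)%N).
Variable k : R.
Hypothesis k0 : 0 < k.
Hypothesis functional : forall lam : C, acute lam ->
  theta L H (lam ^+ 2) = - (k%:C * lam ^- n * lam ^- 4) * theta L H (lam ^- 2).

Let th (w : C) : C := theta L H w.

Lemma acute_sqrt (w : C) : 0 < complex.Re w -> exists2 lam, acute lam & lam ^+ 2 = w.
Proof.
move=> w0; have := sqr_sqrtc w; case: (sqrtc w) => a b lw.
have ab : `|b| < `|a|.
  have : 0 < a ^+ 2 - b ^+ 2 by move: w0; rewrite -lw /= !expr2.
  rewrite subr_gt0 -[b ^+ 2]real_normK ?num_real// -[a ^+ 2]real_normK ?num_real//.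
  by rewrite ltr_pXn2r ?nnegrE.
have [a0|a0] := leP 0 a; first by rewrite (ger0_norm a0) in ab; exists (Complex a b).
rewrite (ltr0_norm a0) in ab; exists (- Complex a b); last by rewrite sqrrN.
by rewrite /acute /= normrN.
Qed.

Lemma Re_inv (w : C) : complex.Re w^-1 = complex.Re w / cabs w ^+ 2.
Proof. by rewrite sqr_cabs; case: w. Qed.

Lemma Re_inv_gt0 (w : C) : 0 < complex.Re w -> 0 < complex.Re w^-1.
Proof.
move=> w0; rewrite Re_inv divr_gt0// exprn_gt0// (lt_le_trans w0)//.
exact: le_trans (ler_norm _) (Re_le_cabs _).
Qed.

(** The point 1 is fixed by the inversion, whose factor there is the negative number - k. *)
Lemma theta_one_eq0 : th 1 = 0.
Proof.
have := functional (acute1 R); rewrite !expr1n !invr1 !mulr1 -/(th 1) => h.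
have : (1 + k)%:C * th 1 == 0 by rewrite rmorphD mulrDl mul1r {1}h mulNr addNr.
by rewrite mulf_eq0 (fmorph_eq0 (real_complex R)) gt_eqF ?addr_gt0// => /eqP.
Qed.

Lemma cabs_theta_inv (w : C) : 0 < complex.Re w ->
  cabs (th w) = k / cabs w ^+ (4 * j + 2) * cabs (th w^-1).
Proof.
move=> /acute_sqrt[lam al <-].
rewrite -exprVn /th functional// exprVn cabsM cabsN -mulrA -invfM -exprD.
rewrite cabsM cabs_real (gtr0_norm k0) cabsV !cabsX -exprM; congr (_ / _ ^+ _ * _).
by rewrite nj; lia.
Qed.

(** The exponent is half of the weight n / 2 + 2, which makes [Phi] invariant under integral
    translations of Im w and, when k = 1, under inversion. *)
Let Phi (w : C) : R := cabs (th w) * complex.Re w ^+ (2 * j + 1).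

Section NormalizedConstant.
Hypothesis k1 : k = 1.

Let Phi_inv w : 0 < complex.Re w -> Phi w^-1 = Phi w.
Proof.
move=> w0; have c0 : cabs w != 0.
  by rewrite gt_eqF// (lt_le_trans w0)// (le_trans (ler_norm _) (Re_le_cabs _)).
rewrite /Phi (cabs_theta_inv w0) k1 Re_inv expr_div_n -exprM.
rewrite (_ : (2 * (2 * j + 1) = 4 * j + 2)%N); last by lia.
rewrite div1r; move: (cabs (th _)) (cabs w ^+ _)^-1 (complex.Re w ^+ _) => a b c.
by ring.
Qed.

Let Phi_shift w : 0 < complex.Re w -> exists2 w', Phi w' = Phi w &
  complex.Re w' = complex.Re w /\ `|complex.Im w'| <= 1 / 2.
Proof.
case: w => y t /= y0; pose z := Num.floor (t + 1 / 2).
exists (Complex y (t - z%:~R)).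
  rewrite /Phi (_ : th (Complex y (t - z%:~R)) = th (Complex y t))//.
  by rewrite -[in RHS](subrK z%:~R t) /th (theta_periodic even_dot bounded).
split => //=; have := floor_le (t + 1 / 2); have := floorD1_gt (t + 1 / 2).
rewrite -/z intrD => h1 h2; rewrite ler_norml; apply/andP; split; lra.
Qed.

(** The bound M is used only on the line Re w = 1 / 2, which lies in the strip. The resulting power
    of 2 turns (Re w)^(2 j + 1) into a power of s = 2 Re w >= 1, so the exponent may be raised to
    7. *)
Let Phi_high M e : 0 < e -> e <= 1 / 2 ->
  (forall w, e <= complex.Re w -> complex.Re w <= 43 / 50 -> Phi w <= M) ->
  forall w, 43 / 50 <= complex.Re w -> Phi w <= 97 / 100 * M.
Proof.
have n1 : 1 <= 43 / 25 :> R by lra.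
have p7 : (2 * j + 1 <= 7)%N by lia.
move=> e0 e2 PM w w0; set y := complex.Re w.
have thS t : cabs (th (Complex (1 / 2) t)) <= 2 ^+ (2 * j + 1) * M.
  have h : Phi (Complex (1 / 2) t) <= M by apply: PM; rewrite [complex.Re _]/=; lra.
  have E2 : 2 ^+ (2 * j + 1) * (1 / 2) ^+ (2 * j + 1) = 1 :> R.
    by rewrite -exprMn (_ : 2 * (1 / 2) = 1 :> R) ?expr1n//; field.
  rewrite (_ : cabs (th (Complex (1 / 2) t)) = 2 ^+ (2 * j + 1) * Phi (Complex (1 / 2) t)).
    by rewrite ler_wpM2l ?exprn_ge0.
  by rewrite /Phi mulrCA E2 mulr1.
have M0 : 0 <= M.
  have := le_trans (cabs_ge0 _) (thS 0).
  by rewrite pmulr_rge0// exprn_gt0.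
have w12 : 1 / 2 < complex.Re w by lra.
have := cusp_estimate even_dot bounded theta_one_eq0 thS w12 (erefl _).
set r := expR (- pi); set rho := expR _; set X := rho * _ => h.
have rho1 : rho < 1.
  rewrite /rho -[ltRHS]expR0 ltr_expR oppr_lt0 mulr_gt0 ?pi_gt0//; lra.
have r1 : r < 1 by rewrite -[ltRHS]expR0 ltr_expR oppr_lt0 pi_gt0.
have X0 : 0 <= X.
  rewrite /X mulr_ge0 ?expR_ge0// addr_ge0// divr_ge0 ?expR_ge0// subr_ge0 ltW//.
have y2 : 43 / 25 <= 2 * y by rewrite /y; lra.
have E1 : (2 * y) ^+ (2 * j + 1) <= (2 * y) ^+ 7.
  have y1 : 1 <= 2 * y := le_trans n1 y2.
  exact: (ler_weXn2l y1 p7).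
have cc : (2 * y) ^+ 7 * X <= 97 / 100 by exact: (cusp_contraction y2 erefl erefl).
rewrite /Phi -/y; apply: le_trans (_ : (2 ^+ (2 * j + 1) * M * X) * y ^+ (2 * j + 1) <= _).
  by apply: ler_wpM2r h; rewrite exprn_ge0// /y; lra.
rewrite (_ : _ * _ = (2 * y) ^+ (2 * j + 1) * X * M); last by rewrite exprMn; ring.
exact: (ler_wpM2r M0 (le_trans (ler_wpM2r X0 E1) cc)).
Qed.

(** Where Re w < 43 / 50, translation to |Im w| <= 1 / 2 followed by inversion multiplies Re w by at
    least 101 / 100. Finitely many such moves reach the region of [Phi_high] without leaving Re w >=
    e. *)
Let Phi_contract M e : 0 < e -> e <= 1 / 2 ->
  (forall w, e <= complex.Re w -> complex.Re w <= 43 / 50 -> Phi w <= M) ->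
  forall w, e <= complex.Re w -> Phi w <= 97 / 100 * M.
Proof.
move=> e0 e2 PM.
have low m : forall w, e <= complex.Re w ->
    43 / 50 <= complex.Re w * (101 / 100) ^+ m -> Phi w <= 97 / 100 * M.
  elim: m => [|m ih] w ew.
    by rewrite expr0 mulr1 => h; exact: (Phi_high e0 e2 PM).
  move=> wm; have [hw|lw] := leP (43 / 50) (complex.Re w).
    exact: (Phi_high e0 e2 PM).
  have w0 : 0 < complex.Re w by exact: lt_le_trans ew.
  have [w' <- [ReE Im2]] := Phi_shift w0.
  have w'0 : 0 < complex.Re w' by rewrite ReE.
  rewrite -(Phi_inv w'0).
  (* (43 / 50)^2 + (1 / 2)^2 = 0.9896, just below 100 / 101. *)
  have c2 : cabs w' ^+ 2 <= 100 / 101.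
    rewrite sqr_cabs ReE -[complex.Im w' ^+ 2]real_normK ?num_real//.
    have : complex.Re w ^+ 2 <= (43 / 50) ^+ 2 by rewrite lerXn2r ?nnegrE ?ltW//; lra.
    have : `|complex.Im w'| ^+ 2 <= (1 / 2) ^+ 2 by rewrite lerXn2r ?nnegrE//; lra.
    by lra.
  have c0 : 0 < cabs w' ^+ 2.
    rewrite exprn_gt0// (lt_le_trans w'0)//.
    exact: le_trans (ler_norm _) (Re_le_cabs _).
  have grow : complex.Re w * (101 / 100) <= complex.Re w'^-1.
    rewrite Re_inv ReE ler_wpM2l ?(ltW w0)//.
    have e101 : (100 / 101)^-1 = 101 / 100 :> R by field.
    by rewrite -e101 lef_pV2 ?posrE; lra.
  apply: ih; first by apply: le_trans grow; lra.
  apply: le_trans wm _; rewrite exprS mulrA ler_wpM2r// exprn_ge0//; lra.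
move=> w ew; have w0 : 0 < complex.Re w by exact: lt_le_trans ew.
have [m hm] : exists m, 43 / 50 <= complex.Re w * (101 / 100) ^+ m.
  pose N := Num.bound (100 * (43 / 50) / complex.Re w); exists N.
  have h : 100 * (43 / 50) / complex.Re w < N%:R.
    by apply: archi_boundP; rewrite divr_ge0 ?(ltW w0)//; lra.
  have b (m : nat) : 1 + m%:R / 100 <= (101 / 100 : R) ^+ m.
    elim: m => [|m ihm]; first by rewrite mul0r addr0 expr0.
    rewrite exprS -natr1; have : 0 <= m%:R / 100 :> R by rewrite divr_ge0.
    by lra.
  rewrite [leRHS]mulrC -ler_pdivrMr//; apply: le_trans _ (b N); move: h.
  by rewrite -mulrA; lra.
exact: (low m).
Qed.

(** [Phi_contract] is used twice: with a crude bound on the strip, to make the supremum over Re w >=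
    e finite, and then with that supremum as M, to make it zero. *)
Lemma theta_eq0_normalized w : 0 < complex.Re w -> th w = 0.
Proof.
move=> w0; pose e := Num.min (complex.Re w) (1 / 2).
have e0 : 0 < e by rewrite lt_min w0 divr_gt0.
have e2 : e <= 1 / 2 by rewrite ge_min lexx orbT.
have ew : e <= complex.Re w by rewrite ge_min lexx.
have [K hK] := bounded e0.
have PK u : e <= complex.Re u -> complex.Re u <= 43 / 50 ->
    Phi u <= K * (43 / 50) ^+ (2 * j + 1).
  move=> eu u1; have u0 := lt_le_trans e0 eu.
  apply: ler_pM; rewrite ?cabs_ge0 ?exprn_ge0 ?(ltW u0)//.
    exact: csum_le (hK u eu).
  by rewrite lerXn2r ?nnegrE ?(ltW u0)//; lra.
pose E := [set Phi u | u in [set u : C | e <= complex.Re u]].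
have E0 : E !=set0 by exists (Phi w), w.
have hE : has_sup E.
  split => //; exists (97 / 100 * (K * (43 / 50) ^+ (2 * j + 1))) => _ [u eu <-].
  exact: (Phi_contract e0 e2 PK).
have Es u : e <= complex.Re u -> Phi u <= sup E.
  by move=> eu; apply: ub_le_sup; [exact: hE.2|exists u].
have sE : sup E <= 97 / 100 * sup E.
  apply: ge_sup => // _ [u eu <-].
  by apply: (Phi_contract e0 e2) eu => v ev _; exact: Es.
have P0 : Phi w = 0.
  have h := Es w ew; apply/eqP; rewrite eq_le; apply/andP; split; first by lra.
  by rewrite mulr_ge0 ?cabs_ge0// exprn_ge0// ltW.
move/eqP: P0; rewrite mulf_eq0 cabs_eq0 expf_eq0 (gt_eqF w0) andbF orbF.
by move/eqP.
Qed.

End NormalizedConstant.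

(* Applying the inversion twice multiplies the modulus by k ^ 2, so that either
   k = 1 or theta vanishes identically. *)
Theorem theta_eq0 w : 0 < complex.Re w -> theta L H w = 0.
Proof.
move=> w0; have [k1|nk1] := eqVneq k 1; first exact: (theta_eq0_normalized k1).
have c0 : cabs w != 0.
  by rewrite gt_eqF// (lt_le_trans w0)// (le_trans (ler_norm _) (Re_le_cabs _)).
have h : cabs (th w) = k ^+ 2 * cabs (th w).
  rewrite {1}(cabs_theta_inv w0) (cabs_theta_inv (Re_inv_gt0 w0)) invrK cabsV exprVn.
  have : cabs w ^+ (4 * j + 2) != 0 by rewrite expf_neq0.
  by move: (cabs w ^+ _) => A A0; field.
apply/eqP; rewrite -cabs_eq0.
have : (1 - k ^+ 2) * cabs (th w) == 0 by rewrite mulrBl mul1r {1}h subrr.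
rewrite mulf_eq0 => /orP[|//]; rewrite subr_eq0 eq_sym sqrf_eq1 (negbTE nk1) /=.
by rewrite gt_eqF// (lt_trans _ k0)// oppr_lt0.
Qed.

End ModularInvariance.

(** * Criticality *)

Section RealUnorderedSums.
Variables (R : realType) (T : choiceType).
Implicit Types (D : set T) (f g : T -> R).

Lemma sbound_sub D D' f K : D' `<=` D -> sbound D f K -> sbound D' f K.
Proof. by move=> DD' fK F FD; apply: fK; exact: subset_trans DD'. Qed.

Let sbound_cabs D f K : sbound D (fun x => `|f x|) K ->
  sbound D (fun x => cabs (f x)%:C) K.
Proof. by apply: sbound_le => x _; rewrite cabs_real. Qed.

Lemma usumD D f g K K' : sbound D (fun x => `|f x|) K ->
  sbound D (fun x => `|g x|) K' ->
  usum D (fun x => f x + g x) = usum D f + usum D g.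
Proof.
move=> /sbound_cabs fK /sbound_cabs gK; have := csumD fK gK.
rewrite [in LHS](_ : (fun x => (f x)%:C + (g x)%:C) = (fun x => (f x + g x)%:C)).
  by move=> /(congr1 (@complex.Re R)).
by apply/funext => x; rewrite rmorphD.
Qed.

Lemma usumZ D c f K : sbound D (fun x => `|f x|) K ->
  usum D (fun x => c * f x) = c * usum D f.
Proof.
move=> /sbound_cabs fK; have := csumZ c%:C fK.
rewrite [in LHS](_ : (fun x => c%:C * (f x)%:C) = (fun x => (c * f x)%:C)).
  by move=> /(congr1 (@complex.Re R)); rewrite usumE /= mul0r subr0.
by apply/funext => x; rewrite rmorphM.
Qed.

Lemma usum_le D f K : sbound D (fun x => `|f x|) K -> `|usum D f| <= K.
Proof.
move=> /sbound_cabs /csum_le; exact: le_trans (Re_le_cabs _).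
Qed.

End RealUnorderedSums.

(** * Termwise differentiation of the energy *)

Section EnergyDerivative.
Variables (R : realType) (n : nat) (D : set 'cV[R]_n) (alpha : R).
Hypothesis alpha_gt0 : 0 < alpha.
Hypothesis gauss_bounded : forall m (b : R), 0 < b ->
  exists K, sbound D (fun x => dot x x ^+ m * expR (- (b * dot x x))) K.

Lemma expR_taylor2 (u : R) : `|expR u - 1 - u| <= u ^+ 2 * expR `|u|.
Proof.
have h1 := expR_ge1Dx u.
have h2 : expR u * (1 - u) <= 1.
  have := ler_wpM2l (expR_ge0 u) (expR_ge1Dx (- u)).
  by rewrite -expRD subrr expR0.
rewrite ger0_norm; last by lra.
apply: le_trans (_ : u * (expR u - 1) <= _); first by lra.
have [u0|u0] := leP 0 u.
  by rewrite ger0_norm// expr2 -mulrA ler_wpM2l//; lra.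
have e1 : 1 <= expR `|u| by rewrite -[leLHS]expR0 ler_expR.
apply: le_trans (_ : u ^+ 2 <= _); last by rewrite ler_peMr// sqr_ge0.
have e3 : u <= expR u - 1 by lra.
by have := ler_wnM2l (ltW u0) e3; rewrite expr2.
Qed.

Lemma mx_entry_le (M : 'M[R]_n) i j : `|M i j| <= `|M|.
Proof.
rewrite [leRHS]mx_normrE.
exact: (le_bigmax _ (fun ij : 'I_n * 'I_n => `|M ij.1 ij.2|) (i, j)).
Qed.

Lemma qform_norm_le (M : 'M[R]_n) x : `|qform M x| <= n%:R ^+ 2 * `|M| * dot x x.
Proof.
apply: le_trans (qform_le M x) _; rewrite ler_wpM2r ?dot_ge0//.
apply: le_trans (_ : \sum_(i < n) \sum_(j < n) `|M| <= _).
  by apply: ler_sum => i _; apply: ler_sum => j _; exact: mx_entry_le.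
by rewrite !sumr_const !card_ord -mulrnA -[leLHS]mulr_natl natrM -expr2.
Qed.

Lemma energy_derive (H : 'M[R]_n) (g : R -> 'M[R]_n) : g 0 = 1%:M ->
  is_derive (0 : R) 1 g H ->
  is_derive (0 : R) 1 (fun t => usum D (fun x => gauss alpha (qform (g t) x)))
    (- alpha * usum D (gradient_term alpha H)).
Proof.
have slope_error (h X Y Z : R) : h != 0 ->
    Z - h^-1 * (X - Y) = - (h^-1 * (X - Y - h * Z)) by move=> h0; field.
move=> g0 dg.
set E := fun t : R => usum D _; set G := - alpha * _.
pose G0 (x : 'cV[R]_n) := expR (- (alpha * dot x x)).
have G0n x : `|G0 x| = G0 x by rewrite ger0_norm// expR_ge0.
have [K0 hK0] := gauss_bounded 0 alpha_gt0.
have [K1 hK1] := gauss_bounded 1 alpha_gt0.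
have a2 : 0 < alpha / 2 by rewrite divr_gt0.
have [K2 hK2] := gauss_bounded 2 a2.
have [K3 hK3] := gauss_bounded 0 a2.
have K10 := sbound_ge0 hK1; have K20 := sbound_ge0 hK2.
pose c := n%:R ^+ 2 : R; have c0 : 0 <= c by rewrite /c sqr_ge0.
pose N := `|H| : R; have N0 : 0 <= N by exact: normr_ge0.
pose A := c * (N + 1); have A0 : 0 <= A by rewrite mulr_ge0// addr_ge0.
(* The number eta measures the deviation of g from its linear part, and A |h| bounds the relative
   change of the quadratic form. With A |h| <= 1 / 2 the exponent moves by at most half of itself,
   so a Gaussian of rate alpha / 2 dominates the quadratic remainder. *)
have key (h eta : R) : 0 <= eta -> eta <= 1 -> A * `|h| <= 1 / 2 ->
    `|g h - 1%:M - h *: H| <= eta * `|h| ->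
    `|E h - E 0 - h * G| <= `|h| * (alpha * c * eta * K1 + (alpha * A) ^+ 2 * `|h| * K2).
  move=> eta0 eta1 Ah gh.
  pose q (x : 'cV[R]_n) := dot x x; pose qh (x : 'cV[R]_n) := qform (g h) x.
  have q0 x : 0 <= q x by exact: dot_ge0.
  have d1 x : `|qh x - q x - h * qform H x| <= c * eta * `|h| * q x.
    have -> : qh x - q x - h * qform H x = qform (g h - 1%:M - h *: H) x.
      by rewrite !qformB qformZ qform1.
    apply: le_trans (qform_norm_le _ _) _; rewrite ler_wpM2r ?q0// -mulrA.
    by rewrite ler_wpM2l.
  have d2 x : `|qh x - q x| <= A * `|h| * q x.
    rewrite -(subrK (h * qform H x) (qh x - q x)); apply: le_trans (ler_normD _ _) _.
    have h1 : `|h * qform H x| <= `|h| * (c * N * q x).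
      by rewrite normrM ler_wpM2l// qform_norm_le.
    apply: le_trans (lerD (d1 x) h1) _.
    have : 0 <= c * `|h| * q x by rewrite !mulr_ge0.
    move=> h2; have := ler_wpM2r h2 eta1.
    rewrite /A; move: h2; set z := `|h|; lra.
  pose e (x : 'cV[R]_n) := gauss alpha (qh x).
  have eE x : e x = G0 x * expR (- (alpha * (qh x - q x))).
    by rewrite -expRD; congr expR; rewrite /q; ring.
  have u2 x : `|- (alpha * (qh x - q x))| <= alpha / 2 * q x.
    rewrite normrN normrM (gtr0_norm alpha_gt0) -mulrA ler_wpM2l ?(ltW alpha_gt0)//.
    apply: le_trans (d2 x) _; rewrite ler_wpM2r ?q0//; lra.
  have G02 x : G0 x * expR (alpha / 2 * q x) = expR (- (alpha / 2 * q x)).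
    by rewrite -expRD; congr expR; rewrite /q; field.
  have be : sbound D (fun x => `|e x|) K3.
    apply: sbound_le hK3 => x _; rewrite expr0 mul1r ger0_norm ?expR_ge0//.
    rewrite eE -/(q x) -G02 ler_wpM2l ?expR_ge0// ler_expR.
    exact: le_trans (ler_norm _) (u2 x).
  have b0 : sbound D (fun x => `|gauss alpha (q x)|) K0.
    by apply: sbound_le hK0 => x _; rewrite expr0 mul1r ger0_norm ?expR_ge0.
  have bG : sbound D (fun x => `|gradient_term alpha H x|) (c * N * K1).
    have cN : 0 <= c * N by rewrite mulr_ge0.
    apply: sbound_le (sboundZ cN hK1) => x _; rewrite expr1 mulrA normrM.
    rewrite (ger0_norm (expR_ge0 (- (alpha * dot x x)))) ler_wpM2r ?expR_ge0//.
    exact: qform_norm_le.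
  pose rest (x : 'cV[R]_n) := e x + (- 1 * gauss alpha (q x) + h * alpha * gradient_term alpha H x).
  have restE : E h - E 0 - h * G = usum D rest.
    have b0' : sbound D (fun x => `|- 1 * gauss alpha (q x)|) K0.
      by apply: sbound_le b0 => x _; rewrite mulN1r normrN.
    have ha0 : 0 <= `|h * alpha| by exact: normr_ge0.
    have bG' : sbound D (fun x => `|h * alpha * gradient_term alpha H x|)
        (`|h * alpha| * (c * N * K1)).
      by apply: sbound_le (sboundZ ha0 bG) => x _; rewrite -normrM.
    have b0G : sbound D (fun x => `|- 1 * gauss alpha (q x) +
        h * alpha * gradient_term alpha H x|) (K0 + `|h * alpha| * (c * N * K1)).
      by apply: sbound_le (sboundD b0' bG') => x _; exact: ler_normD.
    rewrite (usumD be b0G) (usumD b0' bG') (usumZ _ b0) (usumZ _ bG).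
    have -> : E 0 = usum D (fun x => gauss alpha (q x)).
      by congr usum; apply/funext => x; rewrite g0 qform1.
    rewrite -[usum D e]/(E h) /G.
    by move: (E h) (usum D _) (usum D _) => X Y Z; ring.
  rewrite restE; apply: usum_le.
  have w1 : 0 <= `|h| * (alpha * c * eta).
    by rewrite !mulr_ge0// ltW.
  have w2 : 0 <= `|h| * ((alpha * A) ^+ 2 * `|h|).
    by apply: mulr_ge0 => //; apply: mulr_ge0 => //; exact: sqr_ge0.
  have := sboundD (sboundZ w1 hK1) (sboundZ w2 hK2).
  rewrite (_ : _ + _ = `|h| * (alpha * c * eta * K1 + (alpha * A) ^+ 2 * `|h| * K2)); last by ring.
  apply: sbound_le => x _; rewrite -/(q x) -/(G0 x) expr1.
  pose u := - (alpha * (qh x - q x)).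
  have -> : rest x = G0 x * (expR u - 1 - u) -
      G0 x * (alpha * (qh x - q x - h * qform H x)).
    by rewrite /rest eE /gradient_term /gauss -/(q x) -/(G0 x) -/u /u; ring.
  apply: le_trans (ler_normB _ _) _; rewrite addrC; apply: lerD.
    rewrite !normrM (gtr0_norm alpha_gt0) G0n.
    rewrite (_ : `|h| * _ * _ = G0 x * (alpha * (c * eta * `|h| * q x))); last by ring.
    by rewrite ler_wpM2l ?expR_ge0// ler_wpM2l ?(ltW alpha_gt0).
  rewrite normrM G0n.
  apply: le_trans (ler_wpM2l (expR_ge0 _) (expR_taylor2 u)) _.
  apply: le_trans (_ : u ^+ 2 * expR (- (alpha / 2 * q x)) <= _).
    rewrite mulrCA ler_wpM2l ?sqr_ge0// -G02 ler_wpM2l ?expR_ge0// ler_expR.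
    exact: u2.
  rewrite mulrA ler_wpM2r ?expR_ge0//.
  have : `|u| <= alpha * (A * `|h| * q x).
    by rewrite /u normrN normrM (gtr0_norm alpha_gt0) ler_wpM2l ?(ltW alpha_gt0).
  move=> ul; have := ler_pM (normr_ge0 _) (normr_ge0 _) ul ul.
  rewrite -!expr2 real_normK ?num_real// => h1; apply: le_trans h1 _.
  by rewrite le_eqVlt; apply/orP; left; apply/eqP; ring.
have lim_g : (fun h : R => h^-1 *: (g h - g 0)) @ 0^' --> H.
  have := @ex_derive _ _ _ _ _ _ _ dg; have := @derive_val _ _ _ _ _ _ _ dg.
  rewrite /derive /derivable => dE cg; rewrite -[X in _ --> X]dE.
  have -> : (fun h : R => h^-1 *: (g h - g 0)) =
      (fun h : R => h^-1 *: ((g \o shift 0) (h *: 1) - g 0)).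
    by apply/funext => h /=; rewrite addr0 /GRing.scale /= mulr1.
  exact: cg.
have lim_E : (fun h : R => h^-1 *: ((E \o shift 0) (h *: 1) - E 0)) @ 0^' --> G.
  apply/cvgrPdist_le => e e0.
  (* Chosen so that the deviation of g from its linear part costs at most e / 2; the smallness of h
     takes care of the quadratic remainder. *)
  pose eta := Num.min 1 (e / 2 / (1 + alpha * c * K1)).
  have b1 : 0 < 1 + alpha * c * K1 by rewrite ltr_wpDr// !mulr_ge0// ltW.
  have eta0 : 0 < eta by rewrite lt_min ltr01 !divr_gt0.
  have eta1 : eta <= 1 by rewrite ge_min lexx.
  have b2 : 0 < 1 + (alpha * A) ^+ 2 * K2 by rewrite ltr_wpDr//; apply: mulr_ge0 => //; exact: sqr_ge0.
  have b3 : 0 < 1 + A by rewrite ltr_wpDr.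
  near=> h.
  have hn0 : h != 0 by near: h; exact: nbhs_dnbhs_neq.
  have h1 : `|h| <= e / 2 / (1 + (alpha * A) ^+ 2 * K2).
    by near: h; apply: dnbhs0_le; rewrite !divr_gt0.
  have h2 : `|h| <= 1 / 2 / (1 + A).
    by near: h; apply: dnbhs0_le; rewrite !divr_gt0.
  have h3 : `|H - h^-1 *: (g h - g 0)| <= eta.
    by near: h; move/cvgrPdist_le : lim_g => /(_ _ eta0).
  have hp : 0 < `|h| by rewrite normr_gt0.
  have gh : `|g h - 1%:M - h *: H| <= eta * `|h|.
    have -> : g h - 1%:M - h *: H = - (h *: (H - h^-1 *: (g h - g 0))).
      by rewrite g0 scalerBr scalerA divff// scale1r opprB.
    by rewrite normrN normrZ mulrC ler_wpM2r.
  have Ah : A * `|h| <= 1 / 2.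
    have := h2; rewrite ler_pdivlMr// => h2'.
    by apply: le_trans h2'; rewrite mulrC ler_wpM2l// lerDr.
  have := key h eta (ltW eta0) eta1 Ah gh.
  rewrite /= addr0 {1 2}/GRing.scale /= mulr1 => kh.
  rewrite (slope_error _ _ _ _ hn0).
  rewrite normrN normrM normfV ler_pdivrMl//; apply: le_trans kh _.
  rewrite ler_wpM2l// [leRHS]splitr; apply: lerD.
    have : eta <= e / 2 / (1 + alpha * c * K1) by rewrite ge_min lexx orbT.
    rewrite ler_pdivlMr// => h4; apply: le_trans h4.
    by rewrite (_ : alpha * c * eta * K1 = eta * (alpha * c * K1)); [rewrite ler_wpM2l ?(ltW eta0)// lerDr|ring].
  have := h1; rewrite ler_pdivlMr// => h4; apply: le_trans h4.
  by rewrite -mulrA mulrCA ler_wpM2l// lerDr.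
have dE := cvg_lim (@Rhausdorff R) lim_E.
by split; [apply/cvg_ex; exists G; exact: lim_E|exact: dE].
Unshelve. all: by end_near.
Qed.

End EnergyDerivative.

Theorem mainTheorem1 (R : realType) (n : nat)
    (hn : n = 8%N \/ n = 16%N \/ n = 24%N)
    (L : set 'cV[R]_n) (latL : is_lattice L)
    (evenL : even_lattice L) (unimodL : unimodular L)
    (alpha : R) (alpha_gt0 : 0 < alpha) :
  critical alpha L.
Proof.
move=> H [_ trH]; case: latL => L0 LB _ [B uB LB'].
have Lint x y : L x -> L y -> dot x y \is a Num.int.
  by move=> Lx; rewrite {1}unimodL; exact.
have Ldual x : (forall y, L y -> dot x y \is a Num.int) -> L x.
  by move=> h; rewrite unimodL => y Ly; rewrite dotC; exact: h.
have even_dot x : L x -> exists k : nat, dot x x = (2 * k)%:R.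
  move=> /evenL[z zE]; have := dot_ge0 x; rewrite zE ler0z => z0.
  by exists `|z|%N; rewrite natrM natr_absz ger0_norm ?intrM//; lia.
have [d [v fv]] := frame_exists L0 LB Lint uB LB'.
have bounded := sbound_theta Lint fv H.
have [k k0 functional] := theta_functional L0 LB Lint Ldual fv trH.
have [j nj j3] : exists2 j, n = (8 * j)%N & (j <= 3)%N.
  by case: hn => [->|[->|->]]; [exists 1%N|exists 2|exists 3].
pose w : R[i] := (alpha / pi)%:C.
have w0 : 0 < complex.Re w by rewrite /= divr_gt0// pi_gt0.
have th0 := theta_eq0 even_dot bounded nj j3 k0 functional w0.
have termE x : theta_term H w x = (gradient_term alpha H x)%:C.
  rewrite /theta_term (_ : - _ = (- (alpha * dot x x))%:C).
    by rewrite cexp_real -rmorphM.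
  by rewrite -!rmorphM -rmorphN mulrCA divff ?mulr1// gt_eqF// pi_gt0.
have [K hK] := bounded _ w0; have {}hK := hK w (lexx _).
have usum0 : usum (L `\ 0) (gradient_term alpha H) = 0.
  rewrite usumE (_ : (fun x => (gradient_term alpha H x)%:C) = theta_term H w).
    by rewrite (csum_setD1 hK) -/(theta L H w) ?th0// /theta_term qform0 mul0r.
  by apply/funext => x; rewrite termE.
have sub : L `\ 0 `<=` L by move=> x [].
split.
- apply: (sbound_summable (K := K)); apply: sbound_le (sbound_sub sub hK) => x _.
  by rewrite termE cabs_real.
- move=> g [_ g0 dg]; apply: energy_derive => // m b b0.
  have [K' hK'] := sbound_monomial_gauss Lint fv m b0.
  by exists K'; exact: sbound_sub sub hK'.
- by rewrite /gradient_along -[lattice_sum _ _]/(usum _ _) usum0 mulr0.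
Qed.
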